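(* Let $q\in\{1,2,3\}$ and $k=q+1$. Then the generalized Chazy differential system $$\dot x=y,\qquad \dot y=z,\qquad \dot z=-|x|^q z-\frac{k|x|^q}{x}\,y^2$$ in $\mathbb{R}^3$ has an invariant cylinder foliated by periodic orbits.
   Context: The system is the first-order form, with $(x,y,z)=(x,\dot x,\ddot x)$, of the generalized Chazy differential equation $\dddot x+|x|^q\ddot x+\frac{k|x|^q}{x}\dot x^2=0$. For $q>1$ the function $|x|^q/x$ is extended by $0$ at $x=0$; the system is polynomial for $q$ even and continuous for $q>1$ odd. For $q=1$ the system is discontinuous on $x=0$ (there $|x|/x=\operatorname{sign}(x)$ for $x\neq 0$) and its trajectories are understood according to Filippov's convention. ''Invariant cylinder foliated by periodic orbits'' means an invariant topological cylinder in the $(x,y,z)$-space, i.e. an invariant subset $C\subset\mathbb{R}^3$ homeomorphic to $S^1\times\mathbb{R}$, which is a disjoint union of (non-constant) periodic orbits of the system, these orbits being the circles of the cylinder (the images of the sets $S^1\times\{s\}$ under a homeomorphism $S^1\times\mathbb{R}\to C$). *)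

(* Defs.v *)
From HB Require Import structures.
From mathcomp Require Import all_boot all_order all_algebra.
From mathcomp Require Import all_classical all_reals all_analysis.

Set Implicit Arguments.
Unset Strict Implicit.
Unset Printing Implicit Defensive.

Import Order.TTheory GRing.Theory Num.Theory.
Import numFieldNormedType.Exports.

Local Open Scope classical_set_scope.
Local Open Scope ring_scope.

(* The topology and norm are those of the product (sup norm); the choice of
   norm on R^3 plays no role in the definitions below. *)
Notation phase_space R := (R * R * R)%type.

Definition lebesgue3 (R : realType) : set (phase_space R) -> \bar R :=
  ((@lebesgue_measure R \x @lebesgue_measure R) \x @lebesgue_measure R)%E.

(* Division by 0 yields 0, so `|x| ^+ q / x is 0 at x = 0 for every q.  For
   q > 1 this is the continuous extension; for q = 1 the value on the null set
   x = 0 is irrelevant to the Filippov set below. *)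
Definition chazy (R : realType) (q : nat) (k : R) (p : phase_space R) :
    phase_space R :=
  let: (x, y, z) := p in
  (y, z, - `|x| ^+ q * z - k * `|x| ^+ q / x * y ^+ 2).

Definition classical_trajectory (R : realType)
    (f : phase_space R -> phase_space R)
    (I : set R) (g : R -> phase_space R) : Prop :=
  forall t : R, I t -> is_derive t (1 : R) g (f (g t)).

Definition closed_convex_hull (R : realType) (A : set (phase_space R)) :
    set (phase_space R) :=
  smallest
    [set B : set (phase_space R) | @convex_set R (phase_space R) B /\ closed B]
    A.

(* Filippov's set-valued regularization of f, for which trajectories are the
   locally absolutely continuous solutions of g'(t) \in filippov f (g t). *)
Definition filippov (R : realType) (f : phase_space R -> phase_space R)
    (p : phase_space R) : set (phase_space R) :=
  \bigcap_(d in [set d : R | 0 < d])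
  \bigcap_(N in [set N : set (phase_space R) | (@lebesgue3 R).-negligible N])
    closed_convex_hull (f @` (ball p d `\` N)).

Definition abs_continuous (R : realType) (a b : R) (g : R -> phase_space R) : Prop :=
  forall e : R, 0 < e -> exists2 d : R, 0 < d &
    forall (n : nat) (u v : 'I_n -> R),
      (forall i, a <= u i /\ u i <= v i /\ v i <= b) ->
      trivIset setT (fun i => `]u i, v i[%classic) ->
      \sum_(i < n) (v i - u i) < d ->
      \sum_(i < n) `|g (v i) - g (u i)| < e.

Definition filippov_trajectory (R : realType)
    (f : phase_space R -> phase_space R)
    (I : set R) (g : R -> phase_space R) : Prop :=
  (forall a b : R, `[a, b] `<=` I -> abs_continuous a b g) /\
  {ae @lebesgue_measure R, forall t : R, I t ->
     exists2 v, filippov f (g t) v & is_derive t (1 : R) g v}.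

Definition chazy_trajectory (R : realType) (q : nat) (k : R) (I : set R)
    (g : R -> phase_space R) : Prop :=
  if q == 1%N then filippov_trajectory (chazy q k) I g
  else classical_trajectory (chazy q k) I g.

(* In the definitions below, [traj I g] reads: g, restricted to the open
   interval I, is a trajectory of the system. *)

Definition periodic_orbit (R : realType)
    (traj : set R -> (R -> phase_space R) -> Prop) (O : set (phase_space R)) : Prop :=
  exists (g : R -> phase_space R) (T : R),
    [/\ traj setT g, 0 < T, (forall t, g (t + T) = g t),
        (exists t, g t <> g 0) & O = range g].

(* Trajectories are not assumed to be unique: every trajectory that meets C
   is required to stay in C, in forward and in backward time. *)
Definition invariant_set (R : realType) (traj : set R -> (R -> phase_space R) -> Prop)
    (C : set (phase_space R)) : Prop :=
  forall (I : set R) (g : R -> phase_space R), open I -> is_interval I -> traj I g ->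
    forall t0 : R, I t0 -> C (g t0) -> forall t : R, I t -> C (g t).

Definition circle (R : realType) : set (R * R)%type :=
  [set u | u.1 ^+ 2 + u.2 ^+ 2 = 1].

Definition homeomorphism (U V : topologicalType) (A : set U) (B : set V)
    (f : U -> V) : Prop :=
  [/\ set_bij A B f, {within A, continuous f} &
      exists2 h : V -> U, {within B, continuous h} & {in A, cancel f h}].

(* The sets phi (S^1 x {s}) are automatically disjoint and cover C, since phi
   is a bijection from S^1 x R onto C. *)
Definition invariant_cylinder_foliated_by_periodic_orbits (R : realType)
    (traj : set R -> (R -> phase_space R) -> Prop) (C : set (phase_space R)) : Prop :=
  invariant_set traj C /\
  exists phi : (R * R) * R -> phase_space R,
    homeomorphism (@circle R `*` setT) C phi /\
    forall s : R, periodic_orbit traj (phi @` (@circle R `*` [set s])).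

(* Main.v *)
Require Import Defs.
From mathcomp Require Import all_boot all_order all_algebra.
From mathcomp Require Import all_classical all_reals all_analysis.
From mathcomp Require Import measurable_realfun ring lra.
Import Order.TTheory GRing.Theory Num.Theory.
Import numFieldNormedType.Exports.
Local Open Scope classical_set_scope.
Local Open Scope ring_scope.

(* Let [a = |x|^q].  In the coordinates [(x, y, Z)], [Z = z + (q + 1) / q * a * y],
   the system becomes [x' = y], [y' = z], [Z' = a * z / q], which is odd and
   locally Lipschitz even for [q = 1]; so trajectories are unique, Filippov ones
   included.  It commutes with the scalings
   [(x, y, Z) -> (l x, l^(q+1) y, l^(2q+1) Z)], [t -> t / l^q].  Hence one periodic
   orbit is enough: its images under the scalings lie on distinct levels of the
   first integral [x Z - x a y / q - y^2 / 2] and sweep out the cylinder.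
   The orbit is found by shooting.  The trajectory of [(1, 0, - b^2 / 2)] reaches
   [x = 0] in both time directions, with [y = - b] in the future and [y = b] in
   the past, and by oddness it is continued by its own mirror image as soon as
   the two end values of [Z] are opposite.  Their sum depends continuously on
   [b], is negative for [b = 3] and positive for small [b]. *)

Set Implicit Arguments.
Unset Strict Implicit.
Unset Printing Implicit Defensive.

(** * Real analysis *)

(** The choice [k = q + 1] is what makes [Z] work: differentiating [|x|^q * y] produces
    [q * |x|^q / x * y^2], and the factor [(q + 1) / q] makes it cancel the only term of the field
    that jumps at [x = 0] when [q = 1]. Along Filippov trajectories this cancellation is available
    only almost everywhere. Crossings of [x = 0] with [y <> 0] are isolated, hence negligible; on
    the line [x = y = 0], where a trajectory may linger, [|x| * y] is still differentiable and the
    field is continuous. Uniqueness therefore goes through a mean value inequality that tolerates a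
    null set of times. The start [(1, 0, - b^2 / 2)] gives the first integral the value [- b^2 / 2],
    and on [x = 0] the first integral is [- y^2 / 2]: the end values of [y] follow from
    conservation, and one scalar condition on [Z] remains. The estimates deciding its sign rest on
    [w = z + |x|^q * y], whose derivative [- |x|^q / x * y^2] has constant sign while [x >= 0]. *)

Lemma cousin_induction (R : realType) (P : R -> R -> Prop) (a b : R) :
  a <= b ->
  (forall u v w, a <= u -> u <= v -> v <= w -> w <= b ->
     P u v -> P v w -> P u w) ->
  (forall t, a <= t -> t <= b -> exists2 d, 0 < d &
     forall u v, a <= u -> u <= t -> t <= v -> v <= b ->
       t - d < u -> v < t + d -> P u v) ->
  P a b.
Proof.
move=> ab Ptr Ploc.
(* The supremum [s] of [S] is reached and cannot lie below [b], since the local hypothesis at [s]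
   extends [P a] past it. This inductive form of compactness carries most passages from local to
   global below. *)
pose S := [set t | a <= t <= b /\ P a t].
have Sa : S a.
  split; first by rewrite lexx ab.
  by have [d d0] := Ploc a (lexx a) ab; apply; rewrite ?lexx ?ltrDl ?gtrBl.
have Sub : ubound S b by move=> t [/andP[_ tb] _].
have hS : has_sup S by split; [exists a | exists b].
pose s := sup S.
have as_ : a <= s by apply: ub_le_sup => //; exists b.
have sb : s <= b by apply: ge_sup => //; exists a.
have [d d0 Pd] := Ploc s as_ sb.
have [u [/andP[au ub] Pu] su] := sup_adherent d0 hS.
have us : u <= s by apply: ub_le_sup => //; [exists b | split; rewrite ?au].
have Ps v : s <= v -> v <= b -> v < s + d -> P a v.
  move=> sv vb vd; apply: (Ptr a u v) => //; first exact: (le_trans us).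
  exact: Pd.
have [sb'|bs] := ltP s b; last first.
  by apply: Ps => //; apply: (le_lt_trans bs); rewrite ltrDl.
pose v := Num.min b (s + d / 2).
have sv : s < v by rewrite lt_min sb' ltrDl divr_gt0.
have vb : v <= b by rewrite ge_min lexx.
have : v <= s.
  apply: ub_le_sup; first by exists b.
  split; first by rewrite vb (le_trans as_ (ltW sv)).
  apply: Ps => //; first exact: ltW.
  rewrite gt_min; apply/orP; right; lra.
by rewrite leNgt sv.
Qed.


Lemma is_deriveP (R : realType) (V : normedModType R) (f : R -> V) (t : R) (v : V) :
  is_derive t 1 f v <->
  (forall e : R, 0 < e -> exists2 d : R, 0 < d & forall s, `|s - t| < d ->
     `|f s - f t - (s - t) *: v| <= e * `|s - t|).
Proof.
have key (h : R) : h != 0 ->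
    `|v - h^-1 *: ((f \o shift t) (h *: 1) - f t)|
    = `|h|^-1 * `|f (h + t) - f t - h *: v|.
  move=> h0; rewrite /= -[h *: 1]/(h * 1) mulr1.
  rewrite distrC -normfV -normrZ scalerBr.
  by rewrite -scalerBr [in RHS]scalerBr [h^-1 *: (h *: v)]scalerA mulVf// scale1r.
split.
  move=> [df dv] e e0.
  have : (h^-1 *: ((f \o shift t) (h *: 1) - f t)) @[h --> 0^'] --> v.
    by rewrite -dv; exact: df.
  move/cvgrPdist_le => /(_ e e0) [d /= d0 H].
  exists d => // s st.
  have [->|st0] := eqVneq s t; first by rewrite !subrr scale0r subr0 !normr0 mulr0.
  have h0 : s - t != 0 by rewrite subr_eq0.
  have := H (s - t); rewrite /ball /= sub0r normrN => /(_ st h0).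
  by rewrite key// subrK mulrC ler_pdivrMr ?normr_gt0// => /le_trans; apply.
move=> H.
have C : (h^-1 *: ((f \o shift t) (h *: 1) - f t)) @[h --> 0^'] --> v.
  apply/cvgrPdist_le => e e0; have [d d0 Hd] := H e e0.
  exists d => // h; rewrite /ball /= sub0r normrN => hd h0.
  rewrite key// mulrC ler_pdivrMr ?normr_gt0//.
  by have := Hd (h + t); rewrite addrK; apply.
by split; [apply/cvg_ex; exists v | exact: cvg_lim].
Qed.

Lemma subr_shuffle (V : zmodType) (A B C p q : V) :
  A - B = (A - C - p) - (B - C - q) + (p - q).
Proof.
rewrite opprB [q - _]addrC (addrACA (A - C)) [- p + q]addrC -[RHS]addrA.
by rewrite subrKA subrr addr0 opprB addrA subrK.
Qed.

Section mean_value.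
Context {R : realType} {V : normedModType R}.
Implicit Types (f : R -> V) (phi : R -> R).

(** Vector-valued curves have no mean value equality, so the bound is propagated by
    [cousin_induction] with an extra slope [e1], whose total contribution is at most the arbitrary
    [e]. A general comparison function [phi] admits non-constant bounds on the speed, as in
    [exp_weight]. *)
Lemma mean_value_ineq f phi (df : R -> V) (dphi : R -> R) (a b : R) :
  a <= b ->
  (forall t, a <= t <= b -> is_derive t 1 f (df t)) ->
  (forall t, a <= t <= b -> is_derive t 1 phi (dphi t)) ->
  (forall t, a <= t <= b -> `|df t| <= dphi t) ->
  `|f b - f a| <= phi b - phi a.
Proof.
move=> ab Hf Hphi Hle; apply/ler_addgt0Pr => e e0.
(* The added 1 keeps the denominator positive when [a = b]. *)
pose e1 := e / (b - a + 1).
have e10 : 0 < e1 by rewrite divr_gt0// ltr_wpDl ?subr_ge0.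
have : `|f b - f a| <= phi b - phi a + e1 * (b - a).
  apply: (@cousin_induction R (fun u v =>
    `|f v - f u| <= phi v - phi u + e1 * (v - u)) a b) => //.
    move=> u v w _ _ _ _ H1 H2; rewrite -(subrKA (f v)).
    by apply: (le_trans (ler_normD _ _)); lra.
  move=> t at_ tb; have tab : a <= t <= b by rewrite at_.
  have e20 : 0 < e1 / 2 by rewrite divr_gt0.
  have [d1 d10 H1] := (is_deriveP _ _ _).1 (Hf t tab) _ e20.
  have [d2 d20 H2] := (is_deriveP _ _ _).1 (Hphi t tab) _ e20.
  exists (Num.min d1 d2); first by rewrite lt_min d10.
  move=> u v au ut tv vb; rewrite !ltrBlDr -!ltrBlDl => ud vd.
  move: ud vd; rewrite !lt_min => /andP[ud1 ud2] /andP[vd1 vd2].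
  have ut' : `|u - t| = t - u by rewrite distrC ger0_norm ?subr_ge0.
  have vt' : `|v - t| = v - t by rewrite ger0_norm ?subr_ge0.
  have Fu : `|f u - f t - (u - t) *: df t| <= e1 / 2 * (t - u).
    by have := H1 u; rewrite ut'; apply; lra.
  have Fv : `|f v - f t - (v - t) *: df t| <= e1 / 2 * (v - t).
    by have := H1 v; rewrite vt'; apply; lra.
  have Pu : `|phi u - phi t - (u - t) * dphi t| <= e1 / 2 * (t - u).
    by have := H2 u; rewrite ut'; apply; lra.
  have Pv : `|phi v - phi t - (v - t) * dphi t| <= e1 / 2 * (v - t).
    by have := H2 v; rewrite vt'; apply; lra.
  have -> : f v - f u = (f v - f t - (v - t) *: df t)
     - (f u - f t - (u - t) *: df t) + (v - u) *: df t.
    have -> : v - u = (v - t) - (u - t) by ring.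
    by rewrite [(v - t - (u - t)) *: _]scalerBl; exact: subr_shuffle.
  have : `|(v - u) *: df t| <= (v - u) * dphi t.
    by rewrite normrZ ger0_norm ?subr_ge0 ?(le_trans ut)// ler_wpM2l ?Hle// subr_ge0 (le_trans ut).
  move: Fu Fv; set x := _ - _ *: _; set y := _ - _ *: _; set z := _ *: df t.
  move=> Hx Hy Hz; apply: (le_trans (ler_normD _ _)).
  have := ler_normB y x.
  move: Pu Pv; rewrite !ler_norml => /andP[P1 P2] /andP[P3 P4]; lra.
have : e1 * (b - a) <= e.
  by rewrite /e1 mulrAC ler_pdivrMr ?ler_wpM2l ?ltr_wpDl ?lerDl ?subr_ge0// ltW.
lra.
Qed.

End mean_value.

Section barriers.
Context {R : realType}.

Lemma is_derive_continuous (V : normedModType R) (f : R -> V) (t : R) (v : V) :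
  is_derive t 1 f v -> {for t, continuous f}.
Proof. by move=> [/derivable1_diffP df _]; exact: differentiable_continuous. Qed.

Lemma for_continuousP (V : normedModType R) (f : R -> V) (t : R) :
  {for t, continuous f} <->
  forall e : R, 0 < e -> exists2 d : R, 0 < d &
    forall s, `|s - t| < d -> `|f s - f t| < e.
Proof.
split.
  move=> /cvgrPdist_lt H e e0; have [d /= d0 Hd] := H e e0.
  by exists d => // s st; rewrite distrC; apply: Hd; rewrite /ball /= distrC.
move=> H; apply/cvgrPdist_lt => e e0; have [d d0 Hd] := H e e0.
by exists d => // s; rewrite /ball /= => st; rewrite distrC; apply: Hd; rewrite distrC.
Qed.

Lemma nonincreasing_of_derive (f df : R -> R) (a b : R) : a <= b ->
  (forall t, a <= t <= b -> is_derive t 1 f (df t)) ->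
  (forall t, a <= t <= b -> df t <= 0) -> f b <= f a.
Proof.
move=> ab Hf Hle.
have [||c cab /eqP] := @MVT_segment _ f df a b ab.
- by move=> x /subset_itv_oo_cc xab; apply: Hf; rewrite in_itv in xab.
- by apply: derivable_within_continuous => x xab; have [] := Hf x _; rewrite ?in_itv in xab *.
rewrite subr_eq => /eqP ->; rewrite gerDr mulr_le0_ge0 ?subr_ge0 ?Hle//.
Qed.

(** At a zero of [g] the positive derivative makes [g] nonnegative just afterwards; elsewhere
    continuity keeps the sign. The condition on [dg] concerns contact times only, which is where the
    energy identity gives information. *)
Lemma barrier (g dg : R -> R) (a b : R) : a <= b -> 0 <= g a ->
  (forall t, a <= t <= b -> is_derive t 1 g (dg t)) ->
  (forall t, a <= t <= b -> g t = 0 -> 0 < dg t) -> 0 <= g b.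
Proof.
move=> ab ga Hg H0.
apply: (@cousin_induction R (fun u v => 0 <= g u -> 0 <= g v) a b) => //.
  by move=> u v w _ _ _ _ H1 H2 /H1.
move=> t at_ tb; have tab : a <= t <= b by rewrite at_.
have [gt0|gt0|gt0] := ltgtP (g t) 0.
- have /for_continuousP /(_ (- g t)) := is_derive_continuous (Hg t tab).
  rewrite oppr_gt0 => /(_ gt0)[d d0 Hd]; exists d => // u v au ut tv vb ud vd gu.
  have := Hd u; rewrite distrC ger0_norm ?subr_ge0// ltrBlDr -ltrBlDl => /(_ ud).
  by rewrite ltr_norml => /andP[_]; lra.
- have /for_continuousP /(_ _ gt0) := is_derive_continuous (Hg t tab).
  move=> [d d0 Hd]; exists d => // u v au ut tv vb ud vd gu.
  have := Hd v; rewrite ger0_norm ?subr_ge0// ltrBlDl => /(_ vd).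
  by rewrite ltr_norml => /andP[]; lra.
- have D0 := H0 t tab gt0.
  (* An error ratio equal to [dg t] itself is just small enough to leave [g v >= 0] to the right of
     [t]. *)
  have [d d0 Hd] := (is_deriveP _ _ _).1 (Hg t tab) _ D0.
  exists d => // u v au ut tv vb ud vd gu.
  have := Hd v; rewrite ger0_norm ?subr_ge0// ltrBlDl => /(_ vd).
  rewrite gt0 subr0 -[_ *: _]/(_ * _) ler_norml => /andP[+ _].
  have -> : - (dg t * (v - t)) = - ((v - t) * dg t) by ring.
  lra.
Qed.

(** The order on the list leaves every later interval inside [[p.2, v[], so the first one can be
    peeled off. The result converts a small measure of [U] into the small total length that absolute
    continuity asks for. *)
Lemma open_intervals_measure (U : set R) (u v : R) (l : seq (R * R)) :
  open U -> u <= v ->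
  (forall p, p \in l -> [/\ u <= p.1, p.1 <= p.2, p.2 <= v & `]p.1, p.2[ `<=` U]) ->
  pairwise (fun p p' : R * R => p.2 <= p'.1) l ->
  ((\sum_(p <- l) (p.2 - p.1))%:E <= lebesgue_measure (U `&` `[u, v[))%E.
Proof.
move=> oU; elim: l u => [|p l IH] u uv Hl.
  by rewrite big_nil.
rewrite big_cons pairwise_cons => /andP[/allP pl Pl].
have [up p12 pv pU] := Hl p (mem_head _ _).
have mU : measurable U by exact: open_measurable.
have {}IH := IH p.2 pv _ Pl.
have -> : ((p.2 - p.1 + \sum_(j <- l) (j.2 - j.1))%:E =
   lebesgue_measure (`]p.1, p.2[ : set R) + (\sum_(j <- l) (j.2 - j.1))%:E)%E.
  by rewrite lebesgue_measure_itv /= lte_fin EFinD; case: ltgtP p12 => // ->; rewrite subrr.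
apply: (@le_trans _ _ (lebesgue_measure (`]p.1, p.2[ : set R) +
  lebesgue_measure (U `&` `[p.2, v[))%E).
  apply: leeD => //; apply: IH => r rl.
  have [_ r12 rv rU] := Hl r (mem_behead (s := p :: l) rl).
  by split => //; exact: pl.
rewrite -measureU//; last 2 first.
- by apply: measurableI.
- apply/seteqP; split => // x []; rewrite /= !in_itv /= => /andP[_ xp] [_ /andP[px _]].
  by move: xp; rewrite ltNge px.
apply: le_measure; rewrite ?inE.
- by apply: measurableU => //; apply: measurableI.
- by apply: measurableI.
- move=> x [|[Ux]]; rewrite /= !in_itv /= => /andP[px xp]; split => //.
  + by apply: pU; rewrite /= in_itv /= px.
  + by rewrite (le_trans up (ltW px)) (lt_le_trans xp).
  + by rewrite xp (le_trans _ px)// (le_trans up).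
Qed.

End barriers.

(** The derivative is never integrated: ordinary times obey the slope bound locally, and the
    exceptional ones are enclosed in an open set so small that absolute continuity controls the
    curve there. This is the form of [mean_value_ineq] that Filippov trajectories admit. *)
Lemma abs_continuous_mean_value (R : realType) (g : R -> phase_space R) (a b M : R) :
  a <= b -> 0 <= M -> abs_continuous a b g ->
  {ae @lebesgue_measure R, forall t : R, a <= t <= b ->
     exists2 v, is_derive t (1 : R) g v & `|v| <= M} ->
  `|g b - g a| <= M * (b - a).
Proof.
move=> ab M0 gAC [A [mA A0 NA]].
apply/ler_addgt0Pr => e e0.
pose e1 := e / 2 / (b - a + 1).
have ba0 : 0 < b - a + 1 by rewrite ltr_wpDl ?subr_ge0.
have e10 : 0 < e1 by rewrite !divr_gt0.
have e20 : 0 < e / 2 by rewrite divr_gt0.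
have [d d0 Hd] := gAC (e / 2) e20.
have A_oo : (lebesgue_measure A < +oo)%E by rewrite A0 ltry.
have [U [oU AU Ud]] := lebesgue_regularity_outer mA A_oo d0.
have mU : measurable U by exact: open_measurable.
have {}Ud : (lebesgue_measure U < d%:E)%E.
  apply: le_lt_trans Ud; rewrite -[leRHS]adde0 -A0.
  apply: le_trans (measureU2 _ _ _) => //; last exact: measurableD.
  by apply: le_measure; rewrite ?inE//; [apply: measurableU => //; exact: measurableD|
    move=> x Ux; have [|] := pselect (A x); [right|left]].
(* [P u v] tolerates the increments over finitely many intervals inside the small
   open set [U]; their total is small by absolute continuity. *)
pose P u v := exists l : seq (R * R),
  [/\ forall p, p \in l -> [/\ u <= p.1, p.1 <= p.2, p.2 <= v & `]p.1, p.2[ `<=` U],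
      pairwise (fun p p' : R * R => p.2 <= p'.1) l
    & `|g v - g u| <= (M + e1) * (v - u) + \sum_(p <- l) `|g p.2 - g p.1| ].
have : P a b.
  apply: cousin_induction => //.
    move=> u v w _ uv vw _ [l1 [H1 L1 S1]] [l2 [H2 L2 S2]]; exists (l1 ++ l2); split.
    - move=> p; rewrite mem_cat => /orP[/H1[? ? ? ?]|/H2[? ? ? ?]]; split => //.
        by rewrite (le_trans _ vw).
      by rewrite (le_trans uv).
    - rewrite pairwise_cat L1 L2 !andbT; apply/allrelP => p p' /H1[_ _ pv _] /H2[vp _ _ _].
      exact: le_trans vp.
    - rewrite big_cat /= -(subrKA (g v)).
      by apply: (le_trans (ler_normD _ _)); lra.
  move=> t at_ tb; have tab : a <= t <= b by rewrite at_.
  have [tA|tA] := pselect (A t).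
    have /nbhs_ballP[r /= r0 rU] : nbhs t U by apply: open_nbhs_nbhs; split => //; exact: AU.
    exists r => // u v au ut tv vb ur vr; exists [:: (u, v)]; split => //.
    - move=> p; rewrite inE => /eqP -> /=; split => //; first exact: le_trans tv.
      move=> x /=; rewrite in_itv /= => /andP[ux xv]; apply: rU.
      by rewrite /ball /= ltr_norml; lra.
    - by rewrite big_seq1 /= lerDr mulr_ge0 ?subr_ge0 ?(le_trans ut)// addr_ge0// ltW.
  have [v dv vM] : exists2 v, is_derive t (1 : R) g v & `|v| <= M.
    by apply: contrapT => H; apply: tA; apply: NA => /(_ tab).
  have [r r0 Hr] := (is_deriveP _ _ _).1 dv _ e10.
  exists r => // u w au ut tw wb ur wr; exists [::]; split => //.
  rewrite big_nil addr0.
  have Hu := Hr u; rewrite (distrC u) ger0_norm ?subr_ge0// in Hu.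
  have Hw := Hr w; rewrite ger0_norm ?subr_ge0// in Hw.
  have ur' : t - u < r by rewrite ltrBlDl addrC -ltrBlDl.
  have wr' : w - t < r by rewrite ltrBlDl.
  have {}Hu := Hu ur'; have {}Hw := Hw wr'.
  have -> : g w - g u = (g w - g t - (w - t) *: v)
     - (g u - g t - (u - t) *: v) + (w - u) *: v.
    have -> : w - u = (w - t) - (u - t) by ring.
    by rewrite [(w - t - (u - t)) *: _]scalerBl; exact: subr_shuffle.
  have : `|(w - u) *: v| <= (w - u) * M.
    by rewrite normrZ ger0_norm ?ler_wpM2l ?subr_ge0// (le_trans ut).
  move: Hu Hw; set x := _ - _ *: _; set y := _ - _ *: _; set z := _ *: v.
  move=> Hx Hy Hz; apply: (le_trans (ler_normD _ _)).
  apply: le_trans (lerD (le_trans (ler_normB _ _) (lerD Hy Hx)) Hz) _.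
  by rewrite le_eqVlt; apply/orP; left; apply/eqP; ring.
move=> [l [Hl Pl Sl]].
have Ld : \sum_(p <- l) (p.2 - p.1) < d.
  rewrite -lte_fin (le_lt_trans (open_intervals_measure oU ab Hl Pl))//.
  by apply: le_lt_trans Ud; apply: le_measure; rewrite ?inE//; exact: measurableI.
have : \sum_(p <- l) `|g p.2 - g p.1| < e / 2.
  rewrite (big_nth (0, 0)) big_mkord.
  apply: (Hd _ (fun i : 'I_(size l) => (nth (0, 0) l i).1)
               (fun i : 'I_(size l) => (nth (0, 0) l i).2)).
  - by move=> i; have [] := Hl _ (mem_nth (0, 0) (ltn_ord i)).
  - apply/trivIsetP => i j _ _.
    wlog ij : i j / (i < j)%N.
      move=> W ij; move: (ij); rewrite neq_ltn => /orP[/W|/W]; first exact.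
      by rewrite setIC eq_sym; apply.
    move=> _; apply/seteqP; split => // x []; rewrite /= !in_itv /=.
    move=> /andP[_ xi] /andP[jx _].
    have /(pairwiseP (0, 0)) := Pl.
    move=> /(_ i j (ltn_ord i) (ltn_ord j) ij) H.
    by have := lt_trans (lt_le_trans xi H) jx; rewrite ltxx.
  - by move: Ld; rewrite (big_nth (0, 0)) big_mkord.
have : e1 * (b - a) <= e / 2.
  by rewrite /e1 mulrAC ler_pdivrMr// ler_wpM2l ?ltW ?divr_gt0 // ?ltrDl.
lra.
Qed.

Section differentiation.
Context {R : realType}.

Lemma der_cst (c t : R) : is_derive t 1 (fun=> c) 0.
Proof. exact: is_derive_cst. Qed.

Lemma der_id (t : R) : is_derive t 1 (fun s => s) 1.
Proof. exact: is_derive_id. Qed.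

Lemma derD (f g : R -> R) (t df dg : R) : is_derive t 1 f df ->
  is_derive t 1 g dg -> is_derive t 1 (fun s => f s + g s) (df + dg).
Proof. by move=> Hf Hg; exact: is_deriveD. Qed.

Lemma derB (f g : R -> R) (t df dg : R) : is_derive t 1 f df ->
  is_derive t 1 g dg -> is_derive t 1 (fun s => f s - g s) (df - dg).
Proof. by move=> Hf Hg; exact: is_deriveB. Qed.

Lemma derN (f : R -> R) (t df : R) : is_derive t 1 f df ->
  is_derive t 1 (fun s => - f s) (- df).
Proof. by move=> Hf; exact: is_deriveN. Qed.

Lemma derM (f g : R -> R) (t df dg : R) : is_derive t 1 f df ->
  is_derive t 1 g dg -> is_derive t 1 (fun s => f s * g s) (f t * dg + g t * df).
Proof. by move=> Hf Hg; exact: is_deriveM. Qed.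

Lemma derX (f : R -> R) (n : nat) (t df : R) : is_derive t 1 f df ->
  is_derive t 1 (fun s => f s ^+ n) (n%:R * f t ^+ n.-1 * df).
Proof.
move=> Hf; have -> : (fun s => f s ^+ n) = f ^+ n.
  by apply/funext => s; elim: n => [|n IH]; rewrite ?expr0// !exprS IH.
exact: is_deriveX.
Qed.

Lemma der_comp (f g : R -> R) (t df dg : R) : is_derive (g t) 1 f df ->
  is_derive t 1 g dg -> is_derive t 1 (fun s => f (g s)) (df * dg).
Proof. by move=> Hf Hg; exact: is_derive1_comp. Qed.

Lemma continuous_bounded (V : normedModType R) (f : R -> V) (a b : R) : a <= b ->
  (forall t, a <= t <= b -> {for t, continuous f}) ->
  exists B, forall t, a <= t <= b -> `|f t| <= B.
Proof.
move=> ab cf.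
apply: (@cousin_induction R (fun u v => exists B, forall t, u <= t <= v -> `|f t| <= B)).
- exact: ab.
- move=> u v w _ _ _ _ [B1 H1] [B2 H2]; exists (Num.max B1 B2) => t /andP[ut tw].
  rewrite le_max; have [tv|/ltW vt] := leP t v; first by rewrite H1 ?ut.
  by rewrite H2 ?vt ?orbT.
- move=> t at_ tb; have tab : a <= t <= b by rewrite at_.
  have [d d0 Hd] := (for_continuousP _ _).1 (cf t tab) 1 ltr01.
  exists d => // u v au ut tv vb ud vd; exists (`|f t| + 1) => s /andP[us sv].
  have /Hd : `|s - t| < d by rewrite ltr_norml; lra.
  by move=> /ltW; rewrite -lerBlDl; apply: le_trans; rewrite lerB_dist.
Qed.

Lemma eq_of_derive (f g df : R -> R) (a b : R) : a <= b ->
  (forall t, a <= t <= b -> is_derive t 1 f (df t)) ->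
  (forall t, a <= t <= b -> is_derive t 1 g (df t)) ->
  f b - f a = g b - g a.
Proof.
move=> ab Hf Hg; have Hfg t : a <= t <= b ->
    is_derive t 1 (fun s => f s - g s) (df t - df t).
  by move=> tab; exact: derB (Hf t tab) (Hg t tab).
have Hgf t : a <= t <= b ->
    is_derive t 1 (fun s => g s - f s) (df t - df t).
  by move=> tab; exact: derB (Hg t tab) (Hf t tab).
have d0 t : a <= t <= b -> df t - df t <= 0 by rewrite subrr.
have := nonincreasing_of_derive ab Hfg d0.
have := nonincreasing_of_derive ab Hgf d0.
lra.
Qed.

(** An integral with a finite lower end gives a primitive only to the right of that end. So
    primitives [G n] on []-n, +oo[], normalized at 0, are glued: at [t] an index [N t] above [|t|]
    is used, and it still serves near [t]. *)
Lemma continuous_primitive (f : R -> R) : continuous f ->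
  exists2 G : R -> R, G 0 = 0 & forall t : R, is_derive t 1 G (f t).
Proof.
move=> cf.
pose I (n : nat) (t : R) : R := (\int[lebesgue_measure]_(s in `[- n%:R, t]) f s)%R.
have dI n (t : R) : - n%:R < t -> is_derive t 1 (I n) (f t).
  move=> nt.
  have [] := @continuous_FTC1 R f (BLeft (- n%:R)) t (t + 1).
  - by rewrite ltrDl.
  - apply: continuous_compact_integrable; first exact: segment_compact.
    exact: continuous_subspaceT.
  - by rewrite ?lte_fin ?bnd_simp ?nt.
  - exact: cf.
  move=> D E; apply: DeriveDef; first exact: D.
  by rewrite -derive1E; exact: E.
pose G n t := I n t - I n 0.
have dG n (t : R) : - n%:R < t -> is_derive t 1 (G n) (f t).
  move=> nt; rewrite -[f t]subr0.
  exact: (derB (dI n t nt) (der_cst _ _)).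
have GE n m (t : R) : (0 < n)%N -> (0 < m)%N -> - n%:R < t -> - m%:R < t -> G n t = G m t.
  move=> n0 m0 nt mt.
  have n0' : 0 < n%:R :> R by rewrite ltr0n.
  have m0' : 0 < m%:R :> R by rewrite ltr0n.
  have [t0|/ltW t0] := leP 0 t.
    have := @eq_of_derive (G n) (G m) f 0 t t0.
    rewrite /G !subrr !subr0; apply => s /andP[s0 _]; apply: dG;
      by apply: (lt_le_trans _ s0); rewrite oppr_lt0 ltr0n.
  have := @eq_of_derive (G n) (G m) f t 0 t0.
  have -> : G n 0 = 0 by rewrite /G subrr.
  have -> : G m 0 = 0 by rewrite /G subrr.
  rewrite !sub0r => H; apply: oppr_inj; apply: H => s /andP[s0 _]; apply: dG;
    exact: lt_le_trans s0.
pose N (t : R) := (Num.truncn `|t|).+1.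
have tN (t : R) : `|t| < (N t)%:R by rewrite /N truncnS_gt.
exists (fun t => G (N t) t); first by rewrite /G subrr.
move=> t; apply: (@near_eq_is_derive _ _ _ (G (N t))); last first.
  by apply: dG; have := tN t; rewrite ltr_norml => /andP[].
have [d d0 dt] : exists2 d, 0 < d & `|t| + d <= (N t)%:R.
  by exists ((N t)%:R - `|t|); rewrite ?subr_gt0 ?tN// addrC subrK.
exists d; first exact: d0.
move=> s; rewrite /ball /= => sd; apply: GE; [exact: ltn0Sn|exact: ltn0Sn| |].
  have : `|s| < (N t)%:R.
    apply: lt_le_trans dt; rewrite -ltrBlDl; apply: le_lt_trans sd.
    by rewrite distrC lerB_dist.
  by rewrite ltr_norml => /andP[].
by have := tN s; rewrite ltr_norml => /andP[].
Qed.

(** On a piece with [L * length <= 1 / 2] the supremum [S] of the norm satisfies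
    [S <= |D m| + S / 2], so each of the [n] pieces costs a factor 2. The hypothesis bounds
    increments, not derivatives, so that curves differentiable only almost everywhere are covered;
    boundedness of [D] makes [S] finite. *)
Lemma gronwall (V : normedModType R) (D : R -> V) (L : R) (n : nat) (a b : R) :
  0 <= L -> a <= b -> L * (b - a) <= n%:R / 2 ->
  (exists B, forall t, a <= t <= b -> `|D t| <= B) ->
  (forall s t M, a <= s -> s <= t -> t <= b ->
     (forall r, s <= r <= t -> `|D r| <= M) -> `|D t - D s| <= L * M * (t - s)) ->
  forall t, a <= t <= b -> `|D t| <= 2 ^+ n * `|D a|.
Proof.
move=> L0; elim: n a b => [|n IH] a b ab Lab [B HB] HD t /andP[at_ tb].
  rewrite expr0 mul1r -(subrK (D a) (D t)) (le_trans (ler_normD _ _))// gerDr.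
  have {}Lab : L * (t - a) <= 0.
    by rewrite mul0r in Lab; apply: le_trans Lab; rewrite ler_wpM2l// lerD2r.
  apply: le_trans (HD a t B _ _ _ _) _ => //.
    by move=> r /andP[ar rt]; apply: HB; rewrite ar (le_trans rt).
  rewrite mulrAC mulr_le0_ge0//; apply: le_trans (HB a _) => //.
  by rewrite lexx.
(* The segment [[m, b]] is the last of [n + 1] equal pieces. *)
pose m := a + (b - a) * (n%:R / n.+1%:R).
have n1 : 0 < n.+1%:R :> R by rewrite ltr0n.
have q0 : 0 <= n%:R / n.+1%:R :> R by rewrite divr_ge0.
have q1 : n%:R / n.+1%:R <= 1 :> R by rewrite ler_pdivrMr// mul1r ler_nat.
have am : a <= m by rewrite lerDl mulr_ge0// subr_ge0.
have mb : m <= b.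
  by rewrite /m -lerBrDl ler_piMr// subr_ge0.
have Lam : L * (m - a) <= n%:R / 2.
  have -> : m - a = (b - a) * (n%:R / n.+1%:R) by rewrite /m addrC addKr.
  rewrite mulrA; apply: le_trans (ler_wpM2r q0 Lab) _.
  rewrite le_eqVlt; apply/orP; left; apply/eqP.
  by move: (n.+1%:R) n1 => N1 N10; field; rewrite gt_eqF.
have Lmb : L * (b - m) <= 2^-1.
  have -> : b - m = (b - a) / n.+1%:R.
    by rewrite /m -(@natr1 _ n); field; rewrite natr1 gt_eqF.
  rewrite mulrA ler_pdivrMr//; apply: le_trans Lab _.
  by rewrite mulrC.
have IHm s : a <= s <= m -> `|D s| <= 2 ^+ n * `|D a|.
  apply: IH => //.
    by exists B => r /andP[ar rm]; apply: HB; rewrite ar (le_trans rm).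
  by move=> u v M au uv vm; apply: HD => //; exact: le_trans mb.
have [tm|/ltW mt] := leP t m.
  apply: (le_trans (IHm t _)); first by rewrite at_.
  by rewrite exprS ler_wpM2r// ler_peMl ?exprn_ge0// ler1n.
pose S := sup [set `|D r| | r in [set r | m <= r <= b]].
have SB : has_ubound [set `|D r| | r in [set r | m <= r <= b]].
  by exists B => _ [r /andP[mr rb] <-]; apply: HB; rewrite rb (le_trans am).
have DS r : m <= r <= b -> `|D r| <= S.
  by move=> mrb; apply: ub_le_sup => //; exists r.
have S0 : 0 <= S by apply: le_trans (DS m _); rewrite ?lexx.
have Dm r : m <= r <= b -> `|D r| <= `|D m| + S / 2.
  move=> /andP[mr rb]; rewrite -(subrK (D m) (D r)) addrC.
  rewrite (le_trans (ler_normD _ _))// lerD2l.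
  apply: (le_trans (HD m r S _ _ _ _)) => //.
    by move=> u /andP[mu ur]; apply: DS; rewrite mu (le_trans ur).
  rewrite mulrAC mulrC ler_wpM2l//; apply: le_trans Lmb.
  by rewrite ler_wpM2l// lerD2r.
have S2 : S <= `|D m| + S / 2.
  apply: ge_sup; first by exists `|D m|, m => //=; rewrite lexx.
  by move=> _ [r mrb <-]; exact: Dm.
have Dm2 : `|D m| <= 2 ^+ n * `|D a| by apply: IHm; rewrite am lexx.
have := DS t; rewrite mt tb => /(_ isT) DtS.
rewrite exprS -mulrA; apply: (le_trans DtS).
by move: Dm2; set x := _ * `|_|; lra.
Qed.

End differentiation.

(** * Ordinary differential equations *)

Section picard.
Context {R : realType}.

Lemma is_derive_pairP (V W : normedModType R) (f : R -> V * W) (t : R) (v : V * W) :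
  is_derive t 1 f v <->
  is_derive t 1 (fun s => (f s).1) v.1 /\ is_derive t 1 (fun s => (f s).2) v.2.
Proof.
split.
  move=> /is_deriveP H; split; apply/is_deriveP => e e0;
    have [d d0 Hd] := H e e0; exists d => // s /Hd;
    by rewrite prod_normE ge_max => /andP[].
move=> [/is_deriveP H1 /is_deriveP H2]; apply/is_deriveP => e e0.
have [d1 d10 Hd1] := H1 e e0; have [d2 d20 Hd2] := H2 e e0.
exists (Num.min d1 d2); first by rewrite lt_min d10.
move=> s; rewrite lt_min => /andP[/Hd1 ? /Hd2 ?].
by rewrite prod_normE ge_max; apply/andP; split.
Qed.

Lemma continuous_pair (T : topologicalType) (V W : normedModType R) (f : T -> V * W) x :
  {for x, continuous f} ->
  {for x, continuous (fun t => (f t).1)} /\ {for x, continuous (fun t => (f t).2)}.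
Proof.
move=> /cvgrPdist_lt H; split; apply/cvgrPdist_lt => e e0;
  apply: filterS (H e e0) => t /=;
  by rewrite prod_normE gt_max => /andP[].
Qed.

(** The intervals of radius [2 * c / 2 ^+ n] about [v n] are nested, and [l] is the supremum of
    their left ends. The explicit rate later makes the Picard limit locally uniform in time. *)
Lemma geometric_limit (v : nat -> R) (c : R) :
  (forall n, `|v n.+1 - v n| <= c / 2 ^+ n) ->
  exists l, forall n, `|l - v n| <= 2 * c / 2 ^+ n.
Proof.
move=> H.
have p2 n : 0 < 2 ^+ n :> R by rewrite exprn_gt0.
have c2 n : 2 * c / 2 ^+ n = c / 2 ^+ n + 2 * c / 2 ^+ n.+1.
  by rewrite exprS; field; rewrite gt_eqF.
have c0 : 0 <= c.
  by have := le_trans (normr_ge0 _) (H 0%N); rewrite expr0 divr1.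
pose lo n := v n - 2 * c / 2 ^+ n; pose hi n := v n + 2 * c / 2 ^+ n.
have loS n k : lo n <= lo (n + k)%N.
  elim: k => [|k IH]; first by rewrite addn0.
  apply: le_trans IH _; rewrite addnS /lo c2.
  by have := H (n + k)%N; rewrite ler_norml => /andP[]; lra.
have hiS n k : hi (n + k)%N <= hi n.
  elim: k => [|k IH]; first by rewrite addn0.
  apply: le_trans _ IH; rewrite addnS /hi (c2 (n + k)%N).
  by have := H (n + k)%N; rewrite ler_norml => /andP[]; lra.
have lohi n m : lo n <= hi m.
  apply: le_trans (loS n m) (le_trans _ (hiS m n)); rewrite (addnC m).
  have : 0 <= 2 * c / 2 ^+ (n + m) by rewrite divr_ge0 ?mulr_ge0// ltW.
  by rewrite /lo /hi; lra.
have hs : has_ubound (range lo) by exists (hi 0%N) => _ [n _ <-].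
exists (sup (range lo)) => n.
have : lo n <= sup (range lo) by apply: ub_le_sup => //; exists n.
have : sup (range lo) <= hi n.
  by apply: ge_sup; [exists (lo 0%N), 0%N | move=> _ [m _ <-]].
by rewrite /lo /hi ler_norml => ? ?; apply/andP; split; lra.
Qed.

Notation V := (phase_space R).

Lemma geometric_limit3 (v : nat -> V) (c : R) :
  (forall n, `|v n.+1 - v n| <= c / 2 ^+ n) ->
  exists l, forall n, `|l - v n| <= 2 * c / 2 ^+ n.
Proof.
move=> H.
have H1 n : `|(v n.+1).1.1 - (v n).1.1| <= c / 2 ^+ n.
  by apply: le_trans (H n); rewrite !prod_normE !le_max lexx.
have H2 n : `|(v n.+1).1.2 - (v n).1.2| <= c / 2 ^+ n.
  by apply: le_trans (H n); rewrite !prod_normE !le_max lexx !orbT.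
have H3 n : `|(v n.+1).2 - (v n).2| <= c / 2 ^+ n.
  by apply: le_trans (H n); rewrite !prod_normE !le_max lexx !orbT.
have [l1 L1] := geometric_limit H1.
have [l2 L2] := geometric_limit H2.
have [l3 L3] := geometric_limit H3.
exists (l1, l2, l3) => n; rewrite !prod_normE !ge_max.
by apply/andP; split; [apply/andP; split; [exact: L1|exact: L2]|exact: L3].
Qed.

Lemma continuous_primitive3 (f : R -> V) : continuous f ->
  exists2 G : R -> V, G 0 = 0 & forall t : R, is_derive t 1 G (f t).
Proof.
move=> cf.
have c12 (t : R) := (continuous_pair (cf t)).1.
have c1 : continuous (fun t => (f t).1.1).
  by move=> t; have [] := continuous_pair (c12 t).
have c2 : continuous (fun t => (f t).1.2).
  by move=> t; have [] := continuous_pair (c12 t).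
have c3 : continuous (fun t => (f t).2).
  by move=> t; have [] := continuous_pair (cf t).
have [G1 G10 D1] := continuous_primitive c1.
have [G2 G20 D2] := continuous_primitive c2.
have [G3 G30 D3] := continuous_primitive c3.
exists (fun t => (G1 t, G2 t, G3 t)); first by rewrite G10 G20 G30.
move=> t; apply/is_derive_pairP; split; last exact: D3.
by apply/(is_derive_pairP (fun s => (G1 s, G2 s)) t (f t).1); split; [exact: D1|exact: D2].
Qed.

Lemma der_expR_lin (c a t : R) :
  is_derive t 1 (fun s => c * expR (a * s)) (c * (a * expR (a * t))).
Proof.
have H : is_derive t 1 (fun s => a * s) a.
  by apply: (is_derive_eq (derM (der_cst a t) (der_id t))); rewrite mulr1 mulr0 addr0.
apply: (is_derive_eq (derM (der_cst c t) (der_comp (is_derive_expR (a * t)) H))).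
by rewrite /= mulr0 addr0 (mulrC _ a).
Qed.

Lemma der_opp (W : normedModType R) (f : R -> W) (t : R) (v : W) :
  is_derive (- t) 1 f v -> is_derive t 1 (fun s => f (- s)) (- v).
Proof.
move=> /is_deriveP H; apply/is_deriveP => e e0; have [d d0 Hd] := H e e0.
exists d => // s st; have := Hd (- s).
have -> : - s - - t = - (s - t) by rewrite opprB opprK addrC.
by rewrite normrN scaleNr -scalerN => /(_ st).
Qed.

(** Integrating the weight [expR (2 * L * |t|)] from 0 gains a factor [1 / (2 * L)], so an
    [L]-Lipschitz right-hand side contracts the weighted distance by 1/2. Negative times reduce to
    positive ones by reversing time. *)
Lemma exp_weight (W : normedModType R) (D v : R -> W) (c L : R) : 0 < L ->
  D 0 = 0 -> (forall t : R, is_derive t 1 D (v t)) ->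
  (forall t, `|v t| <= c * expR (2 * L * `|t|)) ->
  forall t, `|D t| <= c / (2 * L) * expR (2 * L * `|t|).
Proof.
move=> L0.
have c0 (w : R -> W) : (forall t, `|w t| <= c * expR (2 * L * `|t|)) -> 0 <= c.
  by move=> /(_ 0); rewrite normr0 mulr0 expR0 mulr1 => /(le_trans _); apply.
have half (E w : R -> W) : E 0 = 0 -> (forall t : R, is_derive t 1 E (w t)) ->
  (forall t, `|w t| <= c * expR (2 * L * `|t|)) ->
  forall t, 0 <= t -> `|E t| <= c / (2 * L) * expR (2 * L * t).
  move=> E0 dE bE t t0.
  have := @mean_value_ineq _ _ E (fun s => c / (2 * L) * expR (2 * L * s)) w _ 0 t t0
    (fun s _ => dE s) (fun s _ => der_expR_lin _ _ s).
  rewrite E0 subr0 => /(_ _)/le_trans; apply; last first.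
    by rewrite gerBl mulr_ge0 ?expR_ge0 ?divr_ge0 ?(c0 _ bE) ?mulr_ge0 ?ltW.
  move=> s /andP[s0 _]; apply: le_trans (bE s) _; rewrite ger0_norm//.
  by rewrite mulrA -(mulrA c) mulVf ?mulr1// gt_eqF// mulr_gt0.
move=> D0 dD bD t; have [t0|t0] := leP 0 t.
  by rewrite (ger0_norm t0); exact: half.
rewrite (ltr0_norm t0).
have := half (fun s => D (- s)) (fun s => - v (- s)).
rewrite /= oppr0 => /(_ D0 (fun s => der_opp (dD _))).
move=> /(_ _ (- t)); rewrite opprK; apply; last by rewrite oppr_ge0 ltW.
by move=> s; rewrite normrN -(normrN s).
Qed.

(* The weight [expR (2 * L * `|t|)] makes the Picard operator a contraction on the
   whole time axis at once. *)
Theorem picard (F : V -> V) (L : R) : 0 < L ->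
  (forall p p', `|F p - F p'| <= L * `|p - p'|) ->
  forall p, exists2 u : R -> V, u 0 = p & forall t : R, is_derive t 1 u (F (u t)).
Proof.
move=> L0 FL p.
have Fc (u : R -> V) : continuous u -> continuous (fun t => F (u t)).
  move=> cu t; apply/for_continuousP => e e0.
  have [d d0 Hd] := (for_continuousP _ _).1 (cu t) (e / L) (divr_gt0 e0 L0).
  exists d => // s /Hd; rewrite ltr_pdivlMr// mulrC; exact: le_lt_trans.
(* [PR] chooses a primitive vanishing at 0; on discontinuous functions its value is arbitrary. *)
have [PR PRP] : {PR : (R -> V) -> R -> V & forall f, continuous f ->
    PR f 0 = 0 /\ forall t : R, is_derive t 1 (PR f) (f t)}.
  apply: (@choice _ _ (fun (f G : R -> V) => continuous f ->
    G 0 = 0 /\ forall t : R, is_derive t 1 G (f t))) => f.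
  have [cf|ncf] := pselect (continuous f).
    by have [G G0 dG] := continuous_primitive3 cf; exists G.
  by exists f => /ncf.
pose T (u : R -> V) := fun t => p + PR (fun s => F (u s)) t.
have T0 u : continuous u -> T u 0 = p.
  by move=> /Fc/PRP[E _]; rewrite /T E addr0.
have dT u (t : R) : continuous u -> is_derive t 1 (T u) (F (u t)).
  move=> /Fc/PRP[_ /(_ t) H]; rewrite -[F _]add0r.
  exact: (is_deriveD (is_derive_cst p t 1) H).
have cT u : continuous u -> continuous (T u).
  by move=> cu t; exact: is_derive_continuous (dT u t cu).
pose u n := iter n T (fun=> p).
have cu n : continuous (u n).
  by elim: n => [|n IH]; [move=> t; exact: cvg_cst|exact: cT].
have u0 n : u n 0 = p by case: n => [//|n]; exact: T0.
pose E (t : R) := expR (2 * L * `|t|).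
(* The first Picard increment has constant derivative [F p], so [exp_weight] bounds it by [M * E t];
   each further iteration halves the bound. *)
pose M := `|F p| / (2 * L).
have L20 : 0 < 2 * L by rewrite mulr_gt0.
have M0 : 0 <= M by rewrite divr_ge0// ltW.
have p2 n : 0 < 2 ^+ n :> R by rewrite exprn_gt0.
have E1 (t : R) : 1 <= E t.
  by apply: le_trans (expR_ge1Dx _); rewrite lerDl mulr_ge0// ltW.
have dTB v w : continuous v -> continuous w -> forall t : R,
    is_derive t 1 (fun s => T v s - T w s) (F (v t) - F (w t)).
  by move=> cv cw t; exact: is_deriveB (dT v t cv) (dT w t cw).
have contract v w c : continuous v -> continuous w ->
    (forall t, `|v t - w t| <= c * E t) -> forall t, `|T v t - T w t| <= c / 2 * E t.
  move=> cv cw H t.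
  have := @exp_weight _ (fun s => T v s - T w s) _ (L * c) L L0 _ (dTB v w cv cw).
  rewrite !T0// subrr => /(_ erefl) K.
  have -> : c / 2 = L * c / (2 * L) by field; rewrite gt_eqF.
  apply: K => s; apply: le_trans (FL _ _) _.
  by rewrite -mulrA; apply: ler_wpM2l; [exact: ltW|exact: H].
have step n t : `|u n.+1 t - u n t| <= M * E t / 2 ^+ n.
  rewrite mulrAC; elim: n t => [|n IH] t; last first.
    have -> : M / 2 ^+ n.+1 = M / 2 ^+ n / 2.
      by rewrite exprS; field; rewrite gt_eqF.
    exact: (contract (u n.+1) (u n) _ (cu _) (cu _) IH).
  rewrite expr0 divr1.
  have h1 : u 1%N 0 - u 0%N 0 = 0 by rewrite !u0 subrr.
  have h2 (r : R) : is_derive r 1 (fun s => u 1%N s - u 0%N s) (F p).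
    rewrite -[F p]subr0.
    exact: (is_deriveB (dT _ r (cu 0%N)) (is_derive_cst p r 1)).
  have h3 (r : R) : `|F p| <= `|F p| * expR (2 * L * `|r|).
    by apply: ler_peMr => //; exact: E1.
  by rewrite /M /E; exact: (exp_weight L0 h1 h2 h3 t).
have [v Hv] : {v : R -> V & forall t n, `|v t - u n t| <= 2 * (M * E t) / 2 ^+ n}.
  apply: (@choice _ _ (fun (t : R) (l : V) =>
    forall n, `|l - u n t| <= 2 * (M * E t) / 2 ^+ n)) => t.
  by apply: geometric_limit3 => n; exact: step.
have small (c e : R) : 0 <= c -> 0 < e -> exists n, c / 2 ^+ n < e.
  move=> c0 e0; exists (Num.truncn (c / e)).+1.
  rewrite ltr_pdivrMr// mulrC -ltr_pdivrMr//.
  apply: lt_le_trans (truncnS_gt _) _.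
  by rewrite -natrX ler_nat ltnW// ltn_expl.
have cv : continuous v.
  move=> t; apply/for_continuousP => e e0.
  pose K := expR (2 * L * (`|t| + 1)).
  have e3 : 0 < e / 3 by rewrite divr_gt0.
  have K0 : 0 <= 2 * (M * K) by apply: mulr_ge0 => //; apply: mulr_ge0 => //; exact: expR_ge0.
  have [n Hn] := small _ _ K0 e3.
  have [d d0 Hd] := (for_continuousP _ _).1 (cu n t) _ e3.
  exists (Num.min d 1); first by rewrite lt_min d0 ltr01.
  move=> s; rewrite lt_min => /andP[/Hd sd s1].
  have vuK r : `|r| <= `|t| + 1 -> `|v r - u n r| < e / 3.
    move=> rt; apply: le_lt_trans Hn; apply: le_trans (Hv r n) _.
    apply: ler_wpM2r; first by rewrite invr_ge0 ltW.
    apply: ler_wpM2l => //; apply: ler_wpM2l => //.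
    by rewrite ler_expR; apply: ler_wpM2l => //; exact: ltW.
  have vs : `|v s - u n s| < e / 3.
    by apply: vuK; rewrite -lerBlDl (le_trans (lerB_dist _ _)) ?ltW.
  have vt : `|v t - u n t| < e / 3 by apply: vuK; rewrite lerDl.
  have -> : v s - v t = (v s - u n s) + (u n s - u n t) - (v t - u n t).
    by rewrite subrKA opprB addrA subrK.
  have := ler_normB ((v s - u n s) + (u n s - u n t)) (v t - u n t).
  have := ler_normD (v s - u n s) (u n s - u n t).
  lra.
have Tv : T v = v.
  apply/funext => t; apply/eqP; rewrite -subr_eq0 -normr_le0.
  apply/ler_addgt0Pr => e e0; rewrite add0r.
  have K0 : 0 <= 3 * (M * E t) by apply: mulr_ge0 => //; apply: mulr_ge0 => //; exact: expR_ge0.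
  have [n Hn] := small _ _ K0 e0; apply: le_trans (ltW Hn).
  have := Hv t n.+1.
  have := contract v (u n) (2 * M / 2 ^+ n) cv (cu n) _ t.
  rewrite -[T (u n)]/(u n.+1) => /(_ _) H1 H2.
  have -> : T v t - v t = (T v t - u n.+1 t) - (v t - u n.+1 t) by rewrite opprB subrKA.
  apply: le_trans (ler_normB _ _) _.
  have -> : 3 * (M * E t) / 2 ^+ n =
      2 * M / 2 ^+ n / 2 * E t + 2 * (2 * (M * E t) / 2 ^+ n.+1).
    by rewrite exprS; field; rewrite gt_eqF.
  apply: lerD; first apply: H1 => s.
    by apply: le_trans (Hv s n) _; rewrite mulrA mulrAC.
  apply: le_trans H2 _; apply: ler_peMl; last by rewrite ler1n.
  apply: divr_ge0; last exact: ltW.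
  by apply: mulr_ge0 => //; apply: mulr_ge0 => //; exact: expR_ge0.
exists v; first by rewrite -Tv T0.
by move=> t; rewrite -{1}Tv; exact: dT.
Qed.

End picard.

(** * Arcs between the plane x = 0 and a turning point *)

Section half_branch.
Context {R : realType}.

(* [s = 1] and [s = -1] describe the two halves, forward and backward in time,
   of an arc issued from the point [x = 1], [y = 0] with [x >= 0]:
   [X t = x (s * t)], [f t = - s * y (s * t)], [Z t = Z (s * t)]. *)
Definition half_branch (m : nat) (s b T : R) (X f Z : R -> R) : Prop :=
  [/\ [/\ X 0 = 1, f 0 = 0 & Z 0 = - (b ^+ 2 / 2)],
      forall t, 0 <= t <= T -> 0 <= X t &
      forall t, 0 <= t <= T ->
      let v := Z t + s * ((m.+1%:R + 1) / m.+1%:R * X t ^+ m.+1 * f t) in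
      [/\ is_derive t 1 X (- f t), is_derive t 1 f (- v)
        & is_derive t 1 Z (s / m.+1%:R * X t ^+ m.+1 * v)]].

Section facts.
Variables (m : nat) (s b T : R) (X f Z : R -> R).
Hypothesis s1 : s = 1 \/ s = -1.
Hypothesis b0 : 0 < b.
Hypothesis b3 : b <= 3.
Hypothesis T0 : 0 <= T.
Hypothesis HB : half_branch m s b T X f Z.

Local Notation N := (m.+1%:R : R).
(** In the original variables this is [z + x^q * y]. The first integral equals [x * w - y^2 / 2],
    and [w] is nonincreasing in forward time as long as [x >= 0]; the estimates of this section come
    from these two facts. *)
Let w t := Z t + s / N * X t ^+ m.+1 * f t.

Let N0 : 0 < N. Proof. by rewrite ltr0n. Qed.
Let N1 : 1 <= N. Proof. by rewrite ler1n. Qed.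

Let init : [/\ X 0 = 1, f 0 = 0 & Z 0 = - (b ^+ 2 / 2)].
Proof. by case: HB. Qed.

Let Xge0 t : 0 <= t <= T -> 0 <= X t.
Proof. by case: HB => _ H _; exact: H. Qed.

Let dX t : 0 <= t <= T -> is_derive t 1 X (- f t).
Proof. by case: HB => _ _ H /H[]. Qed.

Let df t : 0 <= t <= T -> is_derive t 1 f (- w t - s * X t ^+ m.+1 * f t).
Proof.
case: HB => _ _ H /H[_ H2 _]; apply: (is_derive_eq H2).
by rewrite /w; move: N N0 => n n0; field; rewrite gt_eqF.
Qed.

Let dw t : 0 <= t <= T -> is_derive t 1 w (- s * X t ^+ m * f t ^+ 2).
Proof.
move=> tT; case: HB => _ _ /(_ t tT)[H1 H2 H3].
apply: (is_derive_eq (derD H3 (derM (derM (der_cst (s / N) t) (derX m.+1 H1)) H2))).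
rewrite /= exprS; move: N N0 => n n0.
by case: s1 => ->; field; rewrite gt_eqF.
Qed.

Let w0 : w 0 = - (b ^+ 2 / 2).
Proof. by case: init => _ E1 E2; rewrite /w E1 E2 mulr0 addr0. Qed.

Let restrict t : 0 <= t <= T -> forall r, 0 <= r <= t -> 0 <= r <= T.
Proof. by move=> /andP[_ tT] r /andP[-> rt]; rewrite (le_trans rt). Qed.

Lemma half_energy t : 0 <= t <= T -> f t ^+ 2 = b ^+ 2 + 2 * (X t * w t).
Proof.
move=> tT.
have H r : 0 <= r <= T ->
    is_derive r 1 (fun r => f r ^+ 2 - 2 * (X r * w r)) 0.
  move=> rT; apply: (is_derive_eq (derB (derX 2 (df rT))
     (derM (der_cst 2 r) (derM (dX rT) (dw rT))))).
  by rewrite /= [X r ^+ m.+1]exprS; ring.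
have := @eq_of_derive R (fun r => f r ^+ 2 - 2 * (X r * w r)) (fun=> 0) (fun=> 0) 0 t.
case: init => -> E1 _; rewrite w0 E1 => /(_ _ _ (fun r _ => der_cst _ _)).
case/andP: (tT) => t0 _ /(_ t0) K.
have {}K := K (fun r rt => H r (restrict tT rt)).
by move: K; lra.
Qed.

(** Where [f] vanishes, the energy forces [X * w = - b^2 / 2 < 0], hence [X > 0] and [w < 0], and
    the derivative of [f] there is [- w > 0]. *)
Lemma half_f_ge0 t : 0 <= t <= T -> 0 <= f t.
Proof.
move=> tT; case: init => _ E1 _; case/andP: (tT) => t0 _.
apply: (barrier t0 _ (fun r rt => df (restrict tT rt))); first by rewrite E1.
move=> r /(restrict tT) rT fr.
have := half_energy rT; rewrite fr mulr0 subr0 expr0n /= => E.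
have b2 : 0 < b ^+ 2 by rewrite exprn_gt0.
have Xw : X r * w r < 0 by lra.
rewrite oppr_gt0 -(pmulr_rlt0 _ (_ : 0 < X r))// lt_neqAle Xge0// andbT.
by apply: contraTneq Xw => <-; rewrite mul0r ltxx.
Qed.

Lemma half_X_le1 t : 0 <= t <= T -> X t <= 1.
Proof.
move=> tT; case: init => <- _ _; case/andP: (tT) => t0 _.
apply: (nonincreasing_of_derive t0 (fun r rt => dX (restrict tT rt))).
by move=> r /(restrict tT) rT; rewrite oppr_le0 half_f_ge0.
Qed.

Lemma half_Xn t n : 0 <= t <= T -> 0 <= X t ^+ n <= 1.
Proof.
by move=> tT; rewrite exprn_ge0 ?Xge0//= exprn_ile1 ?Xge0 ?half_X_le1.
Qed.

(** Barrier argument against [e * (1 - 1 / (1 + t))] with [e = b^2 / 8], whose slope never exceeds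
    [e]. Since this function is bounded by [e], at a contact [f <= e]; the energy then gives
    [- w >= (b^2 - e^2) / 2], while [e^2 <= 9 / 64 * b^2] because [b <= 3]. So the slope of [f] is
    at least [(b^2 - e^2) / 2 - e > e]. *)
Lemma half_f_lower t : 0 <= t <= T -> b ^+ 2 / 8 * (t / (1 + t)) <= f t.
Proof.
move=> tT; case: init => _ E1 _; case/andP: (tT) => t0 _.
pose e := b ^+ 2 / 8.
have b9 : b ^+ 2 <= 9 by rewrite (_ : 9 = 3 ^+ 2) ?ler_sqr ?nnegrE//; [exact: ltW|ring].
have b2 : 0 < b ^+ 2 by rewrite exprn_gt0.
have e0 : 0 < e by rewrite divr_gt0.
have dh (r : R) : 0 <= r -> is_derive r 1 (fun r => e * (1 - (1 + r)^-1)) (e * (1 + r) ^- 2).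
  move=> r0; have r1 : 1 + r != 0 by rewrite gt_eqF// ltr_wpDr.
  have d1 := derD (der_cst 1 r) (der_id r).
  have d2 := is_deriveV r1 d1.
  apply: (is_derive_eq (derM (der_cst e r) (derB (der_cst 1 r) d2))).
  by rewrite -[_ *: _]/(_ * _); field.
have -> : t / (1 + t) = 1 - (1 + t)^-1 by field; rewrite gt_eqF// ltr_wpDr.
rewrite -subr_ge0.
apply: (@barrier R (fun r => f r - e * (1 - (1 + r)^-1)) _ 0 t t0).
- by rewrite E1 addr0 invr1 subrr mulr0 subr0.
- move=> r rt; have /andP[r0 _] := rt.
  exact: derB (df (restrict tT rt)) (dh r r0).
move=> r /[dup] /andP[r0 _] /(restrict tT) rT /= /eqP; rewrite subr_eq0 => /eqP fr.
have r1 : 0 < 1 + r by rewrite ltr_wpDr.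
have i0 : 0 < (1 + r)^-1 by rewrite invr_gt0.
have i1 : (1 + r)^-1 <= 1 by rewrite invf_le1// lerDl.
have f0 := half_f_ge0 rT.
have fe : f r <= e by rewrite fr; nra.
have i2 : (1 + r) ^- 2 <= 1 by rewrite -exprVn exprn_ile1// ltW.
have E := half_energy rT.
have f2 : f r ^+ 2 <= e ^+ 2 by rewrite ler_sqr ?nnegrE ?(ltW e0).
have eb : e ^+ 2 <= b ^+ 2 * (9 / 64).
  by rewrite /e expr_div_n expr2; nra.
have Xw : X r * w r < 0 by lra.
have X0 : 0 < X r.
  rewrite lt_neqAle Xge0// andbT.
  by apply: contraTneq Xw => <-; rewrite mul0r ltxx.
have wneg : w r < 0 by rewrite -(pmulr_rlt0 _ X0).
have wX : - w r >= (b ^+ 2 - e ^+ 2) / 2.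
  by have := half_X_le1 rT; nra.
have /andP[Xn0 Xn1] := half_Xn m.+1 rT.
have Xf : s * X r ^+ m.+1 * f r <= e by case: s1 => ->; nra.
have := ler_wpM2l (ltW e0) i2; rewrite mulr1.
by move: Xf wX eb; rewrite /e; lra.
Qed.

(** From [t = 1] on, [t / (1 + t) >= 1 / 2], so [X] falls at least at rate [b^2 / 16] while it stays
    in [[0, 1]]. This makes the supremum defining the hitting time finite. *)
Lemma half_time_le : T <= 1 + 16 / b ^+ 2.
Proof.
have b2 : 0 < b ^+ 2 by rewrite exprn_gt0.
have [T1|/ltW T1] := leP T 1; first by rewrite (le_trans T1)// lerDl divr_ge0// ltW.
have T1T : 0 <= (1 : R) <= T by apply/andP.
have TT : 0 <= T <= T by rewrite T0 lexx.
have sub r : 1 <= r <= T -> 0 <= r <= T.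
  by move=> /andP[r1 ->]; rewrite (le_trans ler01).
have dXr r : 1 <= r <= T -> is_derive r 1 (fun r => X r + b ^+ 2 / 16 * r) (- f r + b ^+ 2 / 16).
  move=> rT; apply: (is_derive_eq (derD (dX (sub r rT)) (derM (der_cst _ r) (der_id r)))).
  by rewrite mulr1 mulr0 addr0.
have := nonincreasing_of_derive T1 dXr.
move=> /(_ _) H.
have : X T + b ^+ 2 / 16 * T <= X 1 + b ^+ 2 / 16 * 1.
  apply: H => r /[dup] /andP[r1 _] /sub rT.
  have := half_f_lower rT; have r0 : 0 < 1 + r by rewrite ltr_wpDr// (le_trans ler01).
  have : 2^-1 <= r / (1 + r) by rewrite ler_pdivlMr//; lra.
  by nra.
have := half_X_le1 T1T; have := Xge0 TT => X0 X1 H2.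
rewrite -lerBlDl ler_pdivlMr//; lra.
Qed.

(** Forward, [w] starts negative and decreases, so the energy yields [f <= b]. Then
    [w' = - X^m * f^2 >= - b * X^m * f], which is the derivative of [b / N * X^N]; hence [w] drops
    by at most [b / N <= b]. *)
Lemma half_forward_bounds t : s = 1 -> 0 <= t <= T ->
  [/\ w t <= - (b ^+ 2 / 2), - (b ^+ 2 / 2) - b <= w t & f t <= b].
Proof.
move=> s_1 tT; case: init => E0 E1 _; case/andP: (tT) => t0 _.
have wle r : 0 <= r <= T -> w r <= - (b ^+ 2 / 2).
  move=> rT; rewrite -w0; case/andP: (rT) => r0 _.
  apply: (nonincreasing_of_derive r0 (fun u ur => dw (restrict rT ur))).
  move=> u /(restrict rT) uT; rewrite s_1 mulN1r mulNr oppr_le0 mulr_ge0 ?sqr_ge0//.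
  by have /andP[] := half_Xn m uT.
have b2 : 0 < b ^+ 2 by rewrite exprn_gt0.
have fb r : 0 <= r <= T -> f r <= b.
  move=> rT; rewrite -ler_sqr ?nnegrE ?(ltW b0) ?half_f_ge0// half_energy//.
  by have := wle r rT; have := Xge0 rT; nra.
split; [exact: wle| |exact: fb].
have H u : 0 <= u <= T -> is_derive u 1 (fun r => b / N * X r ^+ m.+1 - w r)
    (X u ^+ m * f u ^+ 2 - b * X u ^+ m * f u).
  move=> uT; apply: (is_derive_eq (derB (derM (der_cst (b / N) u) (derX m.+1 (dX uT))) (dw uT))).
  by rewrite /= s_1; move: N N0 => n n0; field; rewrite gt_eqF.
have := nonincreasing_of_derive t0 (fun u ut => H u (restrict tT ut)).
move=> /(_ _) K.
have : b / N * X t ^+ m.+1 - w t <= b / N * X 0 ^+ m.+1 - w 0.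
  apply: K => u /(restrict tT) uT.
  have /andP[X0 _] := half_Xn m uT.
  have -> : X u ^+ m * f u ^+ 2 - b * X u ^+ m * f u = - (X u ^+ m * (f u * (b - f u))) by ring.
  by rewrite oppr_le0 !mulr_ge0// ?half_f_ge0// subr_ge0 fb.
rewrite w0 E0 expr1n mulr1.
have bN0 : 0 <= b / N by rewrite divr_ge0 ?ltW.
have bN : b / N <= b by rewrite ler_pdivrMr// ler_peMr// ltW.
have /andP[X0 _] := half_Xn m.+1 tT.
have := mulr_ge0 bN0 X0; move: bN.
by move: (b / N) => v; move: (v * X t ^+ m.+1) => u; lra.
Qed.

(** Backward, [w] grows and the energy alone does not bound [f]. A provisional bound [B] limits the
    growth of [w] to [B / N], and the energy then returns a bound on [f] of order [sqrt B]. Starting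
    from [B = 16] this yields 6, since [2 * 16 < 6 ^ 2]. *)
Lemma half_backward_bounds (B : R) t : s = -1 -> 0 <= B ->
  (forall r, 0 <= r <= T -> f r <= B) -> 0 <= t <= T ->
  [/\ - (b ^+ 2 / 2) <= w t, w t <= - (b ^+ 2 / 2) + B &
      f t ^+ 2 <= 2 * Num.max (b ^+ 2 / 2) B].
Proof.
move=> s_1 B0 fB tT; case: init => E0 E1 _; case/andP: (tT) => t0 _.
have wge : - (b ^+ 2 / 2) <= w t.
  have H u : 0 <= u <= T -> is_derive u 1 (fun r => - w r) (- (X u ^+ m * f u ^+ 2)).
    by move=> uT; apply: (is_derive_eq (derN (dw uT))); rewrite s_1; ring.
  rewrite -w0 -lerN2.
  apply: (nonincreasing_of_derive t0 (fun u ut => H u (restrict tT ut))).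
  move=> u /(restrict tT) uT; rewrite oppr_le0 mulr_ge0 ?sqr_ge0//.
  by have /andP[] := half_Xn m uT.
have BN0 : 0 <= B / N by rewrite divr_ge0.
have BN : B / N <= B by rewrite ler_pdivrMr// ler_peMr.
have wle : w t <= - (b ^+ 2 / 2) + B.
  have H u : 0 <= u <= T -> is_derive u 1 (fun r => w r + B / N * X r ^+ m.+1)
      (- (X u ^+ m * (f u * (B - f u)))).
    move=> uT; apply: (is_derive_eq (derD (dw uT) (derM (der_cst (B / N) u) (derX m.+1 (dX uT))))).
    by rewrite /= s_1; move: N N0 => n n0; field; rewrite gt_eqF.
  have := nonincreasing_of_derive t0 (fun u ut => H u (restrict tT ut)).
  move=> /(_ _) K.
  have : w t + B / N * X t ^+ m.+1 <= w 0 + B / N * X 0 ^+ m.+1.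
    apply: K => u /(restrict tT) uT; have /andP[X0 _] := half_Xn m uT.
    by rewrite oppr_le0 !mulr_ge0// ?half_f_ge0// subr_ge0 fB.
  rewrite w0 E0 expr1n mulr1; have /andP[X0 _] := half_Xn m.+1 tT.
  have := mulr_ge0 BN0 X0; move: BN.
  by move: (B / N) => v; move: (v * X t ^+ m.+1) => u; lra.
split => //; rewrite half_energy//.
have X0 := Xge0 tT; have X1 := half_X_le1 tT.
have [wn|/ltW wp] := leP (w t) 0.
  have : b ^+ 2 / 2 <= Num.max (b ^+ 2 / 2) B by rewrite le_max lexx.
  by nra.
have : B <= Num.max (b ^+ 2 / 2) B by rewrite le_max lexx orbT.
by nra.
Qed.

(** The gain from 16 to 14 is what closes the continuation argument in [flow_box]. Once [f <= 6] and
    [-8 <= w <= 6], the bound on [Z] follows because [Z] differs from [w] by at most [f]. *)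
Lemma half_box : (forall r, 0 <= r <= T -> f r <= 16) ->
  forall t, 0 <= t <= T -> [/\ `|X t| <= 14, `|f t| <= 14 & `|Z t| <= 14].
Proof.
move=> f16 t tT.
have b9 : b ^+ 2 <= 9 by rewrite (_ : 9 = 3 ^+ 2) ?ler_sqr ?nnegrE//; [exact: ltW|ring].
have b2 : 0 < b ^+ 2 by rewrite exprn_gt0.
have X0 := Xge0 tT; have X1 := half_X_le1 tT; have f0 := half_f_ge0 tT.
have /andP[Xn0 Xn1] := half_Xn m.+1 tT.
have i0 : 0 < N^-1 by rewrite invr_gt0.
have i1 : N^-1 <= 1 by rewrite invf_le1.
have a0 : 0 <= N^-1 * X t ^+ m.+1 * f t by rewrite !mulr_ge0 // ltW.
have a1 : N^-1 * X t ^+ m.+1 * f t <= f t.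
  by rewrite ler_piMl// mulr_ile1// ltW.
suff [f6 wl wu] : [/\ f t <= 6, -8 <= w t & w t <= 6].
  have wZ : Z t = w t - s * (N^-1 * X t ^+ m.+1 * f t).
    by rewrite /w; move: (N^-1) => n; ring.
  move: a0 a1 wZ; move: (N^-1 * X t ^+ m.+1 * f t) => a a0 a1 wZ.
  rewrite !ler_norml wZ; split; apply/andP; split; try lra.
    by case: s1 => ->; lra.
  by case: s1 => ->; lra.
case: (s1) => s_1.
  have [? ? ?] := half_forward_bounds s_1 tT; have := b3; split; lra.
have f6 r : 0 <= r <= T -> f r <= 6.
  move=> rT.
  have [_ _] := half_backward_bounds s_1 (ler0n R 16) f16 rT.
  rewrite (max_idPr _); last by lra.
  by have := half_f_ge0 rT; nra.
have [? ? _] := half_backward_bounds s_1 (ler0n R 6) f6 tT; split => //; last lra.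
  exact: f6.
lra.
Qed.

Lemma half_end_f : X T = 0 -> f T = b.
Proof.
move=> XT; have TT : 0 <= T <= T by rewrite T0 lexx.
have := half_energy TT; rewrite XT mul0r mulr0 addr0 => E.
by apply/eqP; rewrite -(@eqrXn2 _ 2) ?half_f_ge0 ?(ltW b0)// E.
Qed.

Lemma half_end_w : X T = 0 -> w T = Z T.
Proof. by move=> XT; rewrite /w XT exprS !mul0r mulr0 mul0r addr0. Qed.

Lemma half_end_forward : s = 1 -> X T = 0 ->
  - (b ^+ 2 / 2) - b <= Z T <= - (b ^+ 2 / 2).
Proof.
move=> s_1 XT; have TT : 0 <= T <= T by rewrite T0 lexx.
by have [? ? _] := half_forward_bounds s_1 TT; rewrite -half_end_w//; apply/andP.
Qed.

(** For [b = 3] this and [half_end_forward] bound the sum of the two end values by [- 9 + 6 < 0]: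
    the negative side of the shooting. *)
Lemma half_end_backward_le : s = -1 -> X T = 0 ->
  (forall r, 0 <= r <= T -> f r <= 16) -> Z T <= - (b ^+ 2 / 2) + 6.
Proof.
move=> s_1 XT f16; have TT : 0 <= T <= T by rewrite T0 lexx.
have b9 : b ^+ 2 <= 9 by rewrite (_ : 9 = 3 ^+ 2) ?ler_sqr ?nnegrE//; [exact: ltW|ring].
have f6 r : 0 <= r <= T -> f r <= 6.
  move=> rT.
  have [_ _] := half_backward_bounds s_1 (ler0n R 16) f16 rT.
  rewrite (max_idPr _); last by lra.
  by have := half_f_ge0 rT; nra.
by have [_ ? _] := half_backward_bounds s_1 (ler0n R 6) f6 TT; rewrite -half_end_w.
Qed.

(* If [f] stayed below [d], the quantity [X f + X^(q+2)/(q+2) - 3 d X / 2]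
   would be nondecreasing although it is positive initially and vanishes at
   the end. *)
Lemma half_end_backward_ge (d : R) : s = -1 -> X T = 0 ->
  d = (2 * (N + 2))^-1 -> b <= d -> d ^+ 2 / 2 - b ^+ 2 / 2 <= Z T.
Proof.
move=> s_1 XT dE bd; have TT : 0 <= T <= T by rewrite T0 lexx.
case: init => E0 E1 _.
(* If [Z T] were smaller, the nondecreasing [w] would stay below [d^2 / 2 - b^2 / 2], and the energy
   would give [f <= d] throughout. *)
rewrite leNgt; apply/negP => ZT; rewrite -half_end_w// in ZT.
have d0 : 0 < d by rewrite (lt_le_trans b0).
have wT r : 0 <= r <= T -> w r <= w T.
  move=> /andP[r0 rT].
  have sub u : r <= u <= T -> 0 <= u <= T by move=> /andP[ru ->]; rewrite (le_trans r0).
  have H u : r <= u <= T -> is_derive u 1 (fun r => - w r) (- (X u ^+ m * f u ^+ 2)).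
    by move=> /sub uT; apply: (is_derive_eq (derN (dw uT))); rewrite s_1; ring.
  rewrite -lerN2; apply: (nonincreasing_of_derive rT H).
  move=> u /sub uT; rewrite oppr_le0 mulr_ge0 ?sqr_ge0//.
  by have /andP[] := half_Xn m uT.
have fd r : 0 <= r <= T -> f r <= d.
  move=> rT; rewrite -ler_sqr ?nnegrE ?(ltW d0) ?half_f_ge0// half_energy//.
  have := wT r rT; have X0 := Xge0 rT; have X1 := half_X_le1 rT.
  have : b ^+ 2 <= d ^+ 2 by rewrite ler_sqr ?nnegrE ?(ltW d0) ?(ltW b0).
  have [wn|/ltW wp] := leP (w r) 0; nra.
(* The power [X^(N+2) / (N+2)] cancels the term [X^(N+1) * f] in the derivative of [X * f]; by
   conservation of energy what remains involves only [f], [b] and [d]. *)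
have H u : 0 <= u <= T -> is_derive u 1
    (fun r => 3 / 2 * d * X r - (X r * f r + (N + 2)^-1 * X r ^+ m.+3))
    (3 / 2 * f u ^+ 2 - b ^+ 2 / 2 - 3 / 2 * d * f u).
  move=> uT; have E := half_energy uT.
  apply: (is_derive_eq (derB (derM (der_cst (3 / 2 * d) u) (dX uT))
    (derD (derM (dX uT) (df uT)) (derM (der_cst (N + 2)^-1 u) (derX m.+3 (dX uT)))))).
  rewrite /= s_1.
  have -> : m.+3%:R = N + 2 :> R by rewrite -addn2 natrD.
  have -> : X u ^+ m.+2 = X u * X u ^+ m.+1 by rewrite exprS.
  have n2 : N + 2 != 0 by rewrite gt_eqF// addr_gt0.
  have -> : b ^+ 2 = f u ^+ 2 - 2 * (X u * w u) by rewrite E; ring.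
  move: n2; move: N (X u ^+ m.+1) (w u) => n x v n2; field.
  by rewrite n2.
have := nonincreasing_of_derive T0 H.
move=> /(_ _) K.
have : 3 / 2 * d * X T - (X T * f T + (N + 2)^-1 * X T ^+ m.+3) <=
       3 / 2 * d * X 0 - (X 0 * f 0 + (N + 2)^-1 * X 0 ^+ m.+3).
  by apply: K => u uT; have := fd u uT; have := half_f_ge0 uT; have := sqr_ge0 b; nra.
rewrite XT E0 E1 !mul0r expr1n exprS mul0r !mulr0 !mulr1 addr0 subr0 add0r.
have n2 : 0 < N + 2 by rewrite addr_gt0.
(* The value of [d] makes [1 / (N + 2) - 3 / 2 * d] positive, which is the contradiction. *)
have -> : 3 / 2 * d = 3 / 4 * (N + 2)^-1 by rewrite dE invfM; field; rewrite gt_eqF.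
have : 0 < (N + 2)^-1 by rewrite invr_gt0.
lra.
Qed.

End facts.
End half_branch.

(** * The Lipschitz field, its truncation, and dependence on initial data *)

Section field.
Context {R : realType}.
Notation V := (phase_space R).

(* The Chazy field in the coordinates [(x, y, Z)] with
   [Z = z + (q + 1) / q * |x|^q * y] and [q = m.+1]; it is locally Lipschitz
   for every [q >= 1], even though for [q = 1] the original one jumps at [x = 0]. *)
Definition lfield (m : nat) (p : V) : V :=
  let z := p.2 - (m.+1%:R + 1) / m.+1%:R * `|p.1.1| ^+ m.+1 * p.1.2 in
  (p.1.2, z, `|p.1.1| ^+ m.+1 * z / m.+1%:R).

(** A bound is carried along with the Lipschitz constant because the Lipschitz estimate of a product
    needs bounds on both factors. *)
Definition box_lip (B : R) (f : V -> R) : Prop :=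
  exists2 C : R, 0 <= C & forall p p' : V, `|p| <= B -> `|p'| <= B ->
    `|f p| <= C /\ `|f p - f p'| <= C * `|p - p'|.

Lemma norm3_le (p : V) (B : R) :
  (`|p| <= B) = [&& `|p.1.1| <= B, `|p.1.2| <= B & `|p.2| <= B].
Proof. by rewrite !prod_normE !ge_max andbA. Qed.

Lemma norm3_lt (p : V) (B : R) :
  (`|p| < B) = [&& `|p.1.1| < B, `|p.1.2| < B & `|p.2| < B].
Proof. by rewrite !prod_normE !gt_max andbA. Qed.

Lemma norm3_ge (p : V) : [/\ `|p.1.1| <= `|p|, `|p.1.2| <= `|p| & `|p.2| <= `|p|].
Proof. by have := lexx `|p|; rewrite {1}norm3_le => /and3P[]. Qed.

Lemma box_lip_cst B c : box_lip B (fun=> c).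
Proof.
exists `|c| => // p p' _ _; split => //.
by rewrite subrr normr0 mulr_ge0.
Qed.

Lemma box_lipM B f g : box_lip B f -> box_lip B g -> box_lip B (fun p => f p * g p).
Proof.
move=> [C C0 HC] [D D0 HD]; exists (C * D + C * D).
  by rewrite addr_ge0 ?mulr_ge0.
move=> p p' pB p'B.
have [f1 f2] := HC p p' pB p'B; have [f3 _] := HC p' p p'B pB.
have [g1 g2] := HD p p' pB p'B.
split.
  rewrite normrM; apply: (@le_trans _ _ (C * D)); first exact: ler_pM.
  by rewrite lerDl mulr_ge0.
have -> : f p * g p - f p' * g p' = (f p - f p') * g p + f p' * (g p - g p') by ring.
apply: (le_trans (ler_normD _ _)); rewrite !normrM mulrDl; apply: lerD.
  by rewrite mulrAC; exact: ler_pM.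
by rewrite -mulrA; exact: ler_pM.
Qed.

Lemma box_lipB B f g : box_lip B f -> box_lip B g -> box_lip B (fun p => f p - g p).
Proof.
move=> [C C0 HC] [D D0 HD]; exists (C + D); first exact: addr_ge0.
move=> p p' pB p'B.
have [f1 f2] := HC p p' pB p'B; have [g1 g2] := HD p p' pB p'B.
split; first by apply: (le_trans (ler_normB _ _)); exact: lerD.
have -> : f p - g p - (f p' - g p') = (f p - f p') - (g p - g p') by ring.
by apply: (le_trans (ler_normB _ _)); rewrite mulrDl; exact: lerD.
Qed.

Lemma box_lipX B f n : box_lip B f -> box_lip B (fun p => f p ^+ n).
Proof.
move=> Hf; elim: n => [|n IH]; first exact: box_lip_cst.
have [C C0 HC] := box_lipM Hf IH.
by exists C => // p p' pB p'B; rewrite !exprS; exact: HC.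
Qed.

Lemma box_lip_coord B : 0 <= B -> [/\ box_lip B (fun p => `|p.1.1|),
  box_lip B (fun p => p.1.2) & box_lip B (fun p => p.2)].
Proof.
move=> B0; have B1 : 0 <= B + 1 by rewrite addr_ge0.
have BB (x : R) : `|x| <= B -> `|x| <= B + 1 by move=> /le_trans; apply; rewrite lerDl.
have BD (x d : R) : `|x| <= d -> `|x| <= (B + 1) * d.
  move=> xd; apply: (le_trans xd).
  by rewrite ler_peMl ?lerDr// (le_trans _ xd).
split; exists (B + 1) => // p p'; rewrite !norm3_le => /and3P[p1 p2 p3] /and3P[p1' p2' p3'];
  have [d1 d2 d3] := norm3_ge (p - p'); split.
- by rewrite normr_id; exact: BB.
- by apply: (le_trans (ler_dist_dist _ _)); exact: BD.
- exact: BB.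
- exact: BD.
- exact: BB.
- exact: BD.
Qed.

Lemma lfield_lip m (B : R) : 0 <= B -> exists2 L : R, 0 < L &
  forall p p' : V, `|p| <= B -> `|p'| <= B -> `|lfield m p - lfield m p'| <= L * `|p - p'|.
Proof.
move=> /box_lip_coord[L1 L2 L3].
pose z (p : V) := p.2 - (m.+1%:R + 1) / m.+1%:R * `|p.1.1| ^+ m.+1 * p.1.2.
have Lz : box_lip B z.
  apply: box_lipB => //; apply: box_lipM => //; apply: box_lipM (box_lipX _ L1).
  exact: box_lip_cst.
have Lw : box_lip B (fun p => `|p.1.1| ^+ m.+1 * z p / m.+1%:R).
  apply: box_lipM (box_lip_cst _ _); exact: box_lipM (box_lipX _ L1) Lz.
have [C2 C20 H2] := L2; have [C3 C30 H3] := Lz; have [C4 C40 H4] := Lw.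
exists (1 + C2 + C3 + C4); first by rewrite !ltr_wpDr.
move=> p p' pB p'B.
have [_ h2] := H2 p p' pB p'B; have [_ h3] := H3 p p' pB p'B.
have [_ h4] := H4 p p' pB p'B.
have d0 : 0 <= `|p - p'| by [].
rewrite norm3_le; apply/and3P; split => /=.
- by apply: (le_trans h2); apply: ler_wpM2r => //; lra.
- by apply: (le_trans h3); apply: ler_wpM2r => //; lra.
- by apply: (le_trans h4); apply: ler_wpM2r => //; lra.
Qed.

Lemma lfieldN m p : lfield m (- p) = - lfield m p.
Proof.
case: p => [[x y] z]; rewrite /lfield /= normrN.
move: (`|x| ^+ m.+1) (m.+1%:R^-1) => a n.
by apply/eqP; rewrite !xpair_eqE /=; apply/andP; split; [apply/andP; split|]; apply/eqP; ring.
Qed.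

Definition clamp (B x : R) : R := Num.max (- B) (Num.min B x).

Lemma clamp_id B x : `|x| <= B -> clamp B x = x.
Proof.
rewrite ler_norml => /andP[h1 h2].
by rewrite /clamp (min_idPr h2) (max_idPr h1).
Qed.

Lemma clamp_le B x : 0 <= B -> `|clamp B x| <= B.
Proof.
move=> B0; rewrite ler_norml /clamp le_max lexx /= ge_max ge_min lexx /=.
by rewrite andbT; lra.
Qed.

(** Presents minimum and maximum as linear alternatives, on each of which [lra] settles the
    Lipschitz and oddness claims. *)
Lemma clamp_cases B x :
  (B <= x /\ Num.min B x = B \/ x <= B /\ Num.min B x = x) /\
  (- B <= Num.min B x /\ clamp B x = Num.min B x \/
   Num.min B x <= - B /\ clamp B x = - B).
Proof.
split; first by case: (leP B x) => [?|/ltW ?]; [left|right].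
by rewrite /clamp; case: (leP (- B) (Num.min B x)) => [?|/ltW ?]; [left|right].
Qed.

Lemma clamp_lip B x y : `|clamp B x - clamp B y| <= `|x - y|.
Proof.
have := ler_norm (x - y); have := ler_norm (y - x).
rewrite (distrC y) ler_norml /clamp => h1 h2.
have [] := clamp_cases B x; have [] := clamp_cases B y; rewrite /clamp.
by case=> [[? ?]|[? ?]]; case=> [[? ?]|[? ?]]; case=> [[? ?]|[? ?]];
  case=> [[? ?]|[? ?]]; apply/andP; split; lra.
Qed.

Lemma clampN B x : 0 <= B -> clamp B (- x) = - clamp B x.
Proof.
move=> B0; rewrite /clamp.
have [] := clamp_cases B x; have [] := clamp_cases B (- x); rewrite /clamp.
by case=> [[? ?]|[? ?]]; case=> [[? ?]|[? ?]]; case=> [[? ?]|[? ?]];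
  case=> [[? ?]|[? ?]]; lra.
Qed.

Definition clamp3 (B : R) (p : V) : V := (clamp B p.1.1, clamp B p.1.2, clamp B p.2).

Lemma clamp3_id B p : `|p| <= B -> clamp3 B p = p.
Proof.
by case: p => [[x y] z]; rewrite norm3_le => /and3P[/= *]; rewrite /clamp3 /= !clamp_id.
Qed.

(* The field frozen outside the box of radius 16 is globally Lipschitz; the arcs
   considered here stay in the box of radius 14. *)
Definition cfield m (p : V) := lfield m (clamp3 16 p).

Lemma cfield_id m p : `|p| <= 16 -> cfield m p = lfield m p.
Proof. by move=> /clamp3_id E; rewrite /cfield E. Qed.

Lemma cfield_lip m : exists2 L : R, 0 < L &
  forall p p' : V, `|cfield m p - cfield m p'| <= L * `|p - p'|.
Proof.
have [L L0 H] := @lfield_lip m 16 (ler0n _ _); exists L => // p p'.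
have c16 (u : V) : `|clamp3 16 u| <= 16.
  by rewrite norm3_le /=; apply/and3P; split; apply: clamp_le.
apply: (le_trans (H _ _ (c16 p) (c16 p'))).
apply: ler_wpM2l; first exact: ltW.
rewrite norm3_le /=; have [d1 d2 d3] := norm3_ge (p - p').
by apply/and3P; split; apply: (le_trans (clamp_lip _ _ _)).
Qed.

(** Oddness survives the truncation because the box is symmetric; it lets a mirror image continue an
    arc. *)
Lemma cfieldN m p : cfield m (- p) = - cfield m p.
Proof.
rewrite /cfield -lfieldN; congr lfield.
by rewrite /clamp3 /= !clampN.
Qed.

(** The factor [2 ^+ n] is the one of [gronwall]; past times are handled by reversing time, which
    replaces [F] by [- F]. *)
Lemma ode_dependence (F : V -> V) (L : R) (I : R) (n : nat) (u v : R -> V) : 0 <= L ->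
  (forall p p', `|F p - F p'| <= L * `|p - p'|) ->
  (forall t : R, is_derive t 1 u (F (u t))) ->
  (forall t : R, is_derive t 1 v (F (v t))) ->
  L * I <= n%:R / 2 -> forall t, `|t| <= I -> `|u t - v t| <= 2 ^+ n * `|u 0 - v 0|.
Proof.
move=> L0 FL.
have fwd (G : V -> V) (x y : R -> V) :
  (forall p p', `|G p - G p'| <= L * `|p - p'|) ->
  (forall t : R, is_derive t 1 x (G (x t))) ->
  (forall t : R, is_derive t 1 y (G (y t))) ->
  L * I <= n%:R / 2 -> forall t, 0 <= t <= I -> `|x t - y t| <= 2 ^+ n * `|x 0 - y 0|.
  move=> GL dx dy LI t /[dup] /andP[t0 tI] tt.
  have dD (r : R) : is_derive r 1 (fun r => x r - y r) (G (x r) - G (y r)).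
    exact: is_deriveB (dx r) (dy r).
  have I0 : 0 <= I by rewrite (le_trans t0).
  apply: (@gronwall R V (fun r => x r - y r) L n 0 I) => //.
  - by rewrite subr0.
  - by apply: continuous_bounded => // r _; exact: is_derive_continuous (dD r).
  - move=> r s M _ rs _ HM.
    have dlin (w : R) : is_derive w 1 (fun w => L * M * w) (L * M).
      by apply: (is_derive_eq (derM (der_cst (L * M) w) (der_id w))); rewrite mulr1 mulr0 addr0.
    rewrite mulrBr.
    apply: (mean_value_ineq rs (fun w _ => dD w) (fun w _ => dlin w)) => w wrs.
    by apply: (le_trans (GL _ _)); rewrite ler_wpM2l// HM.
move=> du dv LI t tI; have [t0|/ltW t0] := leP 0 t.
  by apply: (fwd F) => //; rewrite t0 -(ger0_norm t0).
have := fwd (fun p => - F p) (fun r => u (- r)) (fun r => v (- r)).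
rewrite oppr0 => /(_ _ _ _ LI (- t)); rewrite opprK; apply.
- by move=> p p'; rewrite -opprD normrN.
- by move=> r; exact: der_opp (du _).
- by move=> r; exact: der_opp (dv _).
- by rewrite oppr_ge0 t0 -(ler0_norm t0).
Qed.

Lemma exists_nat_half (c : R) : exists n : nat, c <= n%:R / 2.
Proof.
exists (Num.truncn (2 * `|c|)).+1; rewrite ler_pdivlMr// mulrC.
apply: le_trans (ltW (truncnS_gt _)).
by rewrite ler_wpM2l// ler_norm.
Qed.

Lemma is_derive_shift (W : normedModType R) (u : R -> W) (a t : R) (v : W) :
  is_derive (t + a) 1 u v -> is_derive t 1 (fun s => u (s + a)) v.
Proof.
move=> /is_deriveP H; apply/is_deriveP => e e0; have [d d0 Hd] := H e e0.
exists d => // s st; have := Hd (s + a).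
by rewrite (_ : s + a - (t + a) = s - t); [apply|ring].
Qed.

Lemma ode_unique (F : V -> V) (L : R) (u v : R -> V) (a b : R) : 0 <= L ->
  (forall p p', `|F p - F p'| <= L * `|p - p'|) ->
  (forall t : R, is_derive t 1 u (F (u t))) ->
  (forall t : R, is_derive t 1 v (F (v t))) ->
  u a = v b -> forall t, u (t + a) = v (t + b).
Proof.
move=> L0 FL du dv uv t; have [n Hn] := exists_nat_half (L * `|t|).
have := ode_dependence L0 FL (fun r => is_derive_shift (du (r + a)))
  (fun r => is_derive_shift (dv (r + b))) Hn (lexx _).
by rewrite !add0r uv subrr normr0 mulr0 normr_le0 subr_eq0 => /eqP.
Qed.

End field.

(** * Shooting *)

Section shooting.
Context {R : realType}.
Notation V := (phase_space R).

Lemma is_derive_scale (W : normedModType R) (u : R -> W) (s t : R) (v : W) :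
  is_derive (s * t) 1 u v -> is_derive t 1 (fun r => u (s * r)) (s *: v).
Proof.
move=> /is_deriveP H; apply/is_deriveP => e e0.
have s0 : 0 < `|s| + 1 by rewrite ltr_wpDl.
have [d d0 Hd] := H (e / (`|s| + 1)) (divr_gt0 e0 s0).
exists (d / (`|s| + 1)); first by rewrite divr_gt0.
move=> r rt; have srt : `|s * r - s * t| = `|s| * `|r - t| by rewrite -mulrBr normrM.
have := Hd (s * r); rewrite srt => Hr.
rewrite scalerA (mulrC _ s) mulrBr; apply: le_trans (Hr _) _.
  apply: le_lt_trans (_ : (`|s| + 1) * `|r - t| < d).
    by apply: ler_wpM2r => //; rewrite lerDl.
  by rewrite mulrC -ltr_pdivlMr.
rewrite mulrA; apply: ler_wpM2r => //.
by rewrite mulrAC ler_pdivrMr//; apply: ler_wpM2l; [exact: ltW|rewrite lerDl].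
Qed.

Section flow.
Variables (m : nat) (U : R -> R -> V).
Hypothesis U0 : forall b, U b 0 = (1, 0, - (b ^+ 2 / 2)).
Hypothesis dU : forall b t : R, is_derive t 1 (U b) (cfield m (U b t)).

Let X (s b t : R) : R := (U b (s * t)).1.1.
Let f (s b t : R) : R := - s * (U b (s * t)).1.2.
Let Z (s b t : R) : R := (U b (s * t)).2.

Let dUs (s b t : R) : is_derive t 1 (fun r => U b (s * r)) (s *: cfield m (U b (s * t))).
Proof. exact: is_derive_scale. Qed.

Let U_cont (s b : R) : continuous (fun r : R => U b (s * r)).
Proof. by move=> t; exact: is_derive_continuous (dUs s b t). Qed.

Let X_cont (s b : R) : continuous (X s b).
Proof.
by move=> t; have [] := continuous_pair (continuous_pair (@U_cont s b t)).1.
Qed.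

Lemma half_of_flow s b T : s = 1 \/ s = -1 ->
  (forall t, 0 <= t <= T -> 0 <= X s b t) ->
  (forall t, 0 <= t <= T -> `|U b (s * t)| <= 16) ->
  half_branch m s b T (X s b) (f s b) (Z s b).
Proof.
move=> s1 X0 U16; split => //.
  by rewrite /X /f /Z mulr0 U0 /= mulr0.
move=> t tT /=; have := dUs s b t; rewrite cfield_id ?U16//.
have xE : `|(U b (s * t)).1.1| = X s b t by rewrite ger0_norm// X0.
rewrite /lfield xE => /is_derive_pairP[/= /is_derive_pairP[/= H1 H2] H3].
split.
- by apply: (is_derive_eq H1); rewrite /f mulNr opprK.
- apply: (is_derive_eq (derM (der_cst (- s) t) H2)).
  rewrite mulr0 addr0 -[s *: _]/(s * _) /f /Z.
  by case: s1 => ->; ring.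
- apply: (is_derive_eq H3); rewrite -[s *: _]/(s * _) /f /Z.
  by case: s1 => ->; ring.
Qed.

(** Continuation argument: if the norm is at most 14 up to [u], continuity keeps it below 16 a
    little longer; there the truncated field is the true one, and [half_box] brings the bound back
    to 14. *)
Lemma flow_box s b T : s = 1 \/ s = -1 -> 0 < b -> b <= 3 -> 0 <= T ->
  (forall t, 0 <= t <= T -> 0 <= X s b t) ->
  forall t, 0 <= t <= T -> `|U b (s * t)| <= 14.
Proof.
move=> s1 b0 b3 T0 X0.
have sE : `|s| = 1 by case: s1 => ->; rewrite ?normrN normr1.
have b9 : b ^+ 2 <= 9 by rewrite (_ : 9 = 3 ^+ 2) ?ler_sqr ?nnegrE//; [exact: ltW|ring].
have b2 : 0 < b ^+ 2 by rewrite exprn_gt0.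
have box v : 0 <= v <= T -> (forall t, 0 <= t <= v -> `|U b (s * t)| <= 16) ->
    forall t, 0 <= t <= v -> `|U b (s * t)| <= 14.
  move=> /andP[v0 vT] U16 t tv.
  have X0' r : 0 <= r <= v -> 0 <= X s b r.
    by move=> /andP[r0 rv]; apply: X0; rewrite r0 (le_trans rv).
  have HB := half_of_flow s1 X0' U16.
  have f16 r : 0 <= r <= v -> f s b r <= 16.
    move=> /U16; rewrite norm3_le => /and3P[_ H _]; apply: le_trans H.
    by apply: le_trans (ler_norm _) _; rewrite normrM normrN sE mul1r.
  have [h1 h2 h3] := half_box s1 b0 b3 HB f16 tv.
  rewrite norm3_le h1 h3 /= andbT.
  by move: h2; rewrite /f normrM normrN sE mul1r.
suff H : (forall t, 0 <= t <= 0 -> `|U b (s * t)| <= 14) ->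
    forall t, 0 <= t <= T -> `|U b (s * t)| <= 14.
  apply: H => t; rewrite -eq_le => /eqP <-.
  rewrite mulr0 U0 norm3_le /= normr1 normr0 normrN !ler_norml.
  by apply/and3P; split; lra.
apply: (@cousin_induction R (fun u v =>
  (forall t, 0 <= t <= u -> `|U b (s * t)| <= 14) ->
  forall t, 0 <= t <= v -> `|U b (s * t)| <= 14)) => //.
  by move=> u v w _ _ _ _ H1 H2 /H1.
move=> t t0 tT.
have [d d0 Hd] := (for_continuousP _ _).1 (@U_cont s b t) 1 ltr01.
exists d => // u v u0 ut tv vT ud vd H.
apply: box; first by rewrite vT (le_trans t0).
move=> r /andP[r0 rv]; have [ru|/ltW ur] := leP r u.
  by apply: (le_trans (H r _)); rewrite ?r0// ler_nat.
have := H u; rewrite u0 lexx => /(_ isT) Hu.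
have h1 : `|U b (s * r) - U b (s * t)| < 1 by apply: Hd; rewrite ltr_norml; lra.
have h2 : `|U b (s * u) - U b (s * t)| < 1 by apply: Hd; rewrite ltr_norml; lra.
have -> : U b (s * r) = (U b (s * r) - U b (s * t)) - (U b (s * u) - U b (s * t)) + U b (s * u).
  by rewrite opprB addrA subrK subrK.
apply: (le_trans (ler_normD _ _)).
have := ler_normB (U b (s * r) - U b (s * t)) (U b (s * u) - U b (s * t)).
lra.
Qed.

(** [T] is the supremum of the times up to which [X] stays nonnegative, finite by [half_time_le]. At
    a zero of [X] reached in this way the energy gives slope [- b], so [X] turns negative at once.
    Hence [T] is the first zero, and the strict crossing prepares continuity in [b]. *)
Lemma hitting s b : s = 1 \/ s = -1 -> 0 < b -> b <= 3 ->
  exists T, [/\ 0 < T, X s b T = 0, forall t, 0 <= t < T -> 0 < X s b t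
    & forall e, 0 < e -> exists2 t, T < t < T + e & X s b t < 0].
Proof.
move=> s1 b0 b3.
have HBT T : 0 <= T -> (forall t, 0 <= t <= T -> 0 <= X s b t) ->
    half_branch m s b T (X s b) (f s b) (Z s b).
  move=> T0 X0; apply: half_of_flow => // t tT.
  by apply: (le_trans (flow_box s1 b0 b3 T0 X0 tT)); rewrite ler_nat.
pose A := [set T | 0 <= T /\ forall t, 0 <= t <= T -> 0 <= X s b t].
have X00 : X s b 0 = 1 by rewrite /X mulr0 U0.
have A0 : A 0.
  split => // t; rewrite -eq_le => /eqP <-.
  by rewrite X00.
have Aub : has_ubound A.
  exists (1 + 16 / b ^+ 2) => T [T0 X0].
  exact: half_time_le s1 b0 b3 T0 (HBT T T0 X0).
pose T := sup A.
have T0 : 0 <= T by apply: ub_le_sup.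
have XlT t : 0 <= t < T -> 0 <= X s b t.
  move=> /andP[t0 tT].
  have [|r [r0 Hr] tr] := @sup_gt R A t _ tT; first by exists 0.
  by apply: Hr; rewrite t0 ltW.
have XT : 0 <= X s b T.
  rewrite leNgt; apply/negP => XT.
  have [T00|T00] := eqVneq T 0.
    by move: XT; rewrite T00 X00 ltr10.
  have Tpos : 0 < T by rewrite lt_neqAle eq_sym T00.
  have nX : 0 < - X s b T by rewrite oppr_gt0.
  have [d d0 Hd] := (for_continuousP _ _).1 (@X_cont s b T) _ nX.
  pose t := Num.max 0 (T - d / 2).
  have tT : t < T by rewrite gt_max Tpos gtrBl divr_gt0.
  have t0 : 0 <= t by rewrite le_max lexx.
  have td : T - d / 2 <= t by rewrite le_max lexx orbT.
  have : `|X s b t - X s b T| < - X s b T by apply: Hd; rewrite ltr_norml; lra.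
  have := XlT t; rewrite t0 tT => /(_ isT).
  by rewrite ltr_norml; lra.
have X0 t : 0 <= t <= T -> 0 <= X s b t.
  move=> /andP[t0]; rewrite le_eqVlt => /predU1P[->//|tT].
  by apply: XlT; rewrite t0.
have neg t e : 0 <= t -> t <= T -> X s b t = 0 -> 0 < e ->
    exists2 r, t < r < t + e & X s b r < 0.
  move=> t0 tT Xt e0.
  have X0t r : 0 <= r <= t -> 0 <= X s b r.
    by move=> /andP[r0 rt]; apply: X0; rewrite r0 (le_trans rt).
  have HB := HBT t t0 X0t.
  have ft := half_end_f s1 b0 t0 HB Xt.
  case: HB => _ _ /(_ t); rewrite t0 lexx => /(_ isT)[dX _ _].
  rewrite ft in dX.
  have b20 : 0 < b / 2 by rewrite divr_gt0.
  have [d d0 Hd] := (is_deriveP _ _ _).1 dX _ b20.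
  pose h := Num.min (d / 2) (e / 2).
  have h0 : 0 < h by rewrite lt_min !divr_gt0.
  have hd : h <= d / 2 by rewrite ge_min lexx.
  have he : h <= e / 2 by rewrite ge_min lexx orbT.
  exists (t + h); first by apply/andP; split; lra.
  have := Hd (t + h); rewrite (_ : t + h - t = h); last by ring.
  rewrite (gtr0_norm h0) Xt subr0 -[_ *: _]/(_ * _) ler_norml => /(_ _)/andP[|_]; first lra.
  by have := mulr_gt0 h0 b0; nra.
have XT0 : X s b T = 0.
  apply/eqP; rewrite eq_le XT andbT leNgt; apply/negP => XTp.
  have [d d0 Hd] := (for_continuousP _ _).1 (@X_cont s b T) _ XTp.
  have : T + d / 2 <= T.
    apply: ub_le_sup => //; split; first by rewrite addr_ge0// divr_ge0// ltW.
    move=> t /andP[t0 td]; have [tT|/ltW Tt] := leP t T; first by apply: X0; rewrite t0.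
    have : `|X s b t - X s b T| < X s b T by apply: Hd; rewrite ltr_norml; lra.
    by rewrite ltr_norml; lra.
  by rewrite gerDl leNgt divr_gt0.
exists T; split => //.
- rewrite lt_neqAle T0 andbT; apply/eqP => TE.
  by have := XT0; rewrite -TE X00 => /eqP; rewrite oner_eq0.
- move=> t /andP[t0 tT]; rewrite lt_neqAle X0 ?t0 ?ltW// andbT; apply/eqP => /esym Xt.
  have Tt : 0 < T - t by rewrite subr_gt0.
  have [r /andP[tr rT] Xr] := neg t _ t0 (ltW tT) Xt Tt.
  have : 0 <= X s b r by apply: X0; apply/andP; split; lra.
  by rewrite leNgt Xr.
- by move=> e; apply: neg.
Qed.

End flow.

(** Signs persist under small uniform perturbations: the negative value shortly after [T b] bounds
    [T b'] from above, and the positive minimum on [[0, r]], with [r] just before [T b], bounds it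
    from below. *)
Lemma hitting_continuous (f : R -> R -> R) (T : R -> R) (E : set R) :
  (forall b, E b -> 0 < T b) ->
  (forall b, E b -> forall t, 0 <= t < T b -> 0 < f b t) ->
  (forall b, E b -> forall e, 0 < e -> exists2 t, T b < t < T b + e & f b t < 0) ->
  (forall b, E b -> continuous (f b)) ->
  (forall b, E b -> forall I e, 0 < e -> exists2 d, 0 < d &
     forall b', E b' -> `|b' - b| < d -> forall t, 0 <= t <= I -> `|f b' t - f b t| < e) ->
  forall b, E b -> forall e, 0 < e -> exists2 d, 0 < d &
     forall b', E b' -> `|b' - b| < d -> `|T b' - T b| < e.
Proof.
move=> T0 fpos fneg fc funif b Eb e e0.
have Tb := T0 b Eb.
have [t /andP[t1 t2] ft] := fneg b Eb e e0.
have nft : 0 < - f b t by rewrite oppr_gt0.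
have [d1 d10 H1] := funif b Eb t _ nft.
pose r := Num.max 0 (T b - e / 2).
have rT : r < T b by rewrite gt_max Tb gtrBl divr_gt0.
have r0 : 0 <= r by rewrite le_max lexx.
have re : T b - e / 2 <= r by rewrite le_max lexx orbT.
have [c + Hc] := EVT_min r0 (continuous_subspaceT (fc b Eb)).
rewrite in_itv /= => /andP[c0 cr].
have mu0 : 0 < f b c by apply: fpos => //; rewrite c0 (le_lt_trans cr).
have [d2 d20 H2] := funif b Eb r _ mu0.
exists (Num.min d1 d2); first by rewrite lt_min d10.
move=> b' Eb'; rewrite lt_min => /andP[/(H1 _ Eb') B1 /(H2 _ Eb') B2].
have up : T b' <= t.
  rewrite leNgt; apply/negP => tT.
  have tt : 0 <= t by lra.
  have := fpos b' Eb' t; rewrite tt tT => /(_ isT).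
  by have := B1 t; rewrite tt lexx ltr_norml => /(_ isT); lra.
have lo : r <= T b'.
  rewrite leNgt; apply/negP => Tr; have rT' : 0 < r - T b' by rewrite subr_gt0.
  have [u /andP[u1 u2] fu] := fneg b' Eb' _ rT'.
  have u0 : 0 <= u by rewrite (le_trans _ (ltW u1))// ltW// T0.
  have ur : u <= r by lra.
  have := B2 u; rewrite u0 ur => /(_ isT).
  have : f b c <= f b u by apply: Hc; rewrite in_itv /= u0.
  by rewrite ltr_norml; lra.
by rewrite ltr_norml; apply/andP; split; lra.
Qed.

End shooting.

(** * Joining the two half arcs into a periodic orbit *)

Section periodic.
Context {R : realType}.
Notation V := (phase_space R).

Lemma periodic_ind (P : R -> Prop) (L : R) : 0 < L ->
  (forall t, 0 <= t <= L -> P t) -> (forall t, P t <-> P (t + L)) -> forall t, P t.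
Proof.
move=> L0 P0 PL.
have PLn n t : P t <-> P (t + n%:R * L).
  elim: n => [|n IH]; first by rewrite mul0r addr0.
  by rewrite -natr1 mulrDl mul1r addrA -PL.
have pos n : forall t, 0 <= t <= n%:R * L -> P t.
  elim: n => [|n IH] t.
    by rewrite mul0r => /andP[t0 t1]; apply: P0; rewrite t0 (le_trans t1)// ltW.
  rewrite -natr1 mulrDl mul1r => /andP[t0 tn].
  have [tL|/ltW Lt] := leP t L; first by apply: P0; rewrite t0.
  rewrite -(subrK L t); apply: (PL (t - L)).1; apply: IH.
  by apply/andP; split; lra.
move=> t; pose n := (Num.truncn (`|t| / L)).+1.
have tn : `|t| < n%:R * L by rewrite -ltr_pdivrMr// truncnS_gt.
have n2 : (n + n)%:R * L = n%:R * L + n%:R * L by rewrite natrD mulrDl.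
apply: (PLn n t).2; apply: (pos (n + n)%N); rewrite n2.
by move: tn; rewrite ltr_norml => /andP[h1 h2]; apply/andP; split; lra.
Qed.

Definition energy (m : nat) (p : V) : R :=
  p.1.1 * p.2 - p.1.1 * `|p.1.1| ^+ m.+1 * p.1.2 / m.+1%:R - p.1.2 ^+ 2 / 2.

Lemma energyN m p : energy m (- p) = energy m p.
Proof.
case: p => [[x y] z]; rewrite /energy /= normrN.
by move: (`|x| ^+ m.+1) (m.+1%:R^-1) => a n; ring.
Qed.

Section shoot.
Variables (m : nat) (U : R -> R -> V) (T : R -> R -> R).
Hypothesis U0 : forall b, U b 0 = (1, 0, - (b ^+ 2 / 2)).
Hypothesis dU : forall b t : R, is_derive t 1 (U b) (cfield m (U b t)).
Hypothesis HT : forall s b, s = 1 \/ s = -1 -> 0 < b -> b <= 3 ->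
  [/\ 0 < T s b, (U b (s * T s b)).1.1 = 0,
      forall t, 0 <= t < T s b -> 0 < (U b (s * t)).1.1
    & forall e, 0 < e -> exists2 t, T s b < t < T s b + e & (U b (s * t)).1.1 < 0].

Let U_cont (b : R) : continuous (U b).
Proof. by move=> t; exact: is_derive_continuous (dU b t). Qed.

Let Us_cont (s b : R) : continuous (fun t : R => (U b (s * t)).1.1).
Proof.
move=> t.
have H := is_derive_continuous (is_derive_scale (dU b (s * t))).
by have [] := continuous_pair (continuous_pair H).1.
Qed.

Let pm (s : R) := s = 1 \/ s = -1.
Let pmE s : pm s -> `|s| = 1.
Proof. by case=> ->; rewrite ?normrN normr1. Qed.

Let E : set R := [set b | 0 < b <= 3].

Let unif b : E b -> forall I e, 0 < e -> exists2 d, 0 < d &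
  forall b', E b' -> `|b' - b| < d -> forall t, `|t| <= I -> `|U b' t - U b t| < e.
Proof.
move=> /andP[b0 b3] I e e0; have [L L0 FL] := @cfield_lip R m.
have [n Hn] := exists_nat_half (L * I).
(* For [0 < b <= 3] the initial point depends on [b] with Lipschitz constant 3, since
   [(b' + b) / 2 <= 3]; the flow multiplies distances by at most [2 ^+ n]. *)
have c0 : 0 < 2 ^+ n * 3 :> R by rewrite mulr_gt0 ?exprn_gt0.
exists (e / (2 ^+ n * 3)); first by rewrite divr_gt0.
move=> b' /andP[b'0 b'3] bb' t tI.
apply: (le_lt_trans (ode_dependence (ltW L0) FL (dU b') (dU b) Hn tI)).
rewrite ltr_pdivlMr// in bb'; apply: le_lt_trans bb'.
rewrite mulrCA; apply: ler_wpM2l; first by rewrite exprn_ge0.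
rewrite !U0 norm3_le /= !subrr !normr0 -opprD normrN.
have -> : b' ^+ 2 / 2 - b ^+ 2 / 2 = (b' - b) * ((b' + b) / 2) by field.
have h : 0 <= (b' + b) / 2 <= 3 by apply/andP; split; lra.
case/andP: h => h1 h2.
rewrite normrM (ger0_norm h1) mulr_ge0//=.
exact: ler_wpM2l.
Qed.

Let T_cont s b : pm s -> E b -> forall e, 0 < e -> exists2 d, 0 < d &
  forall b', E b' -> `|b' - b| < d -> `|T s b' - T s b| < e.
Proof.
move=> s1; apply: (hitting_continuous (f := fun b t => (U b (s * t)).1.1)).
- by move=> c /andP[c0 c3]; have [] := HT s1 c0 c3.
- by move=> c /andP[c0 c3]; have [] := HT s1 c0 c3.
- by move=> c /andP[c0 c3]; have [] := HT s1 c0 c3.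
- by move=> c _; exact: Us_cont.
move=> c Ec I e e0; have [d d0 Hd] := unif Ec I e0; exists d => // b' Eb' bb' t /andP[t0 tI].
have := Hd b' Eb' bb' (s * t); rewrite normrM (pmE s1) mul1r ger0_norm// => /(_ tI).
by rewrite norm3_lt => /and3P[].
Qed.

Let z s b := (U b (s * T s b)).2.

(** The end value moves for two reasons, each worth at most [e / 2]: the hitting time changes along
    a fixed trajectory, and the trajectory changes at a fixed time. Keeping the new hitting time
    below [T s b + 1] gives a fixed window for the second. *)
Let z_cont s b : pm s -> E b -> forall e, 0 < e -> exists2 d, 0 < d &
  forall b', E b' -> `|b' - b| < d -> `|z s b' - z s b| < e.
Proof.
move=> s1 Eb e e0; have e2 : 0 < e / 2 by rewrite divr_gt0.
have [d1 d10 H1] := (for_continuousP _ _).1 (@U_cont b (s * T s b)) _ e2.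
have [d2 d20 H2] := T_cont s1 Eb d10.
have [d3 d30 H3] := T_cont s1 Eb ltr01.
have [d4 d40 H4] := unif Eb (T s b + 1) e2.
exists (Num.min (Num.min d2 d3) d4); first by rewrite !lt_min d20 d30 d40.
move=> b' Eb'; rewrite !lt_min => /andP[/andP[B2 B3] B4].
have T'1 : `|s * T s b'| <= T s b + 1.
  have /andP[c0 c3] := Eb'; have [T0 _ _ _] := HT s1 c0 c3.
  rewrite normrM (pmE s1) mul1r ger0_norm ?ltW//.
  by have := H3 b' Eb' B3; rewrite ltr_norml => /andP[]; lra.
have := H4 b' Eb' B4 _ T'1; rewrite norm3_lt => /and3P[_ _ K1].
have : `|U b (s * T s b') - U b (s * T s b)| < e / 2.
  by apply: H1; rewrite -mulrBr normrM (pmE s1) mul1r; exact: H2.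
rewrite norm3_lt => /and3P[_ _ K2].
have -> : z s b' - z s b = ((U b' (s * T s b')).2 - (U b (s * T s b')).2)
  + ((U b (s * T s b')).2 - (U b (s * T s b)).2) by rewrite /z; ring.
apply: (le_lt_trans (ler_normD _ _)).
by move: K1 K2 => /=; lra.
Qed.

Let branch s b : pm s -> E b ->
  half_branch m s b (T s b) (fun t => (U b (s * t)).1.1)
    (fun t => - s * (U b (s * t)).1.2) (fun t => (U b (s * t)).2)
  /\ forall t, 0 <= t <= T s b -> `|U b (s * t)| <= 14.
Proof.
move=> s1 /andP[b0 b3]; have [T0 XT Xpos _] := HT s1 b0 b3.
have X0 t : 0 <= t <= T s b -> 0 <= (U b (s * t)).1.1.
  move=> /andP[t0]; rewrite le_eqVlt => /predU1P[->|tT]; first by rewrite XT.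
  by apply: ltW; apply: Xpos; rewrite t0.
have box := flow_box U0 dU s1 b0 b3 (ltW T0) X0.
split => //; apply: half_of_flow => // t /box tb.
by apply: (le_trans tb); rewrite ler_nat.
Qed.

Let d : R := (2 * (m.+1%:R + 2))^-1.

Let shoot_zero : exists2 b, E b & z 1 b + z (-1) b = 0.
Proof.
have p1 : pm 1 by left.
have p2 : pm (-1) by right.
have N1 : 1 <= m.+1%:R :> R by rewrite ler1n.
have d0 : 0 < d by rewrite invr_gt0 mulr_gt0// addr_gt0// (lt_le_trans ltr01).
have d1 : d <= 1 / 6.
  rewrite /d -[leLHS]mul1r ler_pdivrMr ?mulr_gt0 ?addr_gt0 ?(lt_le_trans ltr01)//.
  lra.
(* At [b0] the lower bounds for the two end values add up to [d^2 / 2 - b0^2 - b0 = b0 - b0^2],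
   which is nonnegative because [b0 <= 1 / 4]. *)
pose b0 := d ^+ 2 / 4.
have b0E : E b0.
  by apply/andP; split; [rewrite divr_gt0 ?exprn_gt0|rewrite /b0; nra].
have E3 : E 3 by rewrite /E /=; apply/andP; split.
have b03 : b0 <= 3 by case/andP: b0E.
have Ei b : b \in `[b0, 3] -> E b.
  by rewrite in_itv /= => /andP[h1 h2]; case/andP: b0E => h3 _; rewrite /E /= (lt_le_trans h3).
have C : {within `[b0, 3], continuous (fun b => z 1 b + z (-1) b)}.
  apply/subspace_continuousP => b /Ei Eb; apply/cvgrPdist_lt => e e0.
  have e2 : 0 < e / 2 by rewrite divr_gt0.
  have [d1' d10 H1] := z_cont p1 Eb e2; have [d2 d20 H2] := z_cont p2 Eb e2.
  exists (Num.min d1' d2); first by rewrite /= lt_min d10.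
  move=> b'; rewrite /ball /= distrC lt_min => /andP[B1 B2] /Ei Eb'.
  rewrite distrC; have -> : z 1 b' + z (-1) b' - (z 1 b + z (-1) b) =
    (z 1 b' - z 1 b) + (z (-1) b' - z (-1) b) by ring.
  apply: (le_lt_trans (ler_normD _ _)).
  by have := H1 b' Eb' B1; have := H2 b' Eb' B2; lra.
have lo : z 1 3 + z (-1) 3 <= 0.
  have /andP[c0 c3] := E3.
  have [T1 X1 _ _] := HT p1 c0 c3; have [T2 X2 _ _] := HT p2 c0 c3.
  have [HB1 _] := branch p1 E3; have [HB2 box] := branch p2 E3.
  have /andP[_ h1] := half_end_forward p1 c0 (ltW T1) HB1 erefl X1.
  have f16 r : 0 <= r <= T (-1) 3 -> - -1 * (U 3 (-1 * r)).1.2 <= 16.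
    move=> /box; rewrite norm3_le => /and3P[_ H _]; rewrite opprK mul1r.
    by apply: (le_trans (ler_norm _)); apply: (le_trans H); rewrite ler_nat.
  have h2 := half_end_backward_le p2 c0 c3 (ltW T2) HB2 erefl X2 f16.
  by rewrite /z; move: h1 h2 => /=; lra.
have hi : 0 <= z 1 b0 + z (-1) b0.
  have /andP[c0 c3] := b0E.
  have [T1 X1 _ _] := HT p1 c0 c3; have [T2 X2 _ _] := HT p2 c0 c3.
  have [HB1 _] := branch p1 b0E; have [HB2 _] := branch p2 b0E.
  have /andP[h1 _] := half_end_forward p1 c0 (ltW T1) HB1 erefl X1.
  have b0d : b0 <= d by rewrite /b0; nra.
  have h2 := half_end_backward_ge p2 c0 (ltW T2) HB2 erefl X2 erefl b0d.
  rewrite -/d in h2.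
  have b2 : b0 ^+ 2 <= b0 * (1 / 4).
    by rewrite expr2; apply: ler_wpM2l; [exact: ltW|rewrite /b0; nra].
  have b4 : d ^+ 2 = 4 * b0 by rewrite /b0; field.
  by rewrite /z; move: h1 h2 => /=; rewrite b4; lra.
have [|b /Ei Eb zb] := @IVT R (fun b => z 1 b + z (-1) b) b0 3 0 b03 C.
  by rewrite ge_min le_max lo hi orbT.
by exists b.
Qed.

Lemma periodic_of_flow : exists (g : R -> V) (L : R),
  [/\ 0 < L, forall t : R, is_derive t 1 g (lfield m (g t)),
      (forall t, g (t + L) = - g t) /\ energy m (g 0) < 0,
      [/\ (g 0).1.1 = 0, 0 < (g 0).1.2 & forall t, 0 < t < L -> 0 < (g t).1.1]
    & forall t, energy m (g t) = energy m (g 0)].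
Proof.
have [b Eb zb] := shoot_zero.
have p1 : pm 1 by left.
have p2 : pm (-1) by right.
have /andP[b0 b3] := Eb.
have [T1 X1 Xpos1 _] := HT p1 b0 b3; have [T2 X2 Xpos2 _] := HT p2 b0 b3.
have [HB1 box1] := branch p1 Eb; have [HB2 box2] := branch p2 Eb.
have f1 := half_end_f p1 b0 (ltW T1) HB1 X1.
have f2 := half_end_f p2 b0 (ltW T2) HB2 X2.
move: T1 X1 Xpos1 HB1 box1 T2 X2 Xpos2 HB2 box2 f1 f2 zb; rewrite /z.
move: (T 1 b) (T (-1) b) => t1 t2 T1 X1 Xpos1 HB1 box1 T2 X2 Xpos2 HB2 box2 f1 f2 zb.
have [L L0 FL] := @cfield_lip R m.
have dN (t : R) : is_derive t 1 (fun t => - U b t) (cfield m (- U b t)).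
  by rewrite cfieldN; exact: is_deriveN (dU b t).
(* Both ends have [x = 0], the values of [y] are [- b] and [b], and the zero of the shooting
   function supplies the third coordinate. Since [- U b] is again a solution, uniqueness turns this
   one coincidence into antiperiodicity. *)
have end_eq : U b t1 = - U b (- t2).
  move: X1 X2 f1 f2 zb; rewrite !mul1r !mulN1r opprK mul1r.
  move: (U b t1) (U b (- t2)) => [[x y] v] [[x' y'] v'] /= -> -> fy -> zz.
  apply/eqP; rewrite !xpair_eqE /= oppr0 eqxx /=.
  by apply/andP; split; apply/eqP; lra.
have shift := ode_unique (ltW L0) FL (dU b) dN end_eq.
pose g t := U b (t - t2).
have gL t : g (t + (t1 + t2)) = - g t.
  rewrite /g (_ : t + (t1 + t2) - t2 = t + t1); last by ring.
  exact: shift.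
have Lpos : 0 < t1 + t2 by rewrite addr_gt0.
have cover t : 0 <= t <= t1 + t2 ->
   (exists2 r, 0 <= r <= t1 & t - t2 = 1 * r) \/ (exists2 r, 0 <= r <= t2 & t - t2 = -1 * r).
  move=> /andP[h1 h2]; have [h|h] := leP t2 t.
    by left; exists (t - t2); [apply/andP; split; lra|rewrite mul1r].
  by right; exists (t2 - t); [apply/andP; split; lra|rewrite mulN1r opprB].
(* The bound on one antiperiod spreads to all times, so along [g] the truncated field is the true
   one. *)
have box t : `|g t| <= 14.
  move: t; apply: (periodic_ind Lpos).
    by move=> t /cover[[r rr E1]|[r rr E1]]; rewrite /g E1; [exact: box1|exact: box2].
  by move=> t; rewrite gL normrN.
have g16 t : `|g t| <= 16 by apply: (le_trans (box t)); rewrite ler_nat.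
have xpos t : 0 < t < t1 + t2 -> 0 < (g t).1.1.
  move=> /andP[h1 h2]; rewrite /g; have [h|h] := leP t2 t.
    by rewrite -(mul1r (t - t2)); apply: Xpos1; apply/andP; split; lra.
  by rewrite -(opprB t2) -mulN1r; apply: Xpos2; apply/andP; split; lra.
have g0 : (g 0).1.1 = 0 /\ (g 0).1.2 = b.
  by move: X2 f2; rewrite /g sub0r !mulN1r opprK mul1r.
have en t : energy m (g t) = - (b ^+ 2 / 2).
  move: t; apply: (periodic_ind Lpos); last by move=> t; rewrite gL energyN.
  have half s r tt : pm s -> 0 <= r <= tt -> half_branch m s b tt (fun t => (U b (s * t)).1.1)
      (fun t => - s * (U b (s * t)).1.2) (fun t => (U b (s * t)).2) ->
      energy m (U b (s * r)) = - (b ^+ 2 / 2).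
    move=> s1 rr HB; have := half_energy s1 HB rr.
    case: HB => _ /(_ r rr) X0 _; rewrite /energy (ger0_norm X0).
    move: (U b (s * r)) => [[x y] v] /=; move: (x ^+ m.+1) (m.+1%:R^-1) => a n.
    have -> : (- s * y) ^+ 2 = y ^+ 2 by case: s1 => ->; ring.
    have -> : s * n * a * (- s * y) = - (n * a * y) by case: s1 => ->; ring.
    by move=> ->; field.
  by move=> t /cover[[r rr E1]|[r rr E1]]; rewrite /g E1; [exact: half HB1|exact: half HB2].
exists g, (t1 + t2); split => //.
- by move=> t; rewrite -cfield_id//; exact: is_derive_shift (dU b (t - t2)).
- by split => //; rewrite en oppr_lt0 divr_gt0// exprn_gt0.
- by case: g0 => -> ->.
- by move=> t; rewrite !en.
Qed.

End shoot.

Theorem periodic_solution (m : nat) : exists (g : R -> V) (L : R),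
  [/\ 0 < L, forall t : R, is_derive t 1 g (lfield m (g t)),
      (forall t, g (t + L) = - g t) /\ energy m (g 0) < 0,
      [/\ (g 0).1.1 = 0, 0 < (g 0).1.2 & forall t, 0 < t < L -> 0 < (g t).1.1]
    & forall t, energy m (g t) = energy m (g 0)].
Proof.
have [L L0 FL] := @cfield_lip R m.
have [U HU] : {U : R -> R -> V & forall b, U b 0 = (1, 0, - (b ^+ 2 / 2)) /\
    forall t : R, is_derive t 1 (U b) (cfield m (U b t))}.
  apply: (@choice _ _ (fun (b : R) (u : R -> V) => u 0 = (1, 0, - (b ^+ 2 / 2)) /\
    forall t : R, is_derive t 1 u (cfield m (u t)))) => b.
  by have [u u0 du] := picard L0 FL (1, 0, - (b ^+ 2 / 2)); exists u.
have U0 b := (HU b).1; have dU b := (HU b).2.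
pose P (sb : R * R) T := sb.1 = 1 \/ sb.1 = -1 -> 0 < sb.2 -> sb.2 <= 3 ->
  [/\ 0 < T, (U sb.2 (sb.1 * T)).1.1 = 0,
      forall t, 0 <= t < T -> 0 < (U sb.2 (sb.1 * t)).1.1
    & forall e, 0 < e -> exists2 t, T < t < T + e & (U sb.2 (sb.1 * t)).1.1 < 0].
have [T HT] : {T : R * R -> R & forall sb, P sb (T sb)}.
  (* Outside the admissible range of [s] and [b] the premises of [P] are false, and 0 is a dummy
     value. *)
  apply: (@choice _ _ P) => -[s b].
  have [s1|s1] := pselect (s = 1 \/ s = -1); last by exists 0 => /s1.
  have [b0|b0] := ltP 0 b; last by exists 0 => _ /=; rewrite ltNge b0.
  have [b3|b3] := leP b 3; last by exists 0 => _ _ /=; rewrite leNgt b3.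
  by have [T ?] := hitting U0 dU s1 b0 b3; exists T.
exact: periodic_of_flow U0 dU (fun s b => HT (s, b)).
Qed.

End periodic.

(** * Filippov trajectories *)

Section filippov_sets.
Context {R : realType}.
Notation V := (phase_space R).

(* These are the times at which a trajectory crosses the discontinuity plane. *)
Lemma transversal_zeros_negligible (x : R -> R) : (@lebesgue_measure R).-negligible
  [set t | x t = 0 /\ exists2 d : R, d != 0 & is_derive t 1 x d].
Proof.
set S := [set t | _].
have iso t : S t -> exists2 d : R, 0 < d & forall s, `|s - t| < d -> x s = 0 -> s = t.
  move=> [xt [v v0 dv]]; have v2 : 0 < `|v| / 2 by rewrite divr_gt0 ?normr_gt0.
  have [d d0 Hd] := (is_deriveP _ _ _).1 dv _ v2.
  exists d => // s /Hd + xs; rewrite xs xt subrr sub0r normrN normrZ => H.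
  apply/eqP; rewrite -subr_eq0 -normr_le0 leNgt; apply/negP => st.
  by have := mulr_gt0 st v2; nra.
(* A rational placed to the right of a crossing and before any further zero determines the crossing,
   so there are countably many. *)
have [r Hr] : {r : R -> rat & forall t, S t ->
    t < ratr (r t) /\ forall s, t <= s -> s < ratr (r t) -> x s = 0 -> s = t}.
  apply: (@choice _ _ (fun (t : R) (r : rat) => S t ->
    t < ratr r /\ forall s, t <= s -> s < ratr r -> x s = 0 -> s = t)) => t.
  have [St|nSt] := pselect (S t); last by exists 0.
  have [d d0 Hd] := iso t St.
  have /rat_in_itvoo[r] : t < t + d by rewrite ltrDl.
  rewrite in_itv /= => /andP[r1 r2]; exists r => _; split => // s ts sr.
  by apply: Hd; rewrite ger0_norm ?subr_ge0// ltrBlDl (lt_trans sr).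
have cS : countable S.
  apply/countable_injP; exists (fun t => pickle (r t)) => t t'.
  rewrite !inE => St St' /(pcan_inj pickleK) rr.
  wlog tt' : t t' St St' rr / t <= t'.
    move=> W; have [tt'|/ltW tt'] := leP t t'; first exact: W.
    by apply/esym; apply: W.
  have [_ Ht] := Hr t St; apply/esym; apply: Ht => //; last by case: St'.
  by rewrite rr; have [] := Hr t' St'.
exists S; split => //; last exact: countable_lebesgue_measure0.
apply: countable_measurable cS => t. exact: measurable_set1.
Qed.

(** In the sup norm a ball is an open cube, of volume [(2 * r)^3 > 0]. Consequently discarding null
    sets does not remove the value of the field at a continuity point from the Filippov set. *)
Lemma lebesgue3_ball_not_negligible (p : V) (r : R) (N : set V) : 0 < r ->
  (@lebesgue3 R).-negligible N -> exists2 p', ball p r p' & ~ N p'.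
Proof.
move=> r0 [A [mA A0 NA]]; apply: contrapT => H.
pose I (c : R) : set R := `]c - r, c + r[%classic.
have mI c : measurable (I c) by exact: measurable_itv.
have muI c : lebesgue_measure (I c) = (2 * r)%:E.
  rewrite /I lebesgue_measure_itv /= lte_fin ifT; last by lra.
  by rewrite -EFinB; congr EFin; ring.
pose B := (I p.1.1 `*` I p.1.2) `*` I p.2.
have BA : B `<=` A.
  move=> [[x y] z] [[/= Ix Iy] Iz]; apply: NA; apply: contrapT => NN; apply: H.
  exists (x, y, z) => //.
  have bI (c u : R) : I c u -> ball c r u.
    by rewrite /I /= in_itv /= => /andP[h1 h2]; rewrite /ball /= ltr_norml; lra.
  by split; [split|]; apply: bI.
have mB1 : measurable (I p.1.1 `*` I p.1.2) := measurableX (mI _) (mI _).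
have mB : measurable B := measurableX mB1 (mI _).
rewrite /lebesgue3 in A0.
have : (((@lebesgue_measure R \x @lebesgue_measure R) \x @lebesgue_measure R) B <=
    ((@lebesgue_measure R \x @lebesgue_measure R) \x @lebesgue_measure R) A)%E.
  by apply: le_measure; rewrite ?inE.
have -> : ((@lebesgue_measure R \x @lebesgue_measure R) \x @lebesgue_measure R)%E B =
    (2 * r * (2 * r) * (2 * r))%:E.
  have E2 := product_measure1E lebesgue_measure lebesgue_measure (mI p.1.1) (mI p.1.2).
  have E3 := product_measure1E (lebesgue_measure \x lebesgue_measure)%E lebesgue_measure mB1 (mI p.2).
  rewrite E3 [RHS]EFinM; congr (_ * _)%E; last exact: muI.
  by apply: etrans E2 _; rewrite [RHS]EFinM; congr (_ * _)%E; exact: muI.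
by rewrite A0 lee_fin leNgt !mulr_gt0.
Qed.

Lemma filippov_sub (f : V -> V) (p : V) (d : R) (B : set V) : 0 < d ->
  @convex_set R V B -> closed B -> f @` ball p d `<=` B -> filippov f p `<=` B.
Proof.
move=> d0 cB clB fB v.
have n0 : (@lebesgue3 R).-negligible set0.
  exists set0; split => //; exact: (measure0
    ((@lebesgue_measure R \x @lebesgue_measure R) \x @lebesgue_measure R)%E).
move=> /(_ d d0 set0 n0).
by apply; split => //; rewrite setD0.
Qed.

(** Used with [h] the identity and with [h] the first coordinate, to trap Filippov velocities in
    closed convex sets. *)
Lemma convex_closed_tube (W : normedModType R) (h : V -> W) (c : W) (e : R) :
  (forall a b u v, h (a *: u + b *: v) = a *: h u + b *: h v) ->
  (forall u v, `|h u - h v| <= `|u - v|) ->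
  @convex_set R V [set v | `|h v - c| <= e] /\ closed [set v | `|h v - c| <= e].
Proof.
move=> hl hlip; split.
  move=> x y l; rewrite !inE /= => hx hy.
  have -> : h (conv l x y) - c =
      l%:inum *: (h x - c) + (1 - l%:inum) *: (h y - c).
    rewrite [conv l x y]/(l%:inum *: (x : V) + (1 - l%:inum) *: (y : V)) hl.
    rewrite !scalerBr addrACA -opprD -scalerDl.
    rewrite (_ : l%:inum + (1 - l%:inum) = 1); last by ring.
    by rewrite scale1r.
  apply: (le_trans (ler_normD _ _)); rewrite !normrZ.
  have l0 : 0 <= l%:inum :> R by [].
  have l1 : l%:inum <= 1 :> R by [].
  have l2 : 0 <= (1 - l%:inum) :> R by rewrite subr_ge0.
  rewrite !ger0_norm//; move: l0 l2.
  move: (l%:inum) => a a0 a1; nra.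
move=> v clv; rewrite /= leNgt; apply/negP => hv.
have hv0 : 0 < `|h v - c| - e by rewrite subr_gt0.
have [u [/= Au]] := clv _ (nbhsx_ballx v _ hv0).
rewrite -ball_normE /= => bu; have := hlip v u.
have := ler_normD (h v - h u) (h u - c); rewrite subrKA; lra.
Qed.

End filippov_sets.

(** * Passing between the Chazy field and the field in the coordinates (x, y, Z) *)

Section bridge.
Context {R : realType}.
Notation V := (phase_space R).

(** Covers [|x|^q] and [|x|^q * y] at [x = 0]: a factor of first order times a vanishing continuous
    factor has zero derivative. *)
Lemma der_zero_prod (u v w : R -> R) (t du : R) : is_derive t 1 u du -> u t = 0 ->
  {for t, continuous v} -> v t = 0 -> (forall s, `|w s| <= `|u s| * `|v s|) ->
  is_derive t 1 w 0.
Proof.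
move=> /is_deriveP Hu ut /for_continuousP cv vt Hw; apply/is_deriveP => e e0.
have wt : w t = 0.
  by apply/eqP; rewrite -normr_le0 (le_trans (Hw t))// ut normr0 mul0r.
have C0 : 0 < `|du| + 1 by rewrite ltr_wpDl.
have [d1 d10 H1] := Hu 1 ltr01.
have [d2 d20 H2] := cv (e / (`|du| + 1)) (divr_gt0 e0 C0).
exists (Num.min d1 d2); first by rewrite lt_min d10.
move=> s; rewrite lt_min => /andP[/H1 s1 /H2 s2].
rewrite wt scaler0 !subr0; apply: le_trans (Hw s) _.
rewrite vt subr0 in s2; rewrite ut subr0 mul1r in s1.
have us : `|u s| <= (`|du| + 1) * `|s - t|.
  have := ler_normD (u s - (s - t) *: du) ((s - t) *: du).
  by rewrite subrK normrZ; nra.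
apply: le_trans (ler_pM _ _ us (ltW s2)) _ => //.
by rewrite mulrAC mulrCA divff ?gt_eqF// mulr1.
Qed.

(** At [x t = 0] the stated derivative is 0 by the convention on division, and this is the true
    value once the exponent exceeds 1. *)
Lemma der_abs_pow (m : nat) (x : R -> R) (t dx : R) : (0 < m)%N \/ x t != 0 ->
  is_derive t 1 x dx ->
  is_derive t 1 (fun s => `|x s| ^+ m.+1) (m.+1%:R * (`|x t| ^+ m.+1 / x t) * dx).
Proof.
move=> mx Hx; have cx := is_derive_continuous Hx.
have [x0|x0|x0] := ltgtP (x t) 0.
- apply: (@near_eq_is_derive _ _ _ (fun s => (- x s) ^+ m.+1)).
    have nx : 0 < - x t by rewrite oppr_gt0.
    have [d d0 Hd] := (for_continuousP _ _).1 cx _ nx.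
    exists d => // s; rewrite /ball /= distrC => /Hd.
    by rewrite ltr_norml => /andP[_ h]; rewrite ltr0_norm//; lra.
  apply: (is_derive_eq (derX m.+1 (derN Hx))).
  rewrite ltr0_norm// [(- x t) ^+ m.+1]exprS /=.
  by field; rewrite lt_eqF.
- apply: (@near_eq_is_derive _ _ _ (fun s => x s ^+ m.+1)).
    have [d d0 Hd] := (for_continuousP _ _).1 cx _ x0.
    exists d => // s; rewrite /ball /= distrC => /Hd.
    by rewrite ltr_norml => /andP[h _]; rewrite gtr0_norm//; lra.
  apply: (is_derive_eq (derX m.+1 Hx)).
  by rewrite gtr0_norm// [x t ^+ m.+1]exprS /=; field; rewrite gt_eqF.
- have m0 : (0 < m)%N by case: mx => //; rewrite x0 eqxx.
  rewrite x0 normr0 expr0n /= !mul0r mulr0 mul0r.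
  apply: (@der_zero_prod x (fun s => x s ^+ m) _ t dx Hx x0).
  + exact: is_derive_continuous (derX m Hx).
  + by rewrite x0 expr0n -leqn0 leqNgt m0.
  + by move=> s; rewrite !normrX normr_id exprS.
Qed.

(** The third alternative serves [q = 1]: on the line [x = y = 0] the function [|x|] may fail to be
    differentiable, but [|x| * y] is. Such times can have positive measure, as for the equilibrium
    at the origin, so uniqueness cannot discard them. *)
Lemma der_abs_powM (m : nat) (x y : R -> R) (t dx dy : R) :
  [\/ (0 < m)%N, x t != 0 | y t = 0] ->
  is_derive t 1 x dx -> is_derive t 1 y dy ->
  is_derive t 1 (fun s => `|x s| ^+ m.+1 * y s)
    (`|x t| ^+ m.+1 * dy + m.+1%:R * (`|x t| ^+ m.+1 / x t * y t) * dx).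
Proof.
move=> mxy Hx Hy.
have [xt|xt] := eqVneq (x t) 0; last first.
  apply: (is_derive_eq (derM (der_abs_pow (or_intror xt) Hx) Hy)); ring.
case: mxy => [m0|/negP[]|yt]; [|exact/eqP|].
  apply: (is_derive_eq (derM (der_abs_pow (or_introl m0) Hx) Hy)); ring.
rewrite xt normr0 expr0n /= !mul0r mulr0 mul0r addr0.
apply: (@der_zero_prod x (fun s => x s ^+ m * y s) _ t dx Hx xt).
- exact: is_derive_continuous (derM (derX m Hx) Hy).
- by rewrite yt mulr0.
- by move=> s; rewrite !normrM !normrX normr_id exprS mulrA.
Qed.

Definition toZ (m : nat) (p : V) : V :=
  (p.1, p.2 + (m.+1%:R + 1) / m.+1%:R * (`|p.1.1| ^+ m.+1 * p.1.2)).

Definition ofZ (m : nat) (p : V) : V :=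
  (p.1, p.2 - (m.+1%:R + 1) / m.+1%:R * (`|p.1.1| ^+ m.+1 * p.1.2)).

Lemma toZK m : cancel (toZ m) (ofZ m).
Proof. by move=> [p z]; rewrite /toZ /ofZ /= addrK. Qed.

Lemma ofZK m : cancel (ofZ m) (toZ m).
Proof. by move=> [p z]; rewrite /toZ /ofZ /= subrK. Qed.

Lemma is_derive_tripleP (f : R -> V) (t : R) (v : V) :
  is_derive t 1 f v <-> [/\ is_derive t 1 (fun s => (f s).1.1) v.1.1,
    is_derive t 1 (fun s => (f s).1.2) v.1.2 & is_derive t 1 (fun s => (f s).2) v.2].
Proof.
split; first by move=> /is_derive_pairP[/is_derive_pairP[? ?] ?].
move=> [H1 H2 H3]; apply/is_derive_pairP; split => //.
by apply/(is_derive_pairP (fun s => (f s).1) t v.1); split.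
Qed.

(** The derivative of the correction term contributes [(q + 1) * |x|^q / x * y^2], exactly the last
    term of the field for [k = q + 1]. *)
Lemma is_derive_ofZ m (G : R -> V) (t : R) : [\/ (0 < m)%N, (G t).1.1 != 0 | (G t).1.2 = 0] ->
  is_derive t 1 G (lfield m (G t)) ->
  is_derive t 1 (fun s => ofZ m (G s)) (chazy m.+1 (m.+1%:R + 1) (ofZ m (G t))).
Proof.
move=> c /is_derive_tripleP [H1 H2 H3]; apply/is_derive_tripleP.
have N0 : m.+1%:R != 0 :> R by rewrite pnatr_eq0.
have Hd := der_abs_powM c H1 H2; move: Hd H1 H2 H3; rewrite /lfield /=.
case: (G t) => [[x y] z] /= Hd H1 H2 H3.
split; first exact: H1.
  by apply: (is_derive_eq H2); rewrite -!mulrA.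
apply: (is_derive_eq (derB H3 (derM (der_cst ((m.+1%:R + 1) / m.+1%:R) t) Hd))).
move: (m.+1%:R) N0 (`|x| ^+ m.+1) (x^-1) => N N0 a i; field; exact: N0.
Qed.

Lemma is_derive_toZ m (g : R -> V) (t : R) : [\/ (0 < m)%N, (g t).1.1 != 0 | (g t).1.2 = 0] ->
  is_derive t 1 g (chazy m.+1 (m.+1%:R + 1) (g t)) ->
  is_derive t 1 (fun s => toZ m (g s)) (lfield m (toZ m (g t))).
Proof.
move=> c /is_derive_tripleP[H1 H2 H3]; apply/is_derive_tripleP.
have N0 : m.+1%:R != 0 :> R by rewrite pnatr_eq0.
have Hd := der_abs_powM c H1 H2; move: Hd H1 H2 H3; rewrite /lfield /chazy /=.
case: (g t) => [[x y] z] /= Hd H1 H2 H3.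
split; first exact: H1.
  by apply: (is_derive_eq H2); rewrite -!mulrA addrK.
apply: (is_derive_eq (derD H3 (derM (der_cst ((m.+1%:R + 1) / m.+1%:R) t) Hd))).
move: (m.+1%:R) N0 (`|x| ^+ m.+1) (x^-1) => N N0 a i; field; exact: N0.
Qed.

Lemma chazyE (q : nat) (k : R) (p : V) : chazy q k p =
  (p.1.2, p.2, - `|p.1.1| ^+ q * p.2 - k * `|p.1.1| ^+ q / p.1.1 * p.1.2 ^+ 2).
Proof. by case: p => [[]]. Qed.

Lemma abs_sgn_le (x : R) : `| `|x| ^+ 1 / x | <= 1.
Proof.
have [->|x0] := eqVneq x 0; first by rewrite invr0 mulr0 normr0.
by rewrite expr1 normrM normr_id normfV divff// normr_eq0.
Qed.

(** For [q = 1] the jump enters only through the sign of [x] times [y^2], so a vanishing [y] removes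
    it. *)
Lemma chazy1_continuous (k : R) (p : V) : 0 <= k -> p.1.1 != 0 \/ p.1.2 = 0 ->
  forall e : R, 0 < e -> exists2 d : R, 0 < d & forall p', `|p' - p| < d ->
    `|chazy 1 k p' - chazy 1 k p| <= e.
Proof.
move=> k0 c e e0.
pose B := `|p| + 1; have B0 : 0 <= B by rewrite addr_ge0.
have [L1 L2 L3] := @box_lip_coord R B B0.
have [C1 C10 H1] := box_lipM L1 L3.
have [C2 C20 H2] := box_lipX 2 L2.
pose C := 1 + C1 + k * C2; have C0 : 0 < C by rewrite !ltr_wpDr// mulr_ge0.
have [d1 d10 Hx] : exists2 d1, 0 < d1 & forall p' : V, `|p' - p| < d1 ->
    p.1.2 = 0 \/ `|p'.1.1| ^+ 1 / p'.1.1 = `|p.1.1| ^+ 1 / p.1.1.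
  case: c => [x0|y0]; last by exists 1 => // *; left.
  exists `|p.1.1|; first by rewrite normr_gt0.
  move=> p' pp'; right; have [h _ _] := norm3_ge (p' - p).
  have := le_lt_trans h pp' => /=; rewrite !expr1.
  have [xn|xp|xe] := ltgtP p.1.1 0; last by rewrite xe eqxx in x0.
    rewrite ltr_norml => /andP[h1 h2].
    have xn' : p'.1.1 < 0 by move: h1 h2; rewrite ltr0_norm//; lra.
    by rewrite !ltr0_norm// !mulNr !divff// lt_eqF.
  rewrite ltr_norml => /andP[h1 h2].
  have xn' : 0 < p'.1.1 by move: h1 h2; rewrite gtr0_norm//; lra.
  by rewrite !gtr0_norm// !divff// gt_eqF.
exists (Num.min (Num.min 1 d1) (e / C)).
  by rewrite !lt_min ltr01 d10 divr_gt0.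
move=> p'; rewrite !lt_min => /andP[/andP[pp1 /Hx sg] ppe].
have pB : `|p| <= B by rewrite lerDl.
have p'B : `|p'| <= B.
  rewrite -(subrK p p') (le_trans (ler_normD _ _))// addrC /B; apply: lerD => //.
  exact: ltW.
have [_ {}H1] := H1 p' p p'B pB; have [_ {}H2] := H2 p' p p'B pB.
have eC : C * `|p' - p| <= e.
  by rewrite mulrC -ler_pdivlMr// ltW.
have [h1 h2 h3] := norm3_ge (p' - p).
have D0 : 0 <= `|p' - p| by [].
have CD : `|p' - p| <= C * `|p' - p|.
  apply: ler_peMl => //; rewrite /C -addrA lerDl addr_ge0// mulr_ge0//.
rewrite !chazyE norm3_le /=; apply/and3P; split.
- by apply: (le_trans h2); lra.
- by apply: (le_trans h3); lra.
have -> : - `|p'.1.1| ^+ 1 * p'.2 - k * `|p'.1.1| ^+ 1 / p'.1.1 * p'.1.2 ^+ 2 -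
    (- `|p.1.1| ^+ 1 * p.2 - k * `|p.1.1| ^+ 1 / p.1.1 * p.1.2 ^+ 2) =
   - (`|p'.1.1| * p'.2 - `|p.1.1| * p.2) - k * (`|p'.1.1| ^+ 1 / p'.1.1 * (p'.1.2 ^+ 2 - p.1.2 ^+ 2)
     + (`|p'.1.1| ^+ 1 / p'.1.1 - `|p.1.1| ^+ 1 / p.1.1) * p.1.2 ^+ 2).
  by rewrite !expr1; move: (p'.1.1^-1) (p.1.1^-1) => i' i; ring.
have -> : (`|p'.1.1| ^+ 1 / p'.1.1 - `|p.1.1| ^+ 1 / p.1.1) * p.1.2 ^+ 2 = 0.
  by case: sg => ->; rewrite ?subrr ?mul0r// expr0n mulr0.
rewrite addr0; apply: le_trans (ler_normB _ _) _; rewrite normrN.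
have : `|k * (`|p'.1.1| ^+ 1 / p'.1.1 * (p'.1.2 ^+ 2 - p.1.2 ^+ 2))| <= k * C2 * `|p' - p|.
  rewrite normrM (ger0_norm k0) -(mulrA k C2); apply: ler_wpM2l => //.
  rewrite normrM; apply: le_trans H2; rewrite ler_piMl//.
  exact: abs_sgn_le.
move: eC H1; rewrite /C; lra.
Qed.

Lemma filippov_continuity (f : V -> V) (p : V) :
  (forall e : R, 0 < e -> exists2 d : R, 0 < d & forall p', `|p' - p| < d ->
    `|f p' - f p| <= e) ->
  filippov f p = [set f p].
Proof.
move=> fc; apply/seteqP; split.
  move=> v Fv; rewrite /=; apply/eqP; rewrite -subr_eq0 -normr_le0.
  apply/ler_addgt0Pr => e e0; rewrite add0r; have [d d0 Hd] := fc e e0.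
  have [h1 h2] := @convex_closed_tube R V id (f p) e (fun _ _ _ _ => erefl) (fun _ _ => lexx _).
  apply: (filippov_sub d0 h1 h2) Fv => _ [p' pp' <-] /=.
  by apply: Hd; move: pp'; rewrite -ball_normE /= distrC.
(* Conversely, [f p] is a limit of values taken in small balls off [N], because no ball is
   negligible, and [B] is closed. *)
move=> _ -> d d0 N NN B [[cB clB] fB].
apply: clB => O /nbhs_ballP[r /= r0 rO].
have r2 : 0 < r / 2 by rewrite divr_gt0.
have [d' d'0 Hd'] := fc _ r2.
have dd0 : 0 < Num.min d d' by rewrite lt_min d0.
have [p' pp' Np'] := lebesgue3_ball_not_negligible p dd0 NN.
move: pp'; rewrite -ball_normE /= lt_min => /andP[pd pd'].
exists (f p'); split.
  by apply: fB; exists p' => //; split => //; rewrite -ball_normE.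
apply: rO; rewrite -ball_normE /= distrC; apply: le_lt_trans (Hd' p' _) _.
  by rewrite distrC.
by rewrite gtr_pMr// invf_lt1// ltr1n.
Qed.

(** The first component of the field is continuous, so convexification keeps [x' = y]. Hence every
    Filippov trajectory crosses [x = 0] transversally where [y <> 0]. *)
Lemma filippov1_first (k : R) (p v : V) : filippov (chazy 1 k) p v -> v.1.1 = p.1.2.
Proof.
move=> Fv; apply/eqP; rewrite -subr_eq0 -normr_le0.
apply/ler_addgt0Pr => e e0; rewrite add0r.
have [h1 h2] := @convex_closed_tube R R (fun v => v.1.1) p.1.2 e (fun _ _ _ _ => erefl)
  (fun u v => let: And3 h _ _ := norm3_ge (u - v) in h).
apply: (filippov_sub e0 h1 h2) Fv => _ [[[x y] z] pp' <-] /=.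
move: pp'; rewrite -ball_normE /= distrC => /ltW; apply: le_trans.
by have [] := norm3_ge ((x, y, z) - p).
Qed.

(** With [abs_continuous_mean_value] this makes Filippov trajectories locally Lipschitz, so their
    images under [toZ] are again absolutely continuous. *)
Lemma filippov1_bounded (k B : R) : 0 <= k -> 0 <= B -> exists2 M : R, 0 <= M &
  forall p v, `|p| <= B -> filippov (chazy 1 k) p v -> `|v| <= M.
Proof.
move=> k0 B0; pose D := B + 1; have D0 : 0 <= D by rewrite addr_ge0.
exists (D + D * D + k * D ^+ 2).
  by rewrite !addr_ge0 ?mulr_ge0 ?sqr_ge0.
move=> p v pB Fv.
have [h1 h2] := @convex_closed_tube R V id 0 (D + D * D + k * D ^+ 2)
  (fun _ _ _ _ => erefl) (fun _ _ => lexx _).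
suff : [set v : V | `|v - 0| <= D + D * D + k * D ^+ 2] v by rewrite /= subr0.
apply: (filippov_sub ltr01 h1 h2) Fv => _ [p' pp' <-] /=; rewrite subr0.
have p'D : `|p'| <= D.
  move: pp'; rewrite -ball_normE /= => /ltW pp'.
  rewrite -(subrK p p') (le_trans (ler_normD _ _))// addrC; apply: lerD => //.
  by rewrite distrC.
case: p' p'D {pp'} => [[x y] z]; rewrite !norm3_le /= => /and3P[xD yD zD].
have DD : 0 <= D * D by rewrite mulr_ge0.
have kD : 0 <= k * D ^+ 2 by rewrite mulr_ge0 ?sqr_ge0.
apply/and3P; split; [lra|lra|].
apply: le_trans (ler_normB _ _) _.
have e1 : `|- `|x| ^+ 1 * z| <= D * D.
  by rewrite expr1 mulNr normrN normrM normr_id; exact: ler_pM.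
have e2 : `|k * `|x| ^+ 1 / x * y ^+ 2| <= k * D ^+ 2.
  rewrite -mulrA -mulrA normrM (ger0_norm k0); apply: ler_wpM2l => //.
  rewrite mulrA normrM -[leRHS]mul1r; apply: ler_pM => //; first exact: abs_sgn_le.
  by rewrite normrX ler_pXn2r ?nnegrE.
lra.
Qed.

End bridge.

(** * Existence and uniqueness of trajectories of the Chazy system *)

Section trajectories.
Context {R : realType}.
Notation V := (phase_space R).

Lemma lipschitz_abs_continuous (g : R -> V) (a b C : R) : 0 <= C ->
  (forall s t, a <= s -> s <= t -> t <= b -> `|g t - g s| <= C * (t - s)) ->
  abs_continuous a b g.
Proof.
move=> C0 H e e0; have C1 : 0 < C + 1 by rewrite ltr_wpDl.
exists (e / (C + 1)); first by rewrite divr_gt0.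
move=> n u v Huv _; rewrite ltr_pdivlMr// => Hs.
apply: le_lt_trans Hs; rewrite mulr_suml; apply: ler_sum => i _.
have [au [uv vb]] := Huv i; apply: (le_trans (H _ _ au uv vb)).
by rewrite mulrC; apply: ler_wpM2l; rewrite ?subr_ge0 ?lerDl.
Qed.

Lemma abs_continuous_continuous (g : R -> V) (a b t : R) : a < t < b ->
  abs_continuous a b g -> {for t, continuous g}.
Proof.
move=> /andP[at_ tb] H; apply/for_continuousP => e e0; have [d d0 Hd] := H e e0.
have K u v : a <= u -> u <= v -> v <= b -> v - u < d -> `|g v - g u| < e.
  move=> au uv vb uvd.
  have := Hd 1%N (fun=> u) (fun=> v); rewrite !big_ord1; apply => //.
  by apply/trivIsetP => i j _ _; rewrite !ord1 eqxx.
exists (Num.min d (Num.min (t - a) (b - t))); first by rewrite !lt_min d0 !subr_gt0 at_.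
move=> s; rewrite !lt_min => /andP[sd /andP[sa sb]].
have [st|/ltW ts] := leP s t.
  rewrite distrC; rewrite distrC ger0_norm ?subr_ge0// in sd sa sb.
  by apply: K => //; [lra|exact: ltW].
rewrite ger0_norm ?subr_ge0// in sd sa sb.
by apply: K => //; [exact: ltW|lra].
Qed.

Lemma box_lip_triple (B : R) (h : V -> V) : box_lip B (fun p => (h p).1.1) ->
  box_lip B (fun p => (h p).1.2) -> box_lip B (fun p => (h p).2) ->
  exists2 C : R, 0 <= C & forall p p', `|p| <= B -> `|p'| <= B ->
    `|h p - h p'| <= C * `|p - p'|.
Proof.
move=> [C1 C10 H1] [C2 C20 H2] [C3 C30 H3]; exists (C1 + C2 + C3).
  by rewrite !addr_ge0.
move=> p p' pB p'B; have d0 : 0 <= `|p - p'| by [].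
have [_ h1] := H1 p p' pB p'B; have [_ h2] := H2 p p' pB p'B; have [_ h3] := H3 p p' pB p'B.
rewrite norm3_le; apply/and3P; split => /=.
- by apply: (le_trans h1); apply: ler_wpM2r => //; lra.
- by apply: (le_trans h2); apply: ler_wpM2r => //; lra.
- by apply: (le_trans h3); apply: ler_wpM2r => //; lra.
Qed.

Lemma box_lip_x (B : R) : 0 <= B -> box_lip B (fun p => p.1.1).
Proof.
move=> B0; exists (B + 1); first by rewrite addr_ge0.
move=> p p' pB p'B; have [h _ _] := norm3_ge p; have [h' _ _] := norm3_ge (p - p').
split; first by rewrite (le_trans h)// (le_trans pB)// lerDl.
by apply: (le_trans h'); apply: ler_peMl; rewrite ?lerDr.
Qed.

Lemma box_lipD B (f g : V -> R) : box_lip B f -> box_lip B g -> box_lip B (fun p => f p + g p).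
Proof.
move=> Hf Hg; have [C C0 H] := box_lipB Hf (box_lipM (box_lip_cst B (-1)) Hg).
by exists C => // p p' pB p'B; have := H p p' pB p'B; rewrite !mulN1r !opprK.
Qed.

Lemma toZ_lip m (B : R) : 0 <= B -> exists2 C : R, 0 <= C &
  forall p p', `|p| <= B -> `|p'| <= B -> `|toZ m p - toZ m p'| <= C * `|p - p'|.
Proof.
move=> B0; have [L1 L2 L3] := @box_lip_coord R B B0.
apply: box_lip_triple => //; first exact: box_lip_x.
apply: box_lipD => //; apply: box_lipM (box_lip_cst _ _) _.
exact: box_lipM (box_lipX _ L1) L2.
Qed.

Lemma ofZ_lip m (B : R) : 0 <= B -> exists2 C : R, 0 <= C &
  forall p p', `|p| <= B -> `|p'| <= B -> `|ofZ m p - ofZ m p'| <= C * `|p - p'|.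
Proof.
move=> B0; have [L1 L2 L3] := @box_lip_coord R B B0.
apply: box_lip_triple => //; first exact: box_lip_x.
apply: box_lipB => //; apply: box_lipM (box_lip_cst _ _) _.
exact: box_lipM (box_lipX _ L1) L2.
Qed.

Section solution.
Variables (m : nat) (G : R -> V).
Hypothesis dG : forall t : R, is_derive t 1 G (lfield m (G t)).

Lemma solution_bounded (a b : R) : a <= b -> exists2 B, 0 <= B &
  forall t, a <= t <= b -> `|G t| <= B.
Proof.
move=> ab; have [B HB] := continuous_bounded ab (fun t _ => is_derive_continuous (dG t)).
exists B => //; apply: le_trans (HB a _); first by [].
by rewrite lexx.
Qed.

Lemma solution_lipschitz (a b : R) : a <= b -> exists2 M, 0 <= M &
  forall s t, a <= s -> s <= t -> t <= b -> `|G t - G s| <= M * (t - s).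
Proof.
move=> ab; have [B B0 HB] := solution_bounded ab.
have [L L0 FL] := @lfield_lip R m B B0.
pose M := L * B + `|lfield m (0 : V)|.
have M0 : 0 <= M by rewrite addr_ge0// mulr_ge0// ltW.
exists M => // s t as_ st tb.
have dlin (w : R) : is_derive w 1 (fun w => M * w) M.
  by apply: (is_derive_eq (derM (der_cst M w) (der_id w))); rewrite mulr1 mulr0 addr0.
rewrite mulrBr.
apply: (mean_value_ineq st (fun w _ => dG w) (fun w _ => dlin w)) => w /andP[sw wt].
have wB : `|G w| <= B by apply: HB; rewrite (le_trans as_ sw) (le_trans wt).
have := FL (G w) 0 wB; rewrite normr0 subr0 => /(_ B0) h.
rewrite -(subrK (lfield m 0) (lfield m (G w))); apply: (le_trans (ler_normD _ _)).
by rewrite lerD2r; apply: (le_trans h); apply: ler_wpM2l => //; exact: ltW.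
Qed.

(** For [q = 1] transversality makes the times with [x = 0] negligible; at the other times the field
    is continuous and its Filippov set is a single vector. *)
Lemma chazy_trajectory_of_solution : (forall t, (G t).1.1 = 0 -> (G t).1.2 != 0) ->
  chazy_trajectory m.+1 (m.+1%:R + 1) setT (fun t => ofZ m (G t)).
Proof.
rewrite /chazy_trajectory eqSS => Gtr; have [m0|m0] := eqVneq m 0%N; last first.
  by move=> t _; apply: is_derive_ofZ => //; apply: Or31; rewrite lt0n.
split.
  move=> a b _; have [ab|ba] := leP a b; last first.
    have C00 : 0 <= (0 : R) by [].
    by apply: (lipschitz_abs_continuous C00) => s t as_ st tb; lra.
  have [B B0 HB] := solution_bounded ab; have [C C0 HC] := @ofZ_lip m B B0.
  have [M M0 HM] := solution_lipschitz ab.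
  apply: (@lipschitz_abs_continuous _ _ _ (C * M)); first exact: mulr_ge0.
  move=> s t as_ st tb.
  have sB : `|G s| <= B by apply: HB; rewrite as_ (le_trans st).
  have tB : `|G t| <= B by apply: HB; rewrite tb (le_trans as_).
  by apply: (le_trans (HC _ _ tB sB)); rewrite -mulrA; apply: ler_wpM2l => //; exact: HM.
apply: negligibleS (transversal_zeros_negligible (fun t => (G t).1.1)) => t /= H.
apply: contrapT => nz; apply: H => _.
have x0 : (G t).1.1 != 0.
  apply/eqP => x0; apply: nz; split => //; exists (G t).1.2; first exact: Gtr.
  by have /is_derive_tripleP[] := dG t.
exists (chazy m.+1 (m.+1%:R + 1) (ofZ m (G t))); last first.
  by apply: is_derive_ofZ => //; apply: Or32.
rewrite m0 filippov_continuity//.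
by apply: chazy1_continuous; [rewrite addr_ge0|left].
Qed.

(** The mean value inequality is an assumption because it has two sources: [mean_value_ineq] for
    classical trajectories and [abs_continuous_mean_value] for Filippov ones. The backward
    implication is Gronwall in reversed time. *)
Lemma mean_value_unique (g : R -> V) (a b : R) : a <= b ->
  (exists2 B, 0 <= B & forall t, a <= t <= b -> `|g t| <= B) ->
  (forall s t M, a <= s -> s <= t -> t <= b -> 0 <= M ->
     (forall r, s <= r <= t -> `|lfield m (g r) - lfield m (G r)| <= M) ->
     `|(g t - G t) - (g s - G s)| <= M * (t - s)) ->
  g a = G a <-> g b = G b.
Proof.
move=> ab [B1 B10 H1] MV; have [B2 B20 H2] := solution_bounded ab.
pose B := B1 + B2; have B0 : 0 <= B by rewrite addr_ge0.
have [L L0 FL] := @lfield_lip R m B B0.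
have HB t : a <= t <= b -> `|g t| <= B /\ `|G t| <= B.
  by move=> tt; split; [apply: (le_trans (H1 t tt))|apply: (le_trans (H2 t tt))];
    rewrite /B ?lerDl ?lerDr.
have DB t : a <= t <= b -> `|g t - G t| <= B + B.
  by move=> /HB[h1 h2]; apply: (le_trans (ler_normB _ _)); exact: lerD.
have step s t M : a <= s -> s <= t -> t <= b -> (forall r, s <= r <= t -> `|g r - G r| <= M) ->
    `|(g t - G t) - (g s - G s)| <= L * M * (t - s).
  move=> as_ st tb HM; apply: MV => //.
    apply: mulr_ge0; first exact: ltW.
    by apply: le_trans (HM s _); rewrite ?lexx.
  move=> r /[dup] /andP[sr rt] /HM hr.
  have [h1 h2] : `|g r| <= B /\ `|G r| <= B.
    by apply: HB; rewrite (le_trans as_ sr) (le_trans rt).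
  by apply: (le_trans (FL _ _ h1 h2)); apply: ler_wpM2l => //; exact: ltW.
have [n Hn] := exists_nat_half (L * (b - a)).
split=> E.
  have := @gronwall R V (fun t => g t - G t) L n a b (ltW L0) ab Hn _ step b.
  rewrite E subrr normr0 mulr0 ab lexx normr_le0 subr_eq0 => H; apply/eqP; apply: H => //.
  by exists (B + B).
have ba : - b <= - a by rewrite lerN2.
have Hn' : L * (- a - - b) <= n%:R / 2 by rewrite opprK addrC.
have := @gronwall R V (fun t => g (- t) - G (- t)) L n (- b) (- a) (ltW L0) ba Hn' _ _ (- a).
rewrite !opprK E subrr normr0 mulr0 ba lexx normr_le0 subr_eq0 => H; apply/eqP; apply: H => //.
  by exists (B + B) => t /andP[h1 h2]; apply: DB; apply/andP; split; lra.
move=> s t M bs st ta HM.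
rewrite distrC (_ : t - s = - s - - t); last by rewrite opprK addrC.
apply: step; try lra.
move=> r /andP[tr rs]; rewrite -(opprK r); apply: HM; apply/andP; split; lra.
Qed.

(** The comparison is made on [toZ m (g t)], whose field is locally Lipschitz. For [q = 1] its
    equation holds off two null sets: the times where the Filippov inclusion fails, and the
    transversal crossings. *)
Theorem chazy_unique (I : set R) (g : R -> V) : open I -> is_interval I ->
  chazy_trajectory m.+1 (m.+1%:R + 1) I g ->
  forall t0, I t0 -> toZ m (g t0) = G t0 -> forall t, I t -> g t = ofZ m (G t).
Proof.
move=> oI iI tg.
suff H a b : I a -> I b -> a <= b -> (toZ m (g a) = G a <-> toZ m (g b) = G b).
  move=> t0 It0 E t It; rewrite -[LHS](toZK m); congr ofZ.
  have [le|/ltW le] := leP t0 t; first by apply: (H _ _ It0 It le).1.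
  exact: (H _ _ It It0 le).2.
move=> Ia Ib ab.
have Iab t : a <= t <= b -> I t by move=> tt; exact: iI tt.
have bdd : (forall t, a <= t <= b -> {for t, continuous g}) -> exists2 B, 0 <= B &
    forall t, a <= t <= b -> `|g t| <= B.
  move=> cg; have [B HB] := continuous_bounded ab cg.
  by exists B => //; apply: le_trans (HB a _); rewrite ?lexx.
have bddZ : (exists2 B, 0 <= B & forall t, a <= t <= b -> `|g t| <= B) ->
    exists2 B, 0 <= B & forall t, a <= t <= b -> `|toZ m (g t)| <= B.
  move=> [B B0 HB]; have [C C0 HC] := toZ_lip m B0.
  exists (C * B + `|toZ m (0 : V)|); first by rewrite addr_ge0// mulr_ge0.
  move=> t /HB tB; rewrite -(subrK (toZ m 0) (toZ m (g t))).
  apply: (le_trans (ler_normD _ _)); rewrite lerD2r.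
  have := HC (g t) 0 tB; rewrite normr0 subr0 => /(_ B0) h.
  by apply: (le_trans h); exact: ler_wpM2l.
move: tg; rewrite /chazy_trajectory eqSS; have [m0|m0] := eqVneq m 0%N; last first.
  move=> tg.
  have dZ t : a <= t <= b -> is_derive t 1 (fun t => toZ m (g t)) (lfield m (toZ m (g t))).
    move=> tt; apply: is_derive_toZ; first by apply: Or31; rewrite lt0n.
    exact: tg (Iab t tt).
  apply: (@mean_value_unique (fun t => toZ m (g t)) a b ab).
    by apply: bddZ; apply: bdd => t tt; exact: is_derive_continuous (tg t (Iab t tt)).
  move=> s t M as_ st tb M0 HM.
  have dlin (w : R) : is_derive w 1 (fun w => M * w) M.
    by apply: (is_derive_eq (derM (der_cst M w) (der_id w))); rewrite mulr1 mulr0 addr0.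
  have dD r : s <= r <= t -> is_derive r 1 (fun r => toZ m (g r) - G r)
      (lfield m (toZ m (g r)) - lfield m (G r)).
    move=> /andP[sr rt]; apply: (is_deriveB (dZ r _) (dG r)).
    by rewrite (le_trans as_ sr) (le_trans rt).
  rewrite mulrBr.
  exact: (mean_value_ineq st dD (fun w _ => dlin w)).
move=> [gAC gae].
have AC s t : a <= s -> t <= b -> abs_continuous s t g.
  move=> as_ tb; apply: gAC => r; rewrite /= in_itv /= => /andP[sr rt].
  by apply: Iab; rewrite (le_trans as_ sr) (le_trans rt).
have gc t : a <= t <= b -> {for t, continuous g}.
  move=> /Iab It; have /nbhs_ballP[r /= r0 rI] : nbhs t I by apply: open_nbhs_nbhs.
  apply: (@abs_continuous_continuous g (t - r / 2) (t + r / 2)).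
    by apply/andP; split; lra.
  apply: gAC => u; rewrite /= in_itv /= => /andP[h1 h2]; apply: rI.
  by rewrite /ball /= ltr_norml; lra.
have [B B0 HB] := bdd gc.
have k0 : 0 <= m.+1%:R + 1 :> R by rewrite addr_ge0.
have [K K0 HK] := filippov1_bounded k0 B0.
have glip s t : a <= s -> s <= t -> t <= b -> `|g t - g s| <= K * (t - s).
  move=> as_ st tb; apply: abs_continuous_mean_value => //; first exact: AC.
  apply: negligibleS gae => r /= H1 H2; apply: H1 => /andP[sr rt].
  have ab_r : a <= r <= b by rewrite (le_trans as_ sr) (le_trans rt).
  have [v Fv dv] := H2 (Iab r ab_r); exists v => //.
  by apply: HK (HB r ab_r) _; rewrite m0 in Fv *.
apply: (@mean_value_unique (fun t => toZ m (g t)) a b ab).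
  by apply: bddZ; exists B.
move=> s t M as_ st tb M0 HM.
have [C C0 HC] := toZ_lip m B0.
have [D D0 HD] := solution_lipschitz ab.
apply: (@abs_continuous_mean_value R (fun r => toZ m (g r) - G r)) => //.
  apply: (@lipschitz_abs_continuous _ _ _ (C * K + D)).
    by rewrite addr_ge0// mulr_ge0.
  move=> u v su uv vt.
  have au : a <= u by exact: le_trans su.
  have vb : v <= b by exact: le_trans tb.
  have -> : toZ m (g v) - G v - (toZ m (g u) - G u) = (toZ m (g v) - toZ m (g u)) - (G v - G u).
    by rewrite !opprB addrACA [RHS]addrACA; congr (_ + _); rewrite addrC.
  apply: (le_trans (ler_normB _ _)); rewrite mulrDl; apply: lerD; last exact: HD.
  have uB : `|g u| <= B by apply: HB; rewrite au (le_trans uv).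
  have vB : `|g v| <= B by apply: HB; rewrite vb (le_trans au).
  by apply: (le_trans (HC _ _ vB uB)); rewrite -mulrA; apply: ler_wpM2l => //; exact: glip.
apply: negligibleS (negligibleU gae (transversal_zeros_negligible (fun t => (g t).1.1))).
move=> r /= H; apply: contrapT => /not_orP[/contrapT H1 H2]; apply: H => srt.
have ab_r : a <= r <= b.
  by case/andP: srt => sr rt; rewrite (le_trans as_ sr) (le_trans rt).
have [v Fv dv] := H1 (Iab r ab_r).
(* If [x = 0] and [y <> 0], then [filippov1_first] puts [r] among the discarded crossings; otherwise
   the velocity is the value of the field. *)
have [x0|x0] := pselect ((g r).1.1 != 0 \/ (g r).1.2 = 0); last first.
  exfalso; apply: H2; move/not_orP: x0 => [/negP/negPn/eqP x0 y0]; split => //.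
  exists v.1.1; last by have /is_derive_tripleP[] := dv.
  by rewrite m0 in Fv; rewrite (filippov1_first Fv); apply/eqP.
have vE : v = chazy m.+1 (m.+1%:R + 1) (g r).
  move: Fv; rewrite m0 filippov_continuity//.
  by apply: chazy1_continuous => //; rewrite addr_ge0.
rewrite vE in dv.
have c : [\/ (0 < m)%N, (g r).1.1 != 0 | (g r).1.2 = 0].
  by case: x0 => h; [apply: Or32|apply: Or33].
exists (lfield m (toZ m (g r)) - lfield m (G r)); last exact: HM.
exact: is_deriveB (is_derive_toZ c dv) (dG r).
Qed.

End solution.
End trajectories.

(** * The cylinder *)

Section continuity.
Context {R : realType} (T : topologicalType).
Implicit Types (f g : T -> R) (x : T).

Lemma for_cvg_pair (V W : normedModType R) (f : T -> V) (g : T -> W) x :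
  {for x, continuous f} -> {for x, continuous g} ->
  {for x, continuous (fun t => (f t, g t))}.
Proof.
move=> /cvgrPdist_lt H1 /cvgrPdist_lt H2; apply/cvgrPdist_lt => e e0.
apply: filterS2 (H1 e e0) (H2 e e0) => t h1 h2.
by rewrite prod_normE gt_max; apply/andP; split.
Qed.

Lemma for_cvgM f g x : {for x, continuous f} -> {for x, continuous g} ->
  {for x, continuous (fun t => f t * g t)}.
Proof. by move=> Hf Hg; exact: cvgM. Qed.

Lemma for_cvgD f g x : {for x, continuous f} -> {for x, continuous g} ->
  {for x, continuous (fun t => f t + g t)}.
Proof. by move=> Hf Hg; exact: cvgD. Qed.

Lemma for_cvgB f g x : {for x, continuous f} -> {for x, continuous g} ->
  {for x, continuous (fun t => f t - g t)}.
Proof. by move=> Hf Hg; exact: cvgB. Qed.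

Lemma for_cvg_cst (c : R) x : {for x, continuous (fun=> c : R)}.
Proof. exact: cvg_cst. Qed.

Lemma for_cvg_norm f x : {for x, continuous f} -> {for x, continuous (fun t => `|f t|)}.
Proof. by move=> Hf; exact: cvg_norm. Qed.

Lemma for_cvgX f n x : {for x, continuous f} -> {for x, continuous (fun t => f t ^+ n)}.
Proof.
move=> Hf; elim: n => [|n IH]; first exact: for_cvg_cst.
rewrite (_ : (fun t => _) = (fun t => f t * f t ^+ n)); first exact: for_cvgM.
by apply/funext => t; rewrite exprS.
Qed.

Lemma for_cvg_comp (U W : topologicalType) (f : T -> U) (h : U -> W) x :
  {for x, continuous f} -> {for f x, continuous h} -> {for x, continuous (fun t => h (f t))}.
Proof. by move=> Hf Hh; exact: (@continuous_comp _ _ _ f h x). Qed.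

End continuity.

(** A continuous map from a compact set to a Hausdorff space sends relatively closed pieces to
    closed sets, which gives continuity of the inverse; [x0] is a default value outside the
    image. *)
Lemma compact_inverse (T : topologicalType) (U : topologicalType) (K : set T) (psi : T -> U)
    (x0 : T) : hausdorff_space U -> compact K -> {within K, continuous psi} ->
  {in K &, injective psi} ->
  exists chi : U -> T, [/\ forall x, K x -> chi (psi x) = x,
    forall y, (psi @` K) y -> K (chi y) /\ psi (chi y) = y &
    {within psi @` K, continuous chi}].
Proof.
move=> hU cK cpsi ipsi.
have [chi Hchi] : {chi : U -> T & forall y, (psi @` K) y -> K (chi y) /\ psi (chi y) = y}.
  apply: (@choice _ _ (fun y x => (psi @` K) y -> K x /\ psi x = y)) => y.
  by have [[x Kx <-]|ny] := pselect ((psi @` K) y); [exists x|exists x0 => /ny].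
have chiK x : K x -> chi (psi x) = x.
  move=> Kx; have [|h1 h2] := Hchi (psi x); first by exists x.
  by apply: ipsi; rewrite ?inE.
exists chi; split => //; apply/subspace_continuousP => _ [x Kx <-] N.
rewrite /from_subspace chiK// => Nx.
have [W [oW Wx] WN] : exists2 W, open_nbhs x W & W `<=` N.
  by move: Nx; rewrite nbhsE => -[W ? ?]; exists W.
pose K' := K `&` ~` W.
have cK' : compact K' by apply: compact_closedI => //; exact: open_closedC.
have cl : closed (psi @` K').
  apply: compact_closed => //; apply: continuous_compact cK'.
  by apply: continuous_subspaceW cpsi => ? [].
have : nbhs (psi x) (~` (psi @` K')).
  apply: open_nbhs_nbhs; split; first exact: closed_openC.
  move=> [x' [Kx' nW] /ipsi E]; apply: nW; rewrite E ?inE//.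
rewrite /= /within /=; apply: filterS => y ny Ky; apply: WN.
have [h1 h2] := Hchi y Ky.
by apply: contrapT => nW; apply: ny; exists (chi y).
Qed.

(** * The scaling symmetry *)

Section cylinder.
Context {R : realType}.
Notation V := (phase_space R).

Definition scale (m : nat) (l : R) (p : V) : V :=
  (l * p.1.1, l ^+ m.+2 * p.1.2, l ^+ (m.+1 + m.+2) * p.2).

Lemma scaleM m l l' p : scale m l (scale m l' p) = scale m (l * l') p.
Proof. by rewrite /scale /= !exprMn !mulrA. Qed.

Lemma scale1 m p : scale m 1 p = p.
Proof. by case: p => [[x y] z]; rewrite /scale /= !expr1n !mul1r. Qed.

Lemma lfield_scale m l p : 0 <= l ->
  lfield m (scale m l p) = l ^+ m.+1 *: scale m l (lfield m p).
Proof.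
move=> l0; case: p => [[x y] z].
rewrite /lfield /scale /= normrM (ger0_norm l0) exprMn [l ^+ (m.+1 + m.+2)]exprD.
rewrite -[_ *: _]/(l ^+ m.+1 * (l * y), l ^+ m.+1 * _, l ^+ m.+1 * _).
rewrite [l ^+ m.+2]exprS.
by congr (_, _, _) => /=; ring.
Qed.

Lemma energy_scale m l p : 0 <= l ->
  energy m (scale m l p) = l ^+ (m.+2 + m.+2) * energy m p.
Proof.
move=> l0; case: p => [[x y] z].
rewrite /energy /scale /= normrM (ger0_norm l0) exprMn.
rewrite [l ^+ (m.+1 + m.+2)]exprD [l ^+ (m.+2 + m.+2)]exprD.
rewrite [l ^+ m.+2]exprS.
by ring.
Qed.

Lemma scale_solution m (g : R -> V) (l a : R) : 0 <= l ->
  (forall t : R, is_derive t 1 g (lfield m (g t))) ->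
  forall t : R, is_derive t 1 (fun t => scale m l (g (l ^+ m.+1 * t + a)))
    (lfield m (scale m l (g (l ^+ m.+1 * t + a)))).
Proof.
move=> l0 dg t; rewrite lfield_scale//.
have := is_derive_scale (is_derive_shift (dg (l ^+ m.+1 * t + a))).
move=> /is_derive_tripleP[H1 H2 H3]; apply/is_derive_tripleP; split.
- by apply: (is_derive_eq (derM (der_cst l t) H1)); rewrite /scale /= mulr0 addr0 mulrCA.
- by apply: (is_derive_eq (derM (der_cst (l ^+ m.+2) t) H2)); rewrite /scale /= mulr0 addr0 mulrCA.
- by apply: (is_derive_eq (derM (der_cst (l ^+ (m.+1 + m.+2)) t) H3));
    rewrite /scale /= mulr0 addr0 mulrCA.
Qed.

End cylinder.

(** * Construction of the foliated cylinder *)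

Section foliation.
Context {R : realType}.
Notation V := (phase_space R).

Lemma toZ_continuous m (p : V) : {for p, continuous (@toZ R m)}.
Proof.
have cid : {for p, continuous (fun q : V => q)} by exact: cvg_id.
have [c1 c3] := continuous_pair cid; have [cx cy] := continuous_pair c1.
apply: for_cvg_pair => //; apply: for_cvgD => //.
apply: for_cvgM; first exact: for_cvg_cst.
by apply: for_cvgM => //; apply: for_cvgX; exact: for_cvg_norm.
Qed.

Lemma ofZ_continuous m (p : V) : {for p, continuous (@ofZ R m)}.
Proof.
have cid : {for p, continuous (fun q : V => q)} by exact: cvg_id.
have [c1 c3] := continuous_pair cid; have [cx cy] := continuous_pair c1.
apply: for_cvg_pair => //; apply: for_cvgB => //.
apply: for_cvgM; first exact: for_cvg_cst.
by apply: for_cvgM => //; apply: for_cvgX; exact: for_cvg_norm.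
Qed.

Lemma energy_continuous m (p : V) : {for p, continuous (@energy R m)}.
Proof.
have cid : {for p, continuous (fun q : V => q)} by exact: cvg_id.
have [c1 c3] := continuous_pair cid; have [cx cy] := continuous_pair c1.
apply: for_cvgB; last by apply: for_cvgM; [exact: for_cvgX|exact: for_cvg_cst].
apply: for_cvgB; first exact: for_cvgM.
apply: for_cvgM; last exact: for_cvg_cst.
apply: for_cvgM => //; apply: for_cvgM => //.
by apply: for_cvgX; exact: for_cvg_norm.
Qed.

Lemma scale_continuous m (T : topologicalType) (l : T -> R) (f : T -> V) (t : T) :
  {for t, continuous l} -> {for t, continuous f} ->
  {for t, continuous (fun t => scale m (l t) (f t))}.
Proof.
move=> cl cf; have [c1 c3] := continuous_pair cf; have [cx cy] := continuous_pair c1.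
by apply: for_cvg_pair; [apply: for_cvg_pair|]; apply: for_cvgM => //; exact: for_cvgX.
Qed.

Lemma circle_compact : compact (@circle R).
Proof.
have c1 : closed (@circle R).
  apply: (@preimage_closed _ _ (fun u : R * R => u.1 ^+ 2 + u.2 ^+ 2) [set 1]).
    move=> u _; have cid : {for u, continuous (fun v : R * R => v)} by exact: cvg_id.
    have [cx cy] := continuous_pair cid.
    exact: (for_cvgD (for_cvgX (n := 2) cx) (for_cvgX (n := 2) cy)).
  exact: closed_eq.
apply: (subclosed_compact c1 (compact_setX (@segment_compact R (-1) 1) (@segment_compact R (-1) 1))).
move=> [x y] /= h; rewrite /circle /= in h.
rewrite !in_itv /=; split; apply/andP; split; nra.
Qed.

Section orbit.
Variables (m : nat) (g : R -> V) (L : R).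
Hypothesis L0 : 0 < L.
Hypothesis dg : forall t : R, is_derive t 1 g (lfield m (g t)).
Hypothesis gL : forall t, g (t + L) = - g t.
Hypothesis e0 : energy m (g 0) < 0.
Hypothesis gx0 : (g 0).1.1 = 0.
Hypothesis gy0 : 0 < (g 0).1.2.
Hypothesis gxpos : forall t, 0 < t < L -> 0 < (g t).1.1.
Hypothesis en : forall t, energy m (g t) = energy m (g 0).

Let g2L t : g (t + 2 * L) = g t.
Proof. by rewrite (_ : t + 2 * L = t + L + L) ?gL ?opprK//; ring. Qed.

Let transversal t : (g t).1.1 = 0 -> (g t).1.2 != 0.
Proof.
move=> xt; apply/eqP => yt; move: e0; rewrite -(en t) /energy xt yt.
by rewrite expr0n /= !mul0r !subr0 ltxx.
Qed.

Let cont_g (t : R) : {for t, continuous g} := is_derive_continuous (dg t).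

(** The first coordinate replaces the angle as parameter: the upper half circle covers the times
    from 0 to [L], the lower half those from 0 to [- L]. The jump at [(-1, 0)] is a full period
    [2 * L], and antipodal points have times differing by [L], so they go to opposite points of the
    orbit. *)
Definition orbit_time (u : R * R) : R :=
  if 0 <= u.2 then L * (1 - u.1) / 2 else - (L * (1 - u.1) / 2).

Let psi (u : R * R) : V := g (orbit_time u).

Let circle_itv (u : R * R) : @circle R u -> -1 <= u.1 <= 1.
Proof. by rewrite /circle /= => h; apply/andP; split; nra. Qed.

Let circleN (u : R * R) : @circle R u -> @circle R (- u).
Proof. by rewrite /circle /= !sqrrN. Qed.

Let psiN (u : R * R) : @circle R u -> psi (- u) = - psi u.
Proof.
move=> cu; rewrite /psi /orbit_time /= oppr_ge0.
have [u2|u2|u2] := ltgtP u.2 0.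
- rewrite -gL; congr g; lra.
- apply: oppr_inj; rewrite [- - g _]opprK -gL; congr g; lra.
- have : u.1 = 1 \/ u.1 = -1.
    have : (u.1 - 1) * (u.1 + 1) = 0 by move: cu; rewrite /circle /= u2; nra.
    by move=> /eqP; rewrite mulf_eq0 => /orP[/eqP|/eqP] h; [left|right]; lra.
  case=> ->.
    by rewrite -gL; congr g; lra.
  by apply: oppr_inj; rewrite [- - g _]opprK -gL; congr g; lra.
Qed.

Let psi_onto t : exists2 u, @circle R u & psi u = g t.
Proof.
move: t; apply: (periodic_ind L0) => [t /andP[t0 tL]|t].
  have h1 : 0 <= t / L <= 1 by rewrite divr_ge0 ?(ltW L0)//= ler_pdivrMr// mul1r.
  pose c := 1 - 2 * (t / L).
  have c1 : 0 <= 1 - c ^+ 2 by rewrite /c; case/andP: h1 => *; nra.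
  exists (c, Num.sqrt (1 - c ^+ 2)).
    by rewrite /circle /= sqr_sqrtr// addrC subrK.
  rewrite /psi /orbit_time /= sqrtr_ge0; congr g.
  by rewrite /c; field; rewrite gt_eqF.
split=> -[u cu E]; exists (- u); try exact: circleN.
  by rewrite psiN// E gL.
by rewrite psiN// E gL opprK.
Qed.

(** By uniqueness [g a = g b] gives [g 0 = g d] for [d = b - a < 2 * L]. The sign of [x] excludes
    [0 < d < L] and, by antiperiodicity, [L < d < 2 * L]; the sign of [y] excludes [d = L]. *)
Let g_inj a b : - L < a <= L -> - L < b <= L -> g a = g b -> a = b.
Proof.
wlog ab : a b / a <= b.
  move=> W aL bL E; have [ab|/ltW ba] := leP a b; first exact: W.
  by apply/esym; apply: W.
move=> /andP[a1 a2] /andP[b1 b2] E; pose d := b - a.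
have shift : g 0 = g d.
  have dg' (t : R) : is_derive t 1 (fun t => g (t + d)) (lfield m (g (t + d))).
    exact: is_derive_shift (dg (t + d)).
  have Eab : toZ m (ofZ m (g a)) = g (a + d) by rewrite ofZK E /d subrKC.
  have iT : is_interval (@setT R) by [].
  have := chazy_unique dg' openT iT (chazy_trajectory_of_solution dg transversal)
    (I : setT a) Eab (I : setT 0).
  by rewrite add0r => /(can_inj (ofZK m)).
have d0 : 0 <= d by rewrite subr_ge0.
have d2 : d < 2 * L by rewrite /d; lra.
move: d0; rewrite le_eqVlt => /predU1P[/eqP|d0].
  by rewrite eq_sym subr_eq0 => /eqP.
have [dL|Ld|dL] := ltgtP d L.
- have : 0 < (g d).1.1 by apply: gxpos; rewrite d0.
  by rewrite -shift gx0 ltxx.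
- have : 0 < (g (d - L)).1.1 by apply: gxpos; apply/andP; split; lra.
  have := gL (d - L); rewrite subrK -shift => /(congr1 (fun p => p.1.1)) /=.
  by rewrite gx0 => h; rewrite -[X in 0 < X]opprK -h oppr0 ltxx.
- have := gL 0; rewrite add0r -dL -shift => /(congr1 (fun p => p.1.2)) /=.
  by move: gy0; lra.
Qed.

Let psi_inj : {in @circle R &, injective psi}.
Proof.
move=> u v; rewrite !inE => cu cv /g_inj.
have itv w : @circle R w -> - L < orbit_time w <= L.
  move=> cw; have /andP[h1 h2] := circle_itv cw; rewrite /orbit_time.
  have p1 : 0 <= L * (1 - w.1) by rewrite mulr_ge0 ?subr_ge0// ltW.
  have p2 : 0 <= L * (1 + w.1) by rewrite mulr_ge0 ?(ltW L0)//; lra.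
  case: (leP 0 w.2) => w2.
    by apply/andP; split; move: L0; lra.
  have : w.1 != -1.
    by apply/eqP => w1; move: cw; rewrite /circle /= w1; nra.
  rewrite eq_sym => h3; have {h3} : -1 < w.1 by rewrite lt_neqAle h3.
  move=> h3; have p3 : 0 < L * (1 + w.1) by rewrite mulr_gt0//; lra.
  by apply/andP; split; move: L0; lra.
move=> /(_ (itv u cu) (itv v cv)); rewrite /orbit_time.
have /andP[u1 u2] := circle_itv cu; have /andP[v1 v2] := circle_itv cv.
have fin : u.1 = v.1 -> 0 <= u.2 * v.2 -> u = v.
  move: cu cv; case: u {u1 u2} => x y; case: v {v1 v2} => x' y'.
  rewrite /circle /= => h1 + E; rewrite -E => h2 h3; congr pair.
  have : (y - y') * (y + y') = 0 by nra.
  move=> /eqP; rewrite mulf_eq0 => /orP[|] /eqP h; first lra.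
  have yE : y' = - y by lra.
  move: h3; rewrite yE mulrN oppr_ge0 -expr2 => y2.
  have /eqP : y ^+ 2 = 0 by apply/eqP; rewrite eq_le sqr_ge0 andbT.
  by rewrite sqrf_eq0 => /eqP ->; rewrite oppr0.
have cancelL x y : L * (1 - x) / 2 = L * (1 - y) / 2 -> x = y.
  move=> h; have : L * (x - y) = 0 by lra.
  by move=> /eqP; rewrite mulf_eq0 gt_eqF//= subr_eq0 => /eqP.
have p1 : 0 <= L * (1 - u.1) by rewrite mulr_ge0 ?subr_ge0// ltW.
have p2 : 0 <= L * (1 - v.1) by rewrite mulr_ge0 ?subr_ge0// ltW.
have one x : L * (1 - x) = 0 -> x = 1.
  by move=> /eqP; rewrite mulf_eq0 gt_eqF//= subr_eq0 => /eqP.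
case: (leP 0 u.2) => hu; case: (leP 0 v.2) => hv h.
- by apply: fin; [exact: cancelL|exact: mulr_ge0].
- have : v.1 = 1 by apply: one; lra.
  by move=> E; exfalso; move: cv; rewrite /circle /= E; nra.
- have : u.1 = 1 by apply: one; lra.
  by move=> E; exfalso; move: cu; rewrite /circle /= E; nra.
- by apply: fin; [apply: cancelL; lra|nra].
Qed.

Let psi_cont (u : R * R) : @circle R u -> {for u, continuous psi}.
Proof.
move=> cu.
have cid : {for u, continuous (fun v : R * R => v)} by exact: cvg_id.
have [c1 c2] := continuous_pair cid.
have clin : {for u, continuous (fun v : R * R => L * (1 - v.1) / 2)}.
  exact: (for_cvgM (for_cvgM (@for_cvg_cst R _ L u) (for_cvgB (@for_cvg_cst R _ 1 u) c1))
    (@for_cvg_cst R _ 2^-1 u)).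
have cA : {for u, continuous (fun v : R * R => g (L * (1 - v.1) / 2))}.
  exact: (@for_cvg_comp _ _ _ (fun v : R * R => L * (1 - v.1) / 2) g u clin (@cont_g (L * (1 - u.1) / 2))).
have cB : {for u, continuous (fun v : R * R => g (- (L * (1 - v.1) / 2)))}.
  exact: (@for_cvg_comp _ _ _ (fun v : R * R => L * (1 - v.1) / 2) (fun x => g (- x)) u clin
    (is_derive_continuous (der_opp (dg (- (L * (1 - u.1) / 2)))))).
have psiE v : psi v = if 0 <= v.2 then g (L * (1 - v.1) / 2) else g (- (L * (1 - v.1) / 2)).
  by rewrite /psi /orbit_time; case: ifP.
apply/cvgrPdist_lt => e e0'.
move: cA cB => /cvgrPdist_lt /(_ e e0') HA /cvgrPdist_lt /(_ e e0') HB.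
have [u2|u2|u2] := ltgtP u.2 0.
- move: c2 => /cvgrPdist_lt /(_ (- u.2)); rewrite oppr_gt0 => /(_ u2) H2.
  apply: filterS2 HB H2 => v hB h2; rewrite !psiE.
  have v2 : v.2 < 0 by move: h2; rewrite ltr_norml => /andP[]; lra.
  by rewrite !leNgt u2 v2.
- move: c2 => /cvgrPdist_lt /(_ u.2 u2) H2.
  apply: filterS2 HA H2 => v hA h2; rewrite !psiE.
  have v2 : 0 <= v.2 by move: h2; rewrite ltr_norml => /andP[]; lra.
  by rewrite (ltW u2) v2.
(* At [(1, 0)] both formulas give time 0; at [(-1, 0)] they give [L] and [- L], one period apart. *)
- have AB : g (L * (1 - u.1) / 2) = g (- (L * (1 - u.1) / 2)).
    have : (u.1 - 1) * (u.1 + 1) = 0 by move: cu; rewrite /circle /= u2; nra.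
    move=> /eqP; rewrite mulf_eq0 => /orP[/eqP|/eqP] h.
      by congr g; nra.
    rewrite -[RHS]g2L; congr g; nra.
  apply: filterS2 HA HB => v hA hB; rewrite !psiE u2 lexx.
  by case: ifP => _ //; rewrite AB.
Qed.

Let phi (w : (R * R) * R) : V := ofZ m (scale m (expR w.2) (psi w.1)).

Let phi_cont w : @circle R w.1 -> {for w, continuous phi}.
Proof.
move=> cw; have cid : {for w, continuous (fun v : R * R * R => v)} by exact: cvg_id.
have [c1 c2] := continuous_pair cid.
apply: (for_cvg_comp (h := @ofZ R m)); last exact: ofZ_continuous.
apply: scale_continuous.
  by apply: (for_cvg_comp (h := expR) c2); exact: continuous_expR.
by apply: (for_cvg_comp (h := psi) c1); exact: psi_cont.
Qed.

(** The energy is negative on the orbit and scales by [l ^ (2 * q + 2)], so the ratio is positive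
    and its logarithm recovers the height on the cylinder. *)
Let level (p : V) : R := ln (energy m (toZ m p) / energy m (g 0)) / (m.+2 + m.+2)%:R.

Let energy_phi w : energy m (toZ m (phi w)) / energy m (g 0) = expR ((m.+2 + m.+2)%:R * w.2).
Proof.
rewrite /phi ofZK energy_scale ?expR_ge0// en mulfK ?lt_eqF//.
by rewrite -expRM_natl.
Qed.

Let levelK w : level (phi w) = w.2.
Proof.
rewrite /level energy_phi expRK mulrC mulrA mulVf ?mul1r//.
Qed.

Let level_cont w : {for phi w, continuous level}.
Proof.
have c1 : {for phi w, continuous (fun p : V => energy m (toZ m p))}.
  exact: (@for_cvg_comp _ _ _ (@toZ R m) (@energy R m) _ (@toZ_continuous m _)
    (@energy_continuous m _)).
have c2 : {for phi w, continuous (fun p : V => energy m (toZ m p) / energy m (g 0))}.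
  exact: (for_cvgM c1 (@for_cvg_cst R _ (energy m (g 0))^-1 _)).
have pos : 0 < energy m (toZ m (phi w)) / energy m (g 0).
  by rewrite energy_phi expR_gt0.
have c3 : {for phi w, continuous (fun p : V => ln (energy m (toZ m p) / energy m (g 0)))}.
  exact: (@for_cvg_comp _ _ _ _ (@ln R) _ c2 (continuous_ln pos)).
exact: (for_cvgM c3 (@for_cvg_cst R _ (m.+2 + m.+2)%:R^-1 _)).
Qed.

Let base (p : V) : V := scale m (expR (- level p)) (toZ m p).

Let base_phi w : base (phi w) = psi w.1.
Proof.
by rewrite /base levelK /phi ofZK scaleM -expRD addNr expR0 scale1.
Qed.

Let base_cont w : {for phi w, continuous base}.
Proof.
apply: scale_continuous; last exact: toZ_continuous.
apply: (for_cvg_comp (h := expR)); last exact: continuous_expR.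
exact: cvgN (@level_cont w).
Qed.

Let C : set V := phi @` (@circle R `*` setT).

Lemma foliated_cylinder :
  invariant_cylinder_foliated_by_periodic_orbits
    (chazy_trajectory m.+1 (m.+1%:R + 1)) C.
Proof.
have l0 s : 0 <= expR s :> R by exact: expR_ge0.
have lq s : 0 < expR s ^+ m.+1 :> R by rewrite exprn_gt0// expR_gt0.
split.
  move=> J h oJ iJ th t0 Jt0 [[u s] [/= cu _] E] t Jt.
  (* The time shift places the scaled orbit at [phi (u, s)] at time [t0]; by uniqueness [h] follows
     it and stays on the same circle. *)
  have := chazy_unique (scale_solution (orbit_time u - expR s ^+ m.+1 * t0) (l0 s) dg)
    oJ iJ th Jt0 _ Jt.
  rewrite -E /phi ofZK (addrC (_ * t0)) subrK => /(_ erefl) ->.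
  set r := _ + _; have [v cv Ev] := psi_onto r.
  by exists (v, s) => //; rewrite /phi /= Ev.
have [|chi [chiK chiP chi_cont]] := compact_inverse ((1, 0) : R * R)
    (@norm_hausdorff _ V) circle_compact _ psi_inj.
  by apply/subspace_continuousP => u cu; apply: cvg_within_filter; exact: psi_cont.
exists phi; split.
  split.
  - split; first by move=> w Aw; exists w.
      move=> [u s] [v s']; rewrite !inE => -[/= cu _] [/= cv _] E.
      have := levelK (u, s); rewrite E levelK /= => <-.
      have := base_phi (u, s); rewrite E base_phi /= => Euv.
      by congr pair; apply: psi_inj; rewrite ?inE.
    by move=> p [w Aw <-]; exists w.
  - by apply/subspace_continuousP => w [cw _]; apply: cvg_within_filter; exact: phi_cont.
  (* The inverse reads off the height, undoes the scaling, and then inverts [psi] on the compact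
     circle. *)
  exists (fun p => (chi (base p), level p)); last first.
    by move=> [u s]; rewrite inE => -[/= cu _]; rewrite base_phi levelK chiK.
  apply/subspace_continuousP => _ [w [cw _] <-].
  have H2 : level p @[p --> within C (nbhs (phi w))] --> level (phi w).
    by apply: cvg_within_filter; exact: level_cont.
  have H1 : chi (base p) @[p --> within C (nbhs (phi w))] --> chi (base (phi w)).
    have Kw : (psi @` @circle R) (base (phi w)) by rewrite base_phi; exists w.1.
    move: chi_cont => /subspace_continuousP /(_ _ Kw) H N /H HN.
    have HN' : nbhs (phi w) [set p | (psi @` @circle R) (base p) -> N (chi (base p))] :=
      @base_cont w _ HN.
    suff : nbhs (phi w) [set p | C p -> N (chi (base p))] by [].
    apply: filterS HN' => p hp [w' [cw' _] Ew'].
    by apply: hp; rewrite -Ew' base_phi; exists w'.1.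
  rewrite /from_subspace; exact: (cvg_pair H1 H2).
move=> s.
exists (fun t => ofZ m (scale m (expR s) (g (expR s ^+ m.+1 * t + 0)))), (2 * L / expR s ^+ m.+1).
split.
- apply: (chazy_trajectory_of_solution (scale_solution 0 (l0 s) dg)) => t /= /eqP.
  rewrite mulf_eq0 gt_eqF ?expR_gt0//= => /eqP/transversal.
  by apply: contra; rewrite mulf_eq0 expf_eq0 gt_eqF ?expR_gt0 ?andbF.
- by rewrite divr_gt0// mulr_gt0.
- move=> t; congr (ofZ m (scale m _ _)); rewrite -[RHS]g2L; congr g.
  by move: (lq s) => lq0; field; rewrite gt_eqF.
(* A quarter of the period after time 0 the orbit has [x > 0], whereas [x = 0] at time 0. *)
- exists (L / 2 / expR s ^+ m.+1); move=> /(congr1 (fun p => p.1.1)) /=.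
  have -> : expR s ^+ m.+1 * (L / 2 / expR s ^+ m.+1) = L / 2.
    by move: (lq s) => lq0; field; rewrite gt_eqF.
  rewrite !addr0 mulr0 gx0 mulr0 => /eqP.
  rewrite mulf_eq0 gt_eqF ?expR_gt0//= gt_eqF//; apply: gxpos.
  by apply/andP; split; move: L0; lra.
apply/seteqP; split => [_ [[u s'] [/= cu ->] <-]|_ [t _ <-]].
  exists (orbit_time u / expR s ^+ m.+1) => //.
  by rewrite addr0 (mulrC (_ ^+ _)) divfK ?gt_eqF.
have [u cu Eu] := psi_onto (expR s ^+ m.+1 * t + 0).
by exists (u, s) => //; rewrite /phi /= Eu.
Qed.

End orbit.
End foliation.

Theorem theorem1 (R : realType) (q : nat) (k : R)
    (hq : q \in [:: 1; 2; 3]%N) (hk : k = q%:R + 1) :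
  exists C : set (phase_space R),
    invariant_cylinder_foliated_by_periodic_orbits (chazy_trajectory q k) C.
Proof.
case: q hq hk => [//|m] _ ->.
have [g [L [L0 dg [gL e0] [gx0 gy0 gxpos] en]]] := @periodic_solution R m.
eexists; exact: foliated_cylinder L0 dg gL e0 gx0 gy0 gxpos en.
Qed.
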